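(* Let $Z_0\subset\mathbb{P}^2$ be the configuration of nine points described in the context. Up to projective equivalence, $Z_0$ is the only configuration of points in $\mathbb{P}^2$ which admits an unexpected curve of degree four. That is, a finite set of distinct points $Z\subset\mathbb{P}^2$ admits an unexpected curve of degree $4$ if and only if $Z$ is projectively equivalent to $Z_0$.
   Context: We work over $\mathbb{C}$, and $\mathbb{P}^2=\mathbb{P}^2_{\mathbb{C}}$ with coordinate ring $\mathbb{C}[x,y,z]$. For distinct points $P_1,\dots,P_r$ with ideals $I_1,\dots,I_r$ and integers $m_i\ge 0$, the fat point scheme $X=m_1P_1+\dots+m_rP_r$ has ideal $I(X)=I_1^{m_1}\cap\dots\cap I_r^{m_r}$, and $I(X)_d$ is its homogeneous component of degree $d$ (a complex vector space). A finite set $Z$ of distinct points is identified with the scheme in which all its points have multiplicity $1$, and $Z+mP$ denotes the scheme obtained by adding a point $P$ with multiplicity $m$. A statement holds for a general $P\in\mathbb{P}^2$ if it holds for all $P$ in some nonempty Zariski open subset. A finite set of distinct points $Z\subset\mathbb{P}^2$ admits an unexpected curve of degree $d$ if $\dim I(Z+(d-1)P)_d>\max\{\dim I(Z)_d-\binom{d}{2},0\}$ for a general $P\in\mathbb{P}^2$. Two subsets of $\mathbb{P}^2$ are projectively equivalent if some element of $PGL_3(\mathbb{C})$ maps one onto the other. The configuration $Z_0=\{Z_1,\dots,Z_9\}$: let $Z_1,Z_2,Z_3,Z_4$ be four points, no three collinear. The six lines joining pairs of them determine three further intersection points $Z_5,Z_6,Z_7$ (the intersections of the three pairs of opposite lines).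 Take the line through two of these three points, say $Z_6$ and $Z_7$. Besides $Z_6$ and $Z_7$, this line meets the six lines in two further points, called $Z_8$ and $Z_9$. Up to projective equivalence this configuration is unique; explicitly one can take $Z_1=[-1,0,1]$, $Z_2=[0,-1,1]$, $Z_3=[1,0,1]$, $Z_4=[0,1,1]$, $Z_5=[0,0,1]$, $Z_6=[1,-1,0]$, $Z_7=[1,1,0]$, $Z_8=[0,1,0]$, $Z_9=[1,0,0]$. *)

(* Defs.v *)
From HB Require Import structures.
From mathcomp Require Import all_boot all_order all_algebra.
From mathcomp Require Import finmap multiset mpoly complex.
From mathcomp Require Import boolp reals.

Set Implicit Arguments.
Unset Strict Implicit.
Unset Printing Implicit Defensive.

Import Order.TTheory GRing.Theory Num.Theory.
Local Open Scope fset_scope.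
Local Open Scope mset_scope.
Local Open Scope ring_scope.

Section SubspaceOfProp.
Variables (K : fieldType) (V : vectType K) (S : V -> Prop).

Lemma vspace_of_prop :
  S 0 -> (forall a u v, S u -> S v -> S (a *: u + v)) ->
  exists U : {vspace V}, forall v, v \in U <-> S v.
Proof.
move=> S0 SD.
pose Q k := `[< exists U : {vspace V}, \dim U = k /\ forall v, v \in U -> S v >].
have Q0 : exists k, Q k.
  exists 0%N; apply/asboolP; exists 0%VS; split; first exact: dimv0.
  by move=> v; rewrite memv0 => /eqP->.
have Qb k : Q k -> (k <= \dim {:V})%N.
  by move=> /asboolP[U [<- _]]; apply/dimvS/subvf.
case: (ex_maxnP Q0 Qb) => k /asboolP[U [dU US]] kmax.
exists U => v; split; first exact: US.
move=> Sv; have US' w : w \in (U + <[v]>)%VS -> S w.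
  case/memv_addP=> u uU [_ /vlineP[a ->] ->].
  by rewrite addrC; apply: SD => //; apply: US.
have /kmax le : Q (\dim (U + <[v]>)%VS) by apply/asboolP; exists (U + <[v]>)%VS.
have /eqP -> : U == (U + <[v]>)%VS by rewrite eqEdim addvSl dU.
by apply: (subvP (addvSr _ _)); apply: memv_line.
Qed.

End SubspaceOfProp.

Section ProjectivePlane.
Variable K : fieldType.

(* A point of the projective plane is a line through the origin of K^3. *)
Record P2 := Point2 { line_of :> {vspace 'rV[K]_3}; _ : \dim line_of == 1%N }.
HB.instance Definition _ := [isSub for line_of].
HB.instance Definition _ := [Choice of P2 by <:].

Definition row3 (a b c : K) : 'rV[K]_3 := \row_(i < 3) [:: a; b; c]`_i.

Lemma row3_eq0 a b c : (row3 a b c == 0) = [&& a == 0, b == 0 & c == 0].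
Proof.
apply/eqP/and3P => [r0|[/eqP-> /eqP-> /eqP->]].
  have e (i : 'I_3) : [:: a; b; c]`_i == 0.
    by have /rowP/(_ i) := r0; rewrite !mxE => ->.
  by split; [exact: (e (@Ordinal 3 0 isT)) | exact: (e (@Ordinal 3 1 isT))
            | exact: (e (@Ordinal 3 2 isT))].
by apply/rowP => -[[|[|[|]]] //= ?]; rewrite !mxE.
Qed.

Fact origin_subproof : \dim <[row3 0 0 1]> == 1%N.
Proof. by rewrite dim_vline row3_eq0 oner_eq0 !andbF. Qed.

(* The point [a : b : c]; pt 0 0 0 is a junk value. *)
Definition pt (a b c : K) : P2 :=
  insubd (Point2 origin_subproof) <[row3 a b c]>%VS.

Lemma line_of_pt a b c : ~~ [&& a == 0, b == 0 & c == 0] ->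
  line_of (pt a b c) = <[row3 a b c]>%VS.
Proof.
by move=> nz; apply: (@insubdK _ _ P2); rewrite unfold_in dim_vline row3_eq0 nz.
Qed.

Definition projectively_equivalent (Z W : {fset P2}) : Prop :=
  exists2 g : 'M[K]_3, g \in unitmx &
    [fset (linfun (mulmxr g) @: line_of P)%VS | P in Z]
      = [fset line_of P | P in W].

(* When f is homogeneous, one nonzero v on the line P is enough. *)
Definition vanishes_at (f : {mpoly K[3]}) (P : P2) : Prop :=
  forall v : 'rV[K]_3, v \in line_of P -> f.@[v 0] = 0.

Definition homogeneous (f : {mpoly K[3]}) : Prop := exists d, f \is d.-homog.

Definition zariski_closed (A : P2 -> Prop) : Prop :=
  exists2 S : {mpoly K[3]} -> Prop, (forall f, S f -> homogeneous f) &
    forall P, A P <-> forall f, S f -> vanishes_at f P.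

Definition zariski_open (A : P2 -> Prop) : Prop :=
  zariski_closed (fun P => ~ A P).

Definition for_general_point (Q : P2 -> Prop) : Prop :=
  exists A : P2 -> Prop,
    [/\ zariski_open A, (exists P, A P) & forall P, A P -> Q P].

Inductive ideal_gen (S : {mpoly K[3]} -> Prop) : {mpoly K[3]} -> Prop :=
| ideal_gen_incl f : S f -> ideal_gen S f
| ideal_gen0 : ideal_gen S 0
| ideal_genD f g : ideal_gen S f -> ideal_gen S g -> ideal_gen S (f + g)
| ideal_genM h f : ideal_gen S f -> ideal_gen S (h * f).

Definition ideal_mul (I J : {mpoly K[3]} -> Prop) : {mpoly K[3]} -> Prop :=
  ideal_gen (fun h => exists f g, [/\ I f, J g & h = f * g]).

Definition ideal_exp (I : {mpoly K[3]} -> Prop) (m : nat) :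
  {mpoly K[3]} -> Prop := iter m (ideal_mul I) (fun=> True).

Definition point_ideal (P : P2) : {mpoly K[3]} -> Prop :=
  ideal_gen (fun f => homogeneous f /\ vanishes_at f P).

(* The fat point scheme m_1 P_1 + ... + m_r P_r is the multiset X in which P_i
   has multiplicity m_i. Points outside the support contribute
   point_ideal P ^ 0, the unit ideal. *)
Definition fat_ideal (X : {mset P2}) (f : {mpoly K[3]}) : Prop :=
  forall P : P2, ideal_exp (point_ideal P) (X P) f.

Fact fat_ideal_deg_subproof (X : {mset P2}) (d : nat) :
  exists U : {vspace dhomog 3 K d},
    forall f, f \in U <-> fat_ideal X (mpoly_of_dhomog f).
Proof.
have expE P m (f g h : {mpoly K[3]}) : ideal_exp (point_ideal P) m f ->
    ideal_exp (point_ideal P) m g -> ideal_exp (point_ideal P) m (h * f + g).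
  case: m => [//|m] If Ig; apply: ideal_genD => //; exact: ideal_genM.
apply: vspace_of_prop => [P|a u v Xu Xv P].
  by case: (X P) => [//|m]; apply: ideal_gen0.
have -> : mpoly_of_dhomog (a *: u + v)
    = a%:MP_[3] * mpoly_of_dhomog u + mpoly_of_dhomog v by rewrite mul_mpolyC.
exact: expE.
Qed.

(* I(X)_d *)
Definition fat_ideal_deg (X : {mset P2}) (d : nat) : {vspace dhomog 3 K d} :=
  projT1 (cid (fat_ideal_deg_subproof X d)).

Lemma fat_ideal_degP X d (f : dhomog 3 K d) :
  f \in fat_ideal_deg X d <-> fat_ideal X (mpoly_of_dhomog f).
Proof. exact: (projT2 (cid (fat_ideal_deg_subproof X d))). Qed.

(* Meant for 0 < d: the predecessor d.-1 is truncated at 0. *)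
Definition admits_unexpected_curve (Z : {fset P2}) (d : nat) : Prop :=
  for_general_point (fun P =>
    Num.max ((\dim (fat_ideal_deg (seq_mset Z) d))%:Z - 'C(d, 2)%:Z) 0
      < (\dim (fat_ideal_deg (seq_mset Z `+` msetn d.-1 P) d))%:Z).

(* The first four points are in general position, the next three are the
   intersections of the pairs of opposite lines through them, and the last two
   are where the line through the sixth and seventh points meets the two
   remaining lines, those through the first and third and through the second
   and fourth points. *)
Definition Z0 : {fset P2} :=
  [fset pt (-1) 0 1; pt 0 (-1) 1; pt 1 0 1; pt 0 1 1; pt 0 0 1;
        pt 1 (-1) 0; pt 1 1 0; pt 0 1 0; pt 1 0 0].

End ProjectivePlane.

(* Main.v *)
(** In an affine chart, a quartic with a triple point at [P = (p, q)] restricts to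
    the line of slope [m] through [P] as [t^3 (c(m) + t c'(m))], with [c] and [c'] of
    degrees at most 3 and 4, and it contains a point [(x, y)] of slope [m] iff
    [c(m) + (x - p) c'(m) = 0]. If such a quartic exists for general [P], then [c] and
    [c'] can be chosen polynomial in [p] and [q]. Let [D = d/dp + m d/dq]. The
    polynomial [c' (D c - c') - c D c'] has degree at most 8 in [m] and vanishes at the
    slopes of the at least nine points of [Z], hence it vanishes. By a Wronskian
    argument, the residual intersection of the quartic with a line through [P] depends
    on the line only. As [P] tends to a point [z] of [Z], the quartic degenerates to a
    nonzero polynomial [N(m)] of degree at most 4 which vanishes at the slopes of all
    the lines joining [z] to [Z], and the first order term shows that these are not
    four lines with at least two further points each. Hence [z] lies on at most four
    such lines, and, if there are nine points, on one with four points of [Z]. These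
    incidences force the configuration. Five collinear points are impossible because
    their line splits off. Fewer than nine points are completed with general points to
    nine points, which is impossible as the configuration contains no general point.
    Conversely, [x |-> \sum_i x_i ((P x x)_i)^3], with [P x x] the cross product, is a
    quartic with a triple point at [P] through [Z0], and the nine points of [Z0] impose
    independent conditions on quartics. *)

From HB Require Import structures.
Require Import Defs.
From mathcomp Require Import all_boot all_order all_algebra.
From mathcomp Require Import finmap complex reals.
From mathcomp Require Import multiset mpoly boolp.
From mathcomp Require Import ring zify.

Set Implicit Arguments.
Unset Strict Implicit.
Unset Printing Implicit Defensive.

Import Order.TTheory GRing.Theory Num.Theory.

(** * Nine points with four-point lines *)

(** The hypothesis supplies one curve for each general [P], with no relation between the curves of
    different points, while the argument differentiates in [P]; hence the passage to a kernel vector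
    with entries polynomial in [p] and [q]. The residual point of the line of slope [m] has first
    coordinate [p - c / c'], and the polynomial formed from [c], [c'] and [D] is, up to sign, the
    numerator of its derivative along that line. For curves of degree [d] it has degree at most
    [2 d] in [m] and vanishes at [d + 5] slopes, which kills it exactly for [d <= 4]. Degrees below
    4 enter because the line from [P] to a point of [Z] may split off. The number nine comes from
    [15 - 9 = 6]: quartics through nine points have at least the dimension that a triple point is
    expected to use up, so with fewer conditions an unexpected quartic can be made to pass through
    further fixed points. The chart has pairwise distinct first coordinates on [Z], so every line
    joining two points of [Z] has a finite slope. Identities are cross multiplied instead of divided
    by [c'], which may vanish. *)

Ltac split_andb := repeat match goal with H : is_true (_ && _) |- _ =>
  let H1 := fresh in let H2 := fresh in case/andP: H => H1 H2 end.
Ltac neq_from_context := rewrite ?inE ?negb_or; repeat (apply/andP; split);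
  solve [assumption | rewrite eq_sym; assumption | done].

Section Configuration.
Variables (T : eqType) (col : T -> T -> T -> bool) (S : seq T).
Hypotheses (colC : forall a b c, col a b c = col b a c)
           (colR : forall a b c, col a b c = col a c b)
           (col_refl : forall a b, col a a b)
           (col_trans : forall a b c d, a != b -> col a b c -> col a b d -> col a c d).
Hypothesis no5 : forall a b, a \in S -> b \in S -> a != b -> (count (col a b) S <= 4)%N.
Hypothesis uS : uniq S.
(** A form of the bound by four on the number of lines that join [z] to the other points, stated
    without sets of lines. *)
Hypothesis lines4 : forall z s, z \in S -> size s = 5 -> uniq s -> {subset s <= S} -> z \notin s ->
  exists a b, [/\ a \in s, b \in s, a != b & col z a b].

Lemma col_refl2 a b : col a b a. Proof. by rewrite colR col_refl. Qed.
Lemma col_refl3 a b : col a b b. Proof. by rewrite colC col_refl2. Qed.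

Definition fourline l := [/\ size l = 4, uniq l, {subset l <= S} &
  forall a b c, a \in l -> b \in l -> c \in l -> col a b c].

Lemma fourlineI a b c d : uniq [:: a; b; c; d] -> {subset [:: a; b; c; d] <= S} ->
  col a b c -> col a b d -> fourline [:: a; b; c; d].
Proof.
move=> u sub abc abd; have ab : a != b by move: u; rewrite /= !inE; case: (a == b).
have base x : x \in [:: a; b; c; d] -> col a b x.
  by rewrite !inE => /or4P[] /eqP-> //; [exact: col_refl2 | exact: col_refl3].
split=> // x y z /base hx /base hy /base hz.
have [xa|xa] := eqVneq a x; first by rewrite -xa; apply: col_trans ab _ _.
have axy := col_trans ab hx hy; have axz := col_trans ab hx hz.
by apply: (@col_trans x a); rewrite 1?eq_sym // colC.
Qed.

Lemma fourline_out l x y z : fourline l -> x \in l -> y \in l -> x != y ->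
  z \in S -> z \notin l -> col x y z = false.
Proof.
move=> [szl ul lS hl] xl yl xy zS zl; apply/negP => xyz.
have := no5 (lS x xl) (lS y yl) xy; rewrite leqNgt -size_filter => /negP; apply.
rewrite -szl -/(size (z :: l)); apply: uniq_leq_size; first by rewrite /= zl.
move=> w; rewrite inE mem_filter => /predU1P[->|wl]; first by rewrite xyz.
by rewrite hl // lS.
Qed.

(** The incidence pattern of the positive roots of type $B_3$: [a1], [a2], [a5] are the vertices of
    a triangle, the other six points lie in pairs on its sides, and the four three-point lines form
    a complete quadrilateral with these six as vertices. *)
Definition B3_configuration s := exists a1 a2 a3 a4 a5 a6 a7 a8 a9,
  [/\ s = [:: a1; a2; a3; a4; a5; a6; a7; a8; a9],
   fourline [:: a1; a2; a3; a4], fourline [:: a1; a5; a6; a7], fourline [:: a2; a5; a8; a9] &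
   [/\ col a3 a6 a8, col a3 a7 a9, col a4 a6 a9 & col a4 a7 a8]].

(** A line from [a6] or [a7] to [a8] or [a9] meets the first four-point line in [a3] or [a4], since
    [a1] and [a2] are excluded by the other two four-point lines. Two different such lines with a
    common endpoint cannot use the same one of [a3] and [a4], so the choice for the pair [a6], [a8]
    determines the other three, up to swapping [a3] and [a4]. *)
Lemma B3_from_fourlines a1 a2 a3 a4 a5 a6 a7 a8 a9 :
  uniq [:: a1; a2; a3; a4; a5; a6; a7; a8; a9] ->
  fourline [:: a1; a2; a3; a4] -> fourline [:: a1; a5; a6; a7] -> fourline [:: a2; a5; a8; a9] ->
  (forall t x, t \in [:: a5; a6; a7; a8; a9] -> x \in S -> x != t ->
     exists2 y, y \in [:: a1; a2; a3; a4] & col t y x) ->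
  exists2 s, B3_configuration s & perm_eq s [:: a1; a2; a3; a4; a5; a6; a7; a8; a9].
Proof.
move=> U L1 L2 L3 meet.
have [_ _ S1 _] := L1; have [_ _ S2 _] := L2; have [_ _ S3 _] := L3.
have U' := U; rewrite /= !inE !negb_or !andbT in U'; split_andb.
have o2 x y z := fourline_out (x := x) (y := y) (z := z) L2.
have o3 x y z := fourline_out (x := x) (y := y) (z := z) L3.
have i1 : a1 \in S by apply: S1; rewrite !inE eqxx ?orbT.
have i2 : a2 \in S by apply: S1; rewrite !inE eqxx ?orbT.
have i6 : a6 \in S by apply: S2; rewrite !inE eqxx ?orbT.
have i7 : a7 \in S by apply: S2; rewrite !inE eqxx ?orbT.
have i8 : a8 \in S by apply: S3; rewrite !inE eqxx ?orbT.
have i9 : a9 \in S by apply: S3; rewrite !inE eqxx ?orbT.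
have third t x : t \in [:: a6; a7] -> x \in [:: a8; a9] -> col a3 t x \/ col a4 t x.
  move=> ht hx; have xS : x \in S by move: hx; rewrite !inE => /orP[]/eqP->.
  have tx : x != t by move: hx ht; rewrite !inE => /orP[]/eqP-> /orP[]/eqP->; neq_from_context.
  have [|y hy] := meet t x _ xS tx.
    by move: ht; rewrite !inE => /orP[]/eqP->; rewrite eqxx ?orbT.
  rewrite colC => c; move: hy; rewrite !inE => /or4P[]/eqP e; rewrite e in c.
  - move: c; rewrite o2 // ?inE ?eqxx //.
    + by move: ht; rewrite !inE => /orP[]/eqP->; rewrite eqxx ?orbT.
    + by move: ht; rewrite !inE => /orP[]/eqP->; neq_from_context.
    + by move: hx; rewrite !inE => /orP[]/eqP->; neq_from_context.
  - move: c; rewrite colR o3 // ?inE ?eqxx //.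
    + by move: hx; rewrite !inE => /orP[]/eqP->; rewrite eqxx ?orbT.
    + by move: hx; rewrite !inE => /orP[]/eqP->; neq_from_context.
    + by move: ht; rewrite !inE => /orP[]/eqP->.
    + by move: ht; rewrite !inE => /orP[]/eqP->; neq_from_context.
  - by left.
  - by right.
have n67 y x : y != x -> x \in [:: a8; a9] -> col y a6 x -> col y a7 x -> False.
  move=> yx hx c6 c7; have : col x a6 a7.
    by apply: (@col_trans x y); rewrite 1?eq_sym // colC colR.
  have xS : x \in S by move: hx; rewrite !inE => /orP[]/eqP->.
  rewrite colC colR o2 // ?inE ?eqxx ?orbT //.
  by move: hx; rewrite !inE => /orP[]/eqP->; neq_from_context.
have n89 y t : y != t -> t \in [:: a6; a7] -> col y t a8 -> col y t a9 -> False.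
  move=> yt ht c8 c9; have : col t a8 a9.
    by apply: (@col_trans t y); rewrite 1?eq_sym // colC.
  have tS : t \in S by move: ht; rewrite !inE => /orP[]/eqP->.
  rewrite colC colR o3 // ?inE ?eqxx ?orbT //.
  by move: ht; rewrite !inE => /orP[]/eqP->; neq_from_context.
have e6 : a6 \in [:: a6; a7] by rewrite inE eqxx.
have e7 : a7 \in [:: a6; a7] by rewrite !inE eqxx orbT.
have e8 : a8 \in [:: a8; a9] by rewrite inE eqxx.
have e9 : a9 \in [:: a8; a9] by rewrite !inE eqxx orbT.
have [c68|c68] := third _ _ e6 e8.
  exists [:: a1; a2; a3; a4; a5; a6; a7; a8; a9] => //.
  exists a1, a2, a3, a4, a5, a6, a7, a8, a9; split => //; split => //.
  - have [c78|c78] := third _ _ e7 e8; first by case: (@n67 a3 a8).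
    by have [//|c79] := third _ _ e7 e9; case: (@n89 a4 a7).
  - by have [c69|//] := third _ _ e6 e9; case: (@n89 a3 a6).
  - by have [c78|//] := third _ _ e7 e8; case: (@n67 a3 a8).
exists [:: a1; a2; a4; a3; a5; a6; a7; a8; a9]; last first.
  by rewrite !perm_cons; apply: (permEl (perm_catCA [:: a4] [:: a3] _)).
exists a1, a2, a4, a3, a5, a6, a7, a8, a9; split => //; last split => //.
- have [_ u1 _ _] := L1; apply: fourlineI.
  + by move: u1; rewrite /= !inE !negb_or; case/and4P => /and3P[-> -> ->] /andP[-> ->]; rewrite eq_sym => ->.
  + by move=> x; rewrite !inE => h; apply: S1; rewrite !inE; case/or4P: h => ->; rewrite ?orbT.
  + by case: L1 => _ _ _; apply; rewrite !inE eqxx ?orbT.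
  + by case: L1 => _ _ _; apply; rewrite !inE eqxx ?orbT.
- have [c78|c78] := third _ _ e7 e8; last by case: (@n67 a4 a8).
  by have [c79|//] := third _ _ e7 e9; case: (@n89 a3 a7).
- by have [//|c69] := third _ _ e6 e9; case: (@n89 a4 a6).
- by have [//|c78] := third _ _ e7 e8; case: (@n67 a4 a8).
Qed.

Lemma fourline_perm l l' : perm_eq l l' -> fourline l -> fourline l'.
Proof.
move=> ll' [szl ul lS hl]; have mem := perm_mem ll'; split.
- by rewrite -(perm_size ll').
- by rewrite -(perm_uniq ll').
- by move=> x; rewrite -mem => /lS.
- by move=> x y z; rewrite -!mem; apply: hl.
Qed.

Lemma perm_complement (s t : seq T) : uniq s -> uniq t -> {subset t <= s} ->
  perm_eq s (t ++ filter (fun x => x \notin t) s).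
Proof.
move=> us ut ts; apply: uniq_perm => //.
  rewrite cat_uniq ut filter_uniq // andbT; apply/hasPn => x.
  by rewrite mem_filter => /andP[].
move=> x; rewrite mem_cat mem_filter; by case: (boolP (x \in t)) => [/ts ->|].
Qed.

(** Fix a four-point line [L] with complement [U]. By [lines4] for [x :: L], every line joining a
    point of [U] to another point of [S] meets [L] inside [S], so a four-point line through a point
    of [U] has exactly three points in [U]. Two different such triples among the five points of [U]
    share one point [o], and [L] closes the triangle. *)
Lemma B3_of_nine : size S = 9 ->
  (forall z, z \in S -> exists2 l, fourline l & z \in l) ->
  exists2 s, B3_configuration s & perm_eq s S.
Proof.
move=> sS fl; have [z zS] : exists z, z \in S by case: (S) sS => // z ? _; exists z; apply: mem_head.
have [L LL _] := fl z zS; have [sL uL LS hL] := LL.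
pose U := filter (fun x => x \notin L) S; have pU := perm_complement uS uL LS; rewrite -/U in pU.
have uU : uniq U by apply: filter_uniq.
have sU : size U = 5 by have := perm_size pU; rewrite size_cat sS sL => -[].
have US x : x \in U -> x \in S by rewrite mem_filter => /andP[].
have UL x : x \in U -> x \notin L by rewrite mem_filter => /andP[].
have UI x : x \in S -> x \notin L -> x \in U by rewrite mem_filter => -> ->.
have neqLU x y : x \in L -> y \in U -> x != y.
  by move=> xL /UL; apply: contraNneq => <-.
have meet t x : t \in U -> x \in S -> x != t -> exists2 y, y \in L & col t y x.
  move=> tU xS xt; have [xL|xL] := boolP (x \in L); first by exists x; rewrite ?col_refl3.
  have [||||a [b []]] := @lines4 t (x :: L) (US t tU).
  - by rewrite /= sL.
  - by rewrite /= xL.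
  - by move=> y; rewrite inE => /predU1P[->|/LS].
  - by rewrite inE eq_sym (negPf xt) (negPf (UL t tU)).
  rewrite !inE => /predU1P[->|aL] /predU1P[->|bL] ab c.
  - by rewrite eqxx in ab.
  - by exists b; rewrite // colR.
  - by exists a.
  - by move: c; rewrite colC colR (fourline_out LL aL bL ab (US t tU) (UL t tU)).
have tri t : t \in U -> exists p q y, [/\ p \in U, q \in U, y \in L & fourline [:: t; p; q; y]].
  move=> tU; have [M LM tM] := fl t (US t tU); have [sM uM MS hM] := LM.
  have pM := perm_to_rem tM; set M1 := rem t M in pM.
  have sM1 : size M1 = 3 by have := perm_size pM; rewrite sM => -[].
  have M1M x : x \in M1 -> x \in M by apply: mem_rem.
  have uM1 : t \notin M1 /\ uniq M1 by have := perm_uniq pM; rewrite uM /= => /esym/andP.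
  have [x xM1] : exists x, x \in M1 by case: (M1) sM1 => // x ? _; exists x; apply: mem_head.
  have xt : x != t by apply: contraTneq xM1 => ->; case: uM1.
  have [y yL txy] := meet t x tU (MS x (M1M x xM1)) xt.
  have yt := neqLU _ _ yL tU.
  have yM : y \in M.
    apply/negPn/negP => yM; move: txy; rewrite colR.
    by rewrite (fourline_out LM tM (M1M x xM1) _ (LS y yL) yM) // eq_sym.
  have yM1 : y \in M1.
    by have := perm_mem pM y; rewrite yM inE (negPf yt) => /esym.
  have pM1 := perm_to_rem yM1; set M2 := rem y M1 in pM1.
  have uM2 : y \notin M2 /\ uniq M2 by have := perm_uniq pM1; rewrite uM1.2 /= => /esym/andP.
  have sM2 : size M2 = 2 by have := perm_size pM1; rewrite sM1 => -[].
  have M2U p : p \in M2 -> p \in U.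
    move=> pM2; have pMM : p \in M by apply/M1M/(mem_rem pM2).
    apply: UI (MS _ pMM) _; apply/negP => pL.
    have py : p != y by apply: contraTneq pM2 => ->; case: uM2.
    have := hM p y t pMM yM tM; rewrite (fourline_out LL pL yL py (US t tU)) //.
    exact: UL.
  case: M2 sM2 pM1 M2U {uM2} => [|p [|q []]] // _ pM1 M2U; exists p, q, y; split => //.
  - by apply: M2U; rewrite mem_head.
  - by apply: M2U; rewrite !inE eqxx orbT.
  apply: fourline_perm LM; apply: perm_trans pM _; rewrite perm_cons.
  by apply: perm_trans pM1 _; rewrite -[y :: _]cat1s perm_catC.
have [t tU] : exists t, t \in U by case: (U) sU => // t ? _; exists t; apply: mem_head.
have [p [q [y [pU' qU yL LM]]]] := tri t tU; have [_ uM _ hM] := LM.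
have utpq : uniq [:: t; p; q].
  by move: uM; rewrite /= !inE !negb_or -!andbA; case/and5P => -> -> _ -> _.
have stpq : {subset [:: t; p; q] <= U} by move=> x; rewrite !inE => /or3P[]/eqP->.
have pU3 := perm_complement uU utpq stpq; set R := filter _ U in pU3.
have sR : size R = 2 by have := perm_size pU3; rewrite size_cat sU => -[].
case: R sR pU3 => [|d [|e []]] // _ pU3.
have dU : d \in U by rewrite (perm_mem pU3) !inE eqxx ?orbT.
have eU : e \in U by rewrite (perm_mem pU3) !inE eqxx ?orbT.
have u5 : uniq [:: t; p; q; d; e] by rewrite -(perm_uniq pU3).
have dM : d \notin [:: t; p; q; y].
  move: u5; rewrite /= !inE !negb_or => h; split_andb.
  by have := neqLU _ _ yL dU => ?; neq_from_context.
have [p' [q' [y' [p'U q'U y'L LN]]]] := tri d dU.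
(* The four-point line of [d] contains [e]: otherwise it would share two points with the line of
   [t], which does not contain [d]. *)
have [o [oM LN']] : exists o, o \in [:: t; p; q] /\ fourline [:: d; o; e; y'].
  have [_ uN _ hN] := LN.
  have inM x : x \in U -> x != d -> x != e -> x \in [:: t; p; q].
    by rewrite (perm_mem pU3) /= !inE => /or4P[->|->|->|/orP[->|->]] //; rewrite ?orbT.
  have Uneq := uN; rewrite /= !inE !negb_or in Uneq; split_andb.
  have [e1|p'e] := eqVneq p' e.
    exists q'; split; first by apply: inM; [done | rewrite eq_sym | rewrite -e1 eq_sym].
    by apply: fourline_perm LN; rewrite e1 perm_cons; apply: (permEl (perm_catCA [:: _] [:: _] _)).
  have [e1|q'e] := eqVneq q' e.
    by exists p'; split; [apply: inM; rewrite // eq_sym | rewrite -e1].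
  have p'M : p' \in [:: t; p; q; y].
    by rewrite -[[:: t; p; q; y]]/([:: t; p; q] ++ [:: y]) mem_cat inM // eq_sym.
  have q'M : q' \in [:: t; p; q; y].
    by rewrite -[[:: t; p; q; y]]/([:: t; p; q] ++ [:: y]) mem_cat inM // eq_sym.
  have := hN p' q' d; rewrite (fourline_out LM p'M q'M) //; last exact: US.
  by rewrite !inE !eqxx ?orbT => /(_ isT isT isT).
have [_ uN _ hN] := LN'.
have oU : o \in U by apply: stpq.
have yy' : y != y'.
  apply/eqP => e1; have := hN o y' d; rewrite !inE !eqxx ?orbT => /(_ isT isT isT).
  rewrite (fourline_out LM _ _ _ _ dM) //; last exact: US.
  - by rewrite -[[:: t; p; q; y]]/([:: t; p; q] ++ [:: y]) mem_cat oM.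
  - by rewrite -e1 !inE eqxx ?orbT.
  - by rewrite eq_sym; apply: neqLU.
have uyy' : uniq [:: y; y'] by rewrite /= inE yy'.
have syy' : {subset [:: y; y'] <= L} by move=> x; rewrite !inE => /orP[]/eqP->.
have pL := perm_complement uL uyy' syy'; set R := filter _ L in pL.
have sR : size R = 2 by have := perm_size pL; rewrite size_cat sL => -[].
case: R sR pL => [|a3 [|a4 []]] // _ pL.
have [f [g pofg]] : exists f g, perm_eq [:: t; p; q] [:: o; f; g].
  have := perm_to_rem oM; set R := rem o _ => pR.
  have sR : size R = 2 by have := perm_size pR => -[].
  by case: R sR pR => [|f [|g []]] // _ pR; exists f, g.
have pU5 : perm_eq U [:: o; f; g; d; e].
  apply: perm_trans pU3 _; rewrite -[X in perm_eq _ X]/([:: o; f; g] ++ [:: d; e]).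
  by rewrite perm_cat2r.
have pS : perm_eq S ([:: y; y'; a3; a4] ++ [:: o; f; g; d; e]).
  by apply: perm_trans pU _; apply: perm_cat.
have [|||||s Bs ps] := @B3_from_fourlines y y' a3 a4 o f g d e.
- by rewrite -(perm_uniq pS).
- exact: fourline_perm LL.
- apply: fourline_perm LM; rewrite -[[:: t; p; q; y]]/([:: t; p; q] ++ [:: y]) perm_catC perm_cons.
  exact: pofg.
- apply: fourline_perm LN'; rewrite -[X in perm_eq X _]/([:: d; o; e] ++ [:: y']) perm_catC perm_cons.
  exact: (permEl (perm_catCA [:: d] [:: o] _)).
- move=> x w; rewrite -(perm_mem pU5) => xU wS wx.
  by have [v vL c] := meet x w xU wS wx; exists v; rewrite -?(perm_mem pL).
by exists s => //; apply: perm_trans ps _; rewrite perm_sym.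
Qed.

End Configuration.

Local Open Scope ring_scope.

(** * Generic points of the plane *)

Lemma map_poly_mulX (A B : nzRingType) (f : A -> B) (p : {poly A}) : f 0 = 0 ->
  map_poly f (p * 'X) = map_poly f p * 'X.
Proof.
move=> f0; apply/polyP => i; rewrite coef_map_id0 // !coefMX.
by case: ifP => _; rewrite ?coef_map_id0.
Qed.

Section Generic.
Variables (K : fieldType) (char0 : [pchar K] =i pred0).
Implicit Types (f g : {poly K}) (phi psi : {poly {poly K}}) (p q t m : K).

Lemma poly_nonroot f : f != 0 -> exists t, f.[t] != 0.
Proof.
move=> f0; pose s : seq K := [seq n%:R | n <- iota 0 (size f)].
have inj : injective (fun n => n%:R : K).
  move=> m n; wlog le_mn : m n / (m <= n)%N => [h e|/eqP].
    by case/orP: (leq_total m n) => le; [apply: h|apply/esym/h].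
  rewrite eq_sym -subr_eq0 -natrB // (pcharf0P _).1 // subn_eq0 => le_nm.
  by apply/eqP; rewrite eqn_leq le_mn.
have us : uniq s by rewrite map_inj_uniq ?iota_uniq.
case: (boolP (all (root f) s)) => [rs|/allPn[t _]]; last by rewrite /root; exists t.
by have := max_poly_roots f0 rs us; rewrite size_map size_iota ltnn.
Qed.

Lemma poly_ext f g : (forall t, f.[t] = g.[t]) -> f = g.
Proof.
move=> e; apply/eqP; rewrite -subr_eq0; apply/negP => /negP /poly_nonroot[t].
by rewrite hornerD hornerN e subrr eqxx.
Qed.

Lemma poly_avoid f (s : seq K) : f != 0 -> exists t, f.[t] != 0 /\ t \notin s.
Proof.
move=> f0; have pn0 : \prod_(a <- s) ('X - a%:P) != 0 :> {poly K}.
  by rewrite prodf_seq_neq0; apply/allP => a _; rewrite polyXsubC_eq0.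
have [t] := poly_nonroot (mulf_neq0 f0 pn0).
rewrite hornerM mulf_eq0 negb_or => /andP[ft]; rewrite -/(root _ t) root_prod_XsubC => ?.
by exists t.
Qed.

Lemma poly_cofinite0 f g : g != 0 -> (forall t, g.[t] != 0 -> f.[t] = 0) -> f = 0.
Proof.
move=> g0 h; apply/eqP; apply/negP => /negP f0.
have [t] := poly_nonroot (mulf_neq0 f0 g0).
by rewrite hornerM mulf_eq0 negb_or => /andP[ft /h e]; rewrite e eqxx in ft.
Qed.

Lemma poly_roots0 f (s : seq K) : uniq s -> all (root f) s -> (size f <= size s)%N -> f = 0.
Proof.
move=> us rs le; apply/eqP; apply/negP => /negP f0.
by have := max_poly_roots f0 rs us; rewrite ltnNge le.
Qed.

(* A function of [(p, q)] is a polynomial in [q] whose coefficients are polynomials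
   in [p]. *)
Definition ev p q : {poly {poly K}} -> K := horner_eval p \o horner_eval q%:P.
Fact ev_zmod_morphism p q : zmod_morphism (ev p q).
Proof. by move=> x y; rewrite /ev /= /horner_eval hornerD hornerN hornerD hornerN. Qed.
Fact ev_monoid_morphism p q : monoid_morphism (ev p q).
Proof. by split=> [|x y]; rewrite /ev /= /horner_eval ?hornerM // !hornerC. Qed.
HB.instance Definition _ p q :=
  GRing.isZmodMorphism.Build {poly {poly K}} K (ev p q) (ev_zmod_morphism p q).
HB.instance Definition _ p q :=
  GRing.isMonoidMorphism.Build {poly {poly K}} K (ev p q) (ev_monoid_morphism p q).

(** The pullback to the line [t |-> (p + a t, q + b t)], kept as a polynomial in [t] so that it can
    be differentiated. *)
Definition restrict p q a b : {poly {poly K}} -> {poly K} :=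
  horner_eval (q%:P + b *: 'X) \o map_poly (comp_poly (p%:P + a *: 'X)).
Fact restrict_zmod_morphism p q a b : zmod_morphism (restrict p q a b).
Proof. by move=> x y; rewrite /restrict /= /horner_eval raddfB hornerD hornerN. Qed.
Fact restrict_monoid_morphism p q a b : monoid_morphism (restrict p q a b).
Proof.
by split=> [|x y]; rewrite /restrict /= /horner_eval ?rmorph1 ?hornerC ?rmorphM ?hornerM.
Qed.
HB.instance Definition _ p q a b :=
  GRing.isZmodMorphism.Build {poly {poly K}} {poly K} (restrict p q a b) (restrict_zmod_morphism p q a b).
HB.instance Definition _ p q a b :=
  GRing.isMonoidMorphism.Build {poly {poly K}} {poly K} (restrict p q a b) (restrict_monoid_morphism p q a b).

Lemma restrictC p q a b f : restrict p q a b f%:P = f \Po (p%:P + a *: 'X).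
Proof. by rewrite /restrict /= /horner_eval map_polyC hornerC. Qed.

Lemma restrictX p q a b : restrict p q a b 'X = q%:P + b *: 'X.
Proof. by rewrite /restrict /= /horner_eval map_polyX hornerX. Qed.

Lemma evC p q f : ev p q f%:P = f.[p].
Proof. by rewrite /ev /= /horner_eval hornerC. Qed.

Lemma evX p q : ev p q 'X = q.
Proof. by rewrite /ev /= /horner_eval hornerX hornerC. Qed.

Lemma restrict_ev p q a b phi t : (restrict p q a b phi).[t] = ev (p + a * t) (q + b * t) phi.
Proof.
elim/poly_ind: phi => [|phi f IH]; first by rewrite !rmorph0 horner0.
rewrite !rmorphD !rmorphM /= hornerD hornerM IH restrictX evX restrictC evC horner_comp.
by rewrite !hornerE.
Qed.

Lemma restrict_deriv p q a b phi :
  (restrict p q a b phi)^`() = a *: restrict p q a b (map_poly (@deriv K) phi)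
                         + b *: restrict p q a b phi^`().
Proof.
elim/poly_ind: phi => [|phi f IH].
  by rewrite map_poly0 deriv0 rmorph0 deriv0 !scaler0 addr0.
rewrite derivD derivM derivC derivX [map_poly _ (_ + _)]raddfD /= map_polyC /=.
rewrite map_poly_mulX ?deriv0 //.
rewrite !rmorphD !rmorphM /= restrictX !restrictC !derivE IH deriv_comp !derivE rmorph0.
by rewrite -!mul_polyC; ring.
Qed.

Lemma ev_nonroot phi : phi != 0 -> exists p q, ev p q phi != 0.
Proof.
move=> phi0; have [p hp] : exists p, (lead_coef phi).[p] != 0.
  by apply: poly_nonroot; rewrite lead_coef_eq0.
have m0 : map_poly (horner_eval p) phi != 0.
  by apply: contraNneq hp => /polyP/(_ (size phi).-1); rewrite coef_map coef0 => e; apply/eqP.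
have [q hq] := poly_nonroot m0; exists p, q; rewrite /ev /= /horner_eval.
have -> : phi.[q%:P].[p] = (map_poly (horner_eval p) phi).[(horner_eval p) q%:P].
  by rewrite horner_map.
by rewrite /horner_eval hornerC.
Qed.

(** A single nonzero polynomial certifies genericity, so that conjunctions are handled by products
    and, in characteristic 0, every generic property has a witness. *)
Definition generic (Q : K -> K -> Prop) : Prop :=
  exists2 h : {poly {poly K}}, h != 0 & forall p q, ev p q h != 0 -> Q p q.

Lemma generic_mono (Q Q' : K -> K -> Prop) :
  (forall p q, Q p q -> Q' p q) -> generic Q -> generic Q'.
Proof. by move=> QQ' [h h0 hQ]; exists h => // p q /hQ/QQ'. Qed.

Lemma generic_and (Q Q' : K -> K -> Prop) :
  generic Q -> generic Q' -> generic (fun p q => Q p q /\ Q' p q).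
Proof.
move=> [h h0 hQ] [h' h'0 hQ']; exists (h * h'); first exact: mulf_neq0.
by move=> p q; rewrite rmorphM mulf_eq0 negb_or => /andP[/hQ ? /hQ' ?].
Qed.

Lemma generic_ex (Q : K -> K -> Prop) : generic Q -> exists p q, Q p q.
Proof. by case=> h /ev_nonroot[p [q ev0]] /(_ p q ev0); exists p, q. Qed.

Lemma generic_true (Q : K -> K -> Prop) : (forall p q, Q p q) -> generic Q.
Proof. by move=> h; exists 1; rewrite ?oner_neq0. Qed.

Lemma generic_all (T : eqType) (s : seq T) (Q : T -> K -> K -> Prop) :
  (forall x, x \in s -> generic (Q x)) ->
  generic (fun p q => forall x, x \in s -> Q x p q).
Proof.
elim: s => [_|x s IH h]; first exact: generic_true.
have h1 := h x (mem_head _ _).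
have h2 := IH (fun y ys => h y (mem_behead (s := x :: s) ys)).
apply: generic_mono (generic_and h1 h2) => p q [Qx Qs] y.
by rewrite inE => /predU1P[->|/Qs].
Qed.

Lemma generic_neq0 phi : phi != 0 -> generic (fun p q => ev p q phi != 0).
Proof. by exists phi. Qed.

Lemma generic_eq0 phi : generic (fun p q => ev p q phi = 0) -> phi = 0.
Proof.
move=> g; apply/eqP; apply/negP => /negP /generic_neq0 g'.
by have [p [q [-> /eqP]]] := generic_ex (generic_and g g').
Qed.

Lemma generic_affine a b c : (a != 0) || (b != 0) ->
  generic (fun p q => a * p + b * q + c != 0).
Proof.
move=> ab; exists ((a *: 'X + c%:P)%:P + b%:P%:P * 'X).
  apply: contraTneq ab => /polyP e; rewrite negb_or !negbK.
  have /polyP/(_ 1%N) := e 0%N; have /polyP/(_ 0%N) := e 1%N.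
  rewrite !(coefD, coefC, coefZ, coefX, coefCM) /= ?(coef0, mulr0, mulr1, addr0, add0r).
  rewrite ?(coefD, coefC, coefZ, coefX, coefCM) /= ?(coef0, mulr0, mulr1, addr0, add0r).
  by move=> -> ->; rewrite eqxx.
move=> p q; rewrite rmorphD rmorphM /= !evC evX !hornerE.
by rewrite addrAC.
Qed.

End Generic.

Lemma clear_denominators (A : idomainType) m n (X : 'M[{fraction A}]_(m, n)) :
  exists d (Y : 'M[A]_(m, n)), d != 0 /\ tofrac d *: X = map_mx (@tofrac A) Y.
Proof.
have frac_ex (x : {fraction A}) :
    exists nd : A * A, (nd.2 != 0) /\ x * tofrac nd.2 = tofrac nd.1.
  elim/quotW: x => x; exists (frac x); split; first exact: denom_ratioP.
  unlock FracField.tofrac; rewrite -[LHS]FracField.pi_mul; apply/eqmodP.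
  rewrite /= FracField.equivfE /FracField.mulf.
  by rewrite !numden_Ratio ?mulr1 ?oner_eq0 ?denom_ratioP // mulrC.
have [f hf] : exists f : 'I_m * 'I_n -> A * A,
    forall ij, ((f ij).2 != 0) /\ X ij.1 ij.2 * tofrac (f ij).2 = tofrac (f ij).1.
  by apply: (@fin_all_exists _ _ (fun ij nd => nd.2 != 0 /\ X ij.1 ij.2 * tofrac nd.2 = tofrac nd.1)) => ij; apply: frac_ex.
exists (\prod_ij (f ij).2), (\matrix_(i, j) ((f (i, j)).1 * \prod_(kl | kl != (i, j)) (f kl).2)).
split; first by apply/prodf_neq0 => ij _; case: (hf ij).
apply/matrixP => i j; rewrite !mxE (bigD1 (i, j)) //= !rmorphM /=.
by rewrite mulrC mulrA (hf (i, j)).2.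
Qed.

Section GenericKernel.
Variables (K : fieldType) (char0 : [pchar K] =i pred0).

(* A left inverse over the fraction field would, after clearing denominators,
   contradict the kernel at a point where the denominator does not vanish. *)
Lemma generic_kernel n N (M : 'M[{poly {poly K}}]_(n, N)) :
  generic (fun p q => exists2 v : 'cV[K]_N, v != 0 & map_mx (ev p q) M *m v = 0) ->
  exists2 V : 'cV[{poly {poly K}}]_N, V != 0 & M *m V = 0.
Proof.
have inj_tf m k : injective (map_mx (@tofrac {poly {poly K}}) : 'M_(m, k) -> _).
  move=> A B /matrixP AB; apply/matrixP => i j; have := AB i j; rewrite !mxE.
  by move=> /eqP; rewrite tofrac_eq => /eqP.
move=> gM; have [/row_fullP[B BM]|] := boolP (row_full (map_mx (@tofrac _) M)).
  have [d [Y [d0 dY]]] := clear_denominators B.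
  have YM : Y *m M = d%:M.
    apply: inj_tf; rewrite map_mxM -dY -scalemxAl BM.
    by rewrite map_scalar_mx scalemx1.
  have [p [q [[v /eqP v0 Mv] dpq]]] := generic_ex char0 (generic_and gM (generic_neq0 d0)).
  case: v0; have : map_mx (ev p q) (Y *m M) *m v = 0 by rewrite map_mxM -mulmxA Mv mulmx0.
  rewrite YM map_scalar_mx mul_scalar_mx => /eqP.
  by rewrite scaler_eq0 (negPf dpq) => /eqP.
rewrite -cokermx_eq0 => /eqP coker0.
have [d [Y [d0 dY]]] := clear_denominators (cokermx (map_mx (@tofrac _) M)).
have MY : M *m Y = 0.
  by apply: inj_tf; rewrite map_mxM -dY -scalemxAr mulmx_coker scaler0 map_mx0.
have Y0 : Y != 0.
  apply/eqP => Y0; case: coker0; apply: (scalerI (a := tofrac d)); first by rewrite tofrac_eq0.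
  by rewrite dY Y0 map_mx0 scaler0.
have [j Yj] : exists j, col j Y != 0.
  apply/existsP; apply: contraNT Y0; rewrite negb_exists => /forallP h.
  apply/eqP/matrixP => i j; have := h j; rewrite negbK => /eqP/colP/(_ i).
  by rewrite !mxE.
by exists (col j Y) => //; rewrite colE mulmxA MY mul0mx.
Qed.

End GenericKernel.

(** * Curves with a generic multiple point *)

(** The binary form [X ^ d * c (Y / X)]. With [X] and [Y] the coordinate differences, it turns
    evaluation at a slope into an expression polynomial in [p] and [q]. *)
Definition hform (A : comNzRingType) d (c : {poly A}) (X Y : A) :=
  \sum_(j < d.+1) c`_j * (X ^+ (d - j) * Y ^+ j).

Lemma map_hform (A B : comNzRingType) (f : A -> B) d c X Y :
    zmod_morphism f -> monoid_morphism f ->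
  f (hform d c X Y) = hform d (map_poly f c) (f X) (f Y).
Proof.
move=> fZ fM; pose fadd := GRing.isZmodMorphism.Build A B f fZ.
pose fmul := GRing.isMonoidMorphism.Build A B f fM.
pose g : {rmorphism A -> B} := HB.pack f fadd fmul.
rewrite -[f]/(g : A -> B) rmorph_sum; apply: eq_bigr => j _.
by rewrite !rmorphM !rmorphXn coef_map.
Qed.

Lemma hform_horner (F : fieldType) d (c : {poly F}) X Y : (size c <= d.+1)%N -> X != 0 ->
  hform d c X Y = X ^+ d * c.[Y / X].
Proof.
move=> sc X0; rewrite (horner_coef_wide _ sc) mulr_sumr; apply: eq_bigr => j _.
have jd : (j <= d)%N by rewrite -ltnS.
have -> : X ^+ d = X ^+ (d - j) * X ^+ j by rewrite -exprD subnK.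
have := expf_neq0 j X0; rewrite expr_div_n.
by move: (X ^+ j) (X ^+ (d - j)) (Y ^+ j) => u v w u0; field.
Qed.

Section GenericCurves.
Variables (K : fieldType) (char0 : [pchar K] =i pred0).
Local Notation A2 := {poly {poly K}}.
Implicit Types (S : seq (K * K)) (z a b : K * K) (c : {poly K}) (C : {poly A2}).

Definition slope a b := (b.2 - a.2) / (b.1 - a.1).

(* [t ^+ k.-1 * (c.[m] + t * c'.[m])] is the restriction to the line of slope [m]
   through (p, q) of a curve of degree [k] which has multiplicity [k.-1] at (p, q). *)
Definition generic_curve k S := generic (fun p q => exists c c',
  [/\ (c != 0) || (c' != 0), (size c <= k)%N, (size c' <= k.+1)%N &
    forall z, z \in S -> c.[slope (p, q) z] + (z.1 - p) * c'.[slope (p, q) z] = 0]).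

Lemma generic_x a : generic (fun p q => a.1 - p != 0).
Proof.
apply: generic_mono (@generic_affine _ (-1) 0 a.1 _) => [p q|]; last by rewrite oppr_eq0 oner_eq0.
by rewrite mulN1r mul0r addr0 addrC.
Qed.

(** The exceptional points lie on the line joining [a] and [b], or on one of the two vertical lines
    where a slope is undefined. *)
Lemma generic_slope_neq a b : a.1 != b.1 -> generic (fun p q => slope (p, q) a != slope (p, q) b).
Proof.
move=> ab; have := generic_and (generic_and (generic_x a) (generic_x b))
  (@generic_affine _ (b.2 - a.2) (a.1 - b.1) (a.2 * b.1 - b.2 * a.1) _).
rewrite [_ - b.1 == _]subr_eq0 ab orbT => /(_ isT); apply: generic_mono => p q [[a1 b1]].
apply: contraNneq; rewrite /slope /= => /eqP; rewrite eqr_div // => /eqP e.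
by apply/eqP; rewrite -[RHS](subrr ((a.2 - q) * (b.1 - p))) {2}e; ring.
Qed.

Lemma generic_slopes_uniq S : uniq [seq z.1 | z <- S] ->
  generic (fun p q => uniq [seq slope (p, q) z | z <- S]).
Proof.
elim: S => [_|a S IH /= /andP[aS uS]]; first exact: generic_true.
have h : generic (fun p q => forall b, b \in S -> slope (p, q) a != slope (p, q) b).
  apply: generic_all => b bS; apply: generic_slope_neq.
  by apply: contraNneq aS => ->; apply/mapP; exists b.
apply: generic_mono (generic_and h (IH uS)) => p q [ha ->]; rewrite andbT.
by apply/mapP => -[b /ha] /eqP.
Qed.

Lemma generic_xs S : generic (fun p q => forall z, z \in S -> z.1 - p != 0).
Proof. by apply: generic_all => z _; apply: generic_x. Qed.

Definition dx z : A2 := (z.1%:P - 'X)%:P.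
Definition dy z : A2 := z.2%:P%:P - 'X.

Lemma ev_dx p q z : ev p q (dx z) = z.1 - p.
Proof. by rewrite /dx evC !hornerE. Qed.

Lemma ev_dy p q z : ev p q (dy z) = z.2 - q.
Proof. by rewrite /dy ev_zmod_morphism evC evX hornerC. Qed.

(** The index is shifted: the curves have degree [k + 1], so quartics are [k = 3]. The condition is
    that of [generic_curve k.+1] multiplied by [(z.1 - p) ^ k]. *)
Definition curve_family k S C C' :=
  [/\ (C != 0) || (C' != 0), (size C <= k.+1)%N, (size C' <= k.+2)%N &
    forall z, z \in S -> hform k C (dx z) (dy z) + hform k.+1 C' (dx z) (dy z) = 0].

Lemma rVpoly_eq0 (A : nzRingType) d (v : 'rV[A]_d) : (rVpoly v == 0) = (v == 0).
Proof.
apply/eqP/eqP => [h|->]; last by rewrite linear0.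
by rewrite -[v]rVpolyK h linear0.
Qed.

Lemma hform_rVpoly (A : comNzRingType) d (v : 'rV[A]_d.+1) X Y :
  hform d (rVpoly v) X Y = \sum_(j < d.+1) v 0 j * (X ^+ (d - j) * Y ^+ j).
Proof. by apply: eq_bigr => j _; rewrite coef_rVpoly_ord. Qed.

(** For fixed [p] and [q] the coefficients of [c] and [c'] solve a homogeneous linear system with
    one equation per point of [S]. Its entries are polynomial in [p] and [q], so [generic_kernel]
    yields a solution that is polynomial as well. *)
Lemma generic_curve_family k S : generic_curve k.+1 S ->
  exists C C', curve_family k S C C'.
Proof.
move=> gS; pose X := fun i : 'I_(size S) => dx (nth 0 S i).
pose Y := fun i : 'I_(size S) => dy (nth 0 S i).
pose M : 'M[A2]_(size S, k.+1 + k.+2) := row_mx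
  (\matrix_(i, j) (X i ^+ (k - j) * Y i ^+ j)) (\matrix_(i, j) (X i ^+ (k.+1 - j) * Y i ^+ j)).
have [|V V0 MV] := generic_kernel char0 (M := M).
  apply: generic_mono (generic_and gS (generic_xs S)).
  move=> p q [[c [c' [c0 sc sc' hc]]] hx].
  exists (col_mx (poly_rV c)^T (poly_rV c')^T).
    rewrite -(inj_eq trmx_inj) tr_col_mx !trmxK trmx0 -row_mx0.
    apply: contraTneq c0 => /eq_row_mx[h h'].
    by rewrite -(poly_rV_K sc) -(poly_rV_K sc') h h' !linear0 eqxx.
  apply/colP => i; rewrite map_row_mx mul_row_col !mxE.
  have zS : nth 0 S i \in S by apply: mem_nth.
  have Xi : ev p q (X i) = (nth 0 S i).1 - p by apply: ev_dx.
  have Yi : ev p q (Y i) = (nth 0 S i).2 - q by apply: ev_dy.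
  transitivity (hform k c ((nth 0 S i).1 - p) ((nth 0 S i).2 - q)
              + hform k.+1 c' ((nth 0 S i).1 - p) ((nth 0 S i).2 - q)).
    congr (_ + _); apply: eq_bigr => j _.
      by rewrite !mxE rmorphM !rmorphXn /= Xi Yi mulrC.
    by rewrite !mxE rmorphM !rmorphXn /= Xi Yi mulrC.
  rewrite !hform_horner // ?hx // exprSr -mulrA -mulrDr.
  by rewrite -/(slope (p, q) _) hc ?mulr0.
exists (rVpoly (usubmx V)^T), (rVpoly (dsubmx V)^T); split.
- apply: contraNT V0; rewrite negb_or !negbK !rVpoly_eq0 => /andP[/eqP u0 /eqP d0].
  by rewrite -[V]vsubmxK -[usubmx V]trmxK -[dsubmx V]trmxK u0 d0 !trmx0 col_mx0.
- exact: size_poly.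
- exact: size_poly.
move=> z /(nthP 0)[i iS <-]; have := congr1 (fun A : 'cV_ _ => A (Ordinal iS) 0) MV.
rewrite -{1}[V]vsubmxK mul_row_col !mxE => <-; rewrite !hform_rVpoly.
by congr (_ + _); apply: eq_bigr => j _; rewrite !mxE mulrC.
Qed.

End GenericCurves.

(** * Moving the multiple point along a line *)

Section Descent.
Variables (K : fieldType) (char0 : [pchar K] =i pred0).
Local Notation A2 := {poly {poly K}}.
Implicit Types (S : seq (K * K)) (z a b : K * K) (c : {poly K}) (C : {poly A2}).

Definition at_pt p q C : {poly K} := map_poly (ev p q) C.

Lemma size_at_pt p q C n : (size C <= n)%N -> (size (at_pt p q C) <= n)%N.
Proof. exact: leq_trans (size_poly _ _). Qed.

Lemma curve_family_point k S C C' z p q : curve_family k S C C' -> z \in S -> z.1 - p != 0 ->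
  (at_pt p q C).[slope (p, q) z] + (z.1 - p) * (at_pt p q C').[slope (p, q) z] = 0.
Proof.
move=> [_ sC sC' h] zS x0; have := congr1 (ev p q) (h z zS).
rewrite rmorphD /= !(map_hform _ _ _ _ (ev_zmod_morphism p q) (ev_monoid_morphism p q)).
rewrite ev_dx ev_dy rmorph0 !hform_horner ?size_at_pt //.
rewrite exprSr -mulrA -mulrDr => /eqP.
by rewrite mulf_eq0 expf_eq0 (negPf x0) andbF => /eqP.
Qed.

Definition along (p q u v m : K) C : {poly K} := (map_poly (restrict p q u v) C).[m%:P].

Lemma along_horner (p q u v m : K) C t :
  (along p q u v m C).[t] = (at_pt (p + u * t) (q + v * t) C).[m].
Proof.
rewrite /along /at_pt; elim/poly_ind: C => [|C c IH].
  by rewrite !map_poly0 !horner0.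
rewrite !rmorphD !rmorphM /= !map_polyX !map_polyC /=.
by rewrite !hornerMXaddC !hornerD !hornerM IH restrict_ev hornerC.
Qed.

(* The derivative in the direction [(1, m)], where [m] is the variable of [C]. *)
Definition dirD C : {poly A2} :=
  map_poly (map_poly (@deriv K)) C + 'X * map_poly (@deriv {poly K}) C.

Lemma size_dirD C n : (size C <= n)%N -> (size (dirD C) <= n.+1)%N.
Proof.
move=> sC; apply: leq_trans (size_polyD _ _) _; rewrite geq_max; apply/andP; split.
  by apply: leq_trans (size_poly _ _) _; apply: leq_trans sC _.
apply: leq_trans (size_polyMleq _ _) _; rewrite size_polyX /= ltnS.
exact: leq_trans (size_poly _ _) _.
Qed.

Lemma along_deriv p q m C t :
  (along p q 1 m m C)^`().[t] = (at_pt (p + t) (q + m * t) (dirD C)).[m].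
Proof.
have e : p + t = p + 1 * t by rewrite mul1r.
rewrite e /along /at_pt /dirD rmorphD rmorphM /= map_polyX hornerD hornerM hornerX.
elim/poly_ind: C => [|C c IH].
  by rewrite !map_poly0 !horner0 derivC mulr0 addr0 horner0.
rewrite !raddfD /= !map_polyC /= !map_poly_mulX ?rmorph0 ?map_poly0 ?deriv0 //.
rewrite !hornerMXaddC derivD derivM derivC mulr0 addr0.
rewrite hornerD hornerM hornerC IH restrict_deriv scale1r !(hornerD, hornerM, hornerZ, hornerC) !restrict_ev mul1r; ring.
Qed.

(** Moving the multiple point on its line to [z] keeps the slope, so the incidence with [z] becomes
    an identity in the position [t]. It is first obtained away from [t = z.1 - p], where the slope
    is undefined, and extends because it is polynomial. *)
Lemma along_point k S C C' z p q m : curve_family k S C C' -> z \in S ->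
    z.1 - p != 0 -> m = slope (p, q) z ->
  along p q 1 m m C = ('X - (z.1 - p)%:P) * along p q 1 m m C'.
Proof.
move=> fC zS x0 ->; apply/eqP; rewrite -subr_eq0; apply/eqP.
apply: (@poly_cofinite0 _ char0 _ ('X - (z.1 - p)%:P)); first by rewrite polyXsubC_eq0.
move=> t; rewrite !hornerE => t0.
have x1 : z.1 - (p + 1 * t) != 0.
  by apply: contraNneq t0 => e; apply/eqP; rewrite -[RHS]oppr0 -e; ring.
have := curve_family_point (q + slope (p, q) z * t) fC zS x1.
have -> : slope (p + 1 * t, q + slope (p, q) z * t) z = slope (p, q) z.
  rewrite /slope /=; apply/eqP; rewrite eqr_div //; apply/eqP; field.
  by rewrite /= in x0.
rewrite !along_horner => e; rewrite -[RHS]e; ring.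
Qed.

Definition residual_defect C C' := C' * (dirD C - C') - C * dirD C'.

(** At the slope of a point of [S], [along_point] and its derivative at [t = 0] express [c] and
    [D c] through [c'] and [D c'], and the defect cancels. Its degree in the slope is at most
    [2 k + 2], and [2 k + 3 <= k + 6] amounts to [k < 4]. *)
Lemma residual_constant k S C C' : (k < 4)%N -> uniq [seq z.1 | z <- S] -> (k + 6 <= size S)%N ->
  curve_family k S C C' -> residual_defect C C' = 0.
Proof.
move=> k4 uS sS fC; have [_ sC sC' _] := fC.
have sE : (size (residual_defect C C') <= (k.+1).*2.+1)%N.
  have sD : (size (dirD C - C')%R <= k.+2)%N.
    by rewrite (leq_trans (size_polyD _ _)) // geq_max size_dirD // size_polyN.
  have sD' := size_dirD sC'.
  rewrite (leq_trans (size_polyD _ _)) // geq_max size_polyN.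
  apply/andP; split; apply: leq_trans (size_polyMleq _ _) _; rewrite -subn1 leq_subLR.
    by apply: leq_trans (leq_add sC' sD) _; lia.
  by apply: leq_trans (leq_add sC sD') _; lia.
apply/polyP => i; rewrite coef0; apply: generic_eq0 => //.
apply: generic_mono (generic_and (generic_xs S) (generic_slopes_uniq uS)).
move=> p q [hx hu]; suff : at_pt p q (residual_defect C C') = 0.
  by move/polyP/(_ i); rewrite coef_map coef0.
apply: (poly_roots0 hu); last first.
  by apply: size_at_pt; apply: leq_trans sE _; rewrite size_map; lia.
rewrite all_map; apply/allP => z zS /=; apply/rootP.
set m := slope (p, q) z; have e := along_point fC zS (hx z zS) (erefl m).
have e0 := congr1 (fun f => f.[0]) e; have e1 := congr1 (fun f => f^`().[0]) e.
move: e0 e1; rewrite derivM !derivE !(hornerD, hornerM, hornerN, hornerX, hornerC).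
rewrite !along_deriv !along_horner !mulr0 !addr0.
rewrite /residual_defect /at_pt !rmorphB !rmorphM /= rmorphB /=.
rewrite !(hornerD, hornerM, hornerN) => e0 e1.
ring: e0 e1.
Qed.

End Descent.

Section Wronskian.
Variables (K : fieldType) (char0 : [pchar K] =i pred0).
Implicit Types (f g u : {poly K}).

Lemma divX_root0 f : f.[0] = 0 -> f = 'X * drop_poly 1 f.
Proof.
move=> f0; apply/polyP => -[|i]; first by rewrite coefXM -horner_coef0.
by rewrite coefXM /= coef_drop_poly addn1.
Qed.

(** Every power of ['X] divides [u]: if [u = 'X ^ n.+1 * w], the lowest terms of the relation give
    [n.+1 * w(0) * g(0) = 0], which in characteristic 0 produces one more factor. *)
Lemma wronskian_root0 u g : u^`() * g = u * g^`() -> u.[0] = 0 -> g.[0] != 0 -> u = 0.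
Proof.
move=> W u0 g0; have Xu n : exists w : {poly K}, u = 'X^(n.+1) * w.
  elim: n => [|n [w uw]]; first by exists (drop_poly 1 u); rewrite expr1 -divX_root0.
  suff w0 : w.[0] = 0.
    by exists (drop_poly 1 w); rewrite uw {1}(divX_root0 w0) mulrA -exprSr.
  have e : (n.+1%:R *: w) * g = 'X * (w * g^`() - w^`() * g).
    have Xn : 'X^n != 0 :> {poly K} by rewrite -size_poly_gt0 size_polyXn.
    apply: (mulfI Xn); move: W; rewrite uw derivM derivXn /= -mulr_natl -!mul_polyC polyC_natr exprS.
    move: 'X^n (n.+1%:R) => y e W.
    transitivity ((e * y * w + 'X * y * w^`()) * g - 'X * y * w^`() * g); first by ring.
    by rewrite W; ring.
  have := congr1 (fun f => f.[0]) e; rewrite !hornerE ?mul0r => /eqP.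
  by rewrite !mulf_eq0 (negPf g0) orbF (pcharf0P _).1 //= => /eqP.
have [w e] := Xu (size u); apply/eqP; apply: contraTT isT => u0'.
have w0 : w != 0 by apply: contraNneq u0' => w0; rewrite e w0 mulr0.
have := congr1 (fun f : {poly K} => size f) e.
rewrite size_monicM ?monicXn // size_polyXn => h.
by move: w0; rewrite -size_poly_gt0; lia.
Qed.

(** The quotient [u / g] has derivative zero. The cross multiplied values at 0 make the conclusion
    meaningful when [g], or only its value at 0, is zero; the main case applies [wronskian_root0] to
    the difference of both sides. *)
Lemma wronskian_proportional u g : u^`() * g = u * g^`() -> u.[0] *: g = g.[0] *: u.
Proof.
move=> W; apply/eqP; rewrite -subr_eq0; have [g0|g0] := eqVneq g.[0] 0; last first.
  apply/eqP/(wronskian_root0 _ _ g0); last by rewrite !hornerE; ring.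
  by rewrite derivB !derivZ mulrBl mulrBl -!scalerAl W [g^`() * g]mulrC.
have [u0|u0] := eqVneq u.[0] 0; first by rewrite g0 u0 !scale0r subrr.
rewrite (wronskian_root0 (u := g) (g := u)) ?horner0 ?scaler0 ?scale0r ?subrr //.
by rewrite mulrC -W mulrC.
Qed.

Lemma at0_eq0 (D : {poly {poly K}}) : map_poly (horner_eval 0) D = 0 ->
  exists2 D1 : {poly {poly K}}, D = 'X *: D1 & forall i, D1`_i = drop_poly 1 D`_i.
Proof.
move=> D0; exists (map_poly (drop_poly 1) D) => [|i]; last first.
  by rewrite coef_map_id0 // drop_poly0r.
apply/polyP => i; rewrite coefZ coef_map_id0 ?drop_poly0r //; apply: divX_root0.
by have /polyP/(_ i) := D0; rewrite coef_map coef0.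
Qed.

(* Divides two polynomials over [K[e]] by the largest common power of [e]. *)
Lemma eps_primitive (B B' : {poly {poly K}}) : (B != 0) || (B' != 0) ->
  exists r (D D' : {poly {poly K}}), [/\ B = 'X^r *: D, B' = 'X^r *: D' &
    (map_poly (horner_eval 0) D != 0) || (map_poly (horner_eval 0) D' != 0)].
Proof.
suff h n : forall B B' : {poly {poly K}},
    (exists i, (0 < size (B`_i)%R <= n)%N || (0 < size (B'`_i)%R <= n)%N) ->
  exists r (D D' : {poly {poly K}}), [/\ B = 'X^r *: D, B' = 'X^r *: D' &
    (map_poly (horner_eval 0) D != 0) || (map_poly (horner_eval 0) D' != 0)].
  case/orP=> nz.
    apply: (h (size (lead_coef B))); exists (size B).-1.
    by apply/orP; left; rewrite leqnn andbT size_poly_gt0 lead_coef_eq0.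
  apply: (h (size (lead_coef B'))); exists (size B').-1.
  by apply/orP; right; rewrite leqnn andbT size_poly_gt0 lead_coef_eq0.
elim: n => [|n IH] {}B {}B' [i hi]; first by move: hi; rewrite !leqn0 => /orP[] /andP[/lt0n_neq0]; move=> /negPf->.
have [|] := boolP ((map_poly (horner_eval 0) B != 0) || (map_poly (horner_eval 0) B' != 0)).
  by exists 0%N, B, B'; rewrite expr0 !scale1r.
rewrite negb_or !negbK => /andP[/eqP/at0_eq0[D eD hD] /eqP/at0_eq0[D' eD' hD']].
have [|r [F [F' [eF eF' h]]]] := IH D D'.
  have small (f : {poly {poly K}}) j : (0 < size (('X *: f)`_j)%R <= n.+1)%N -> (0 < size (f`_j)%R <= n)%N.
    rewrite coefZ; have [->|f0] := eqVneq f`_j 0; first by rewrite mulr0 size_poly0.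
    by rewrite mulrC size_mulX // !ltnS /= => le; rewrite le size_poly_gt0 f0.
  by exists i; case/orP: hi; rewrite ?eD ?eD' => /small ->; rewrite ?orbT.
by exists r.+1, F, F'; rewrite eD eF eD' eF' !scalerA -exprS.
Qed.

End Wronskian.

Section Residual.
Variables (K : fieldType) (char0 : [pchar K] =i pred0).
Local Notation A2 := {poly {poly K}}.
Implicit Types (S : seq (K * K)) (z a b : K * K) (c : {poly K}) (C : {poly A2}).

(* By [residual_defect C C' = 0], the Wronskian of [f - X g] and [g] vanishes, where
   [f] and [g] are the restrictions of [C] and [C'] to a line. *)
Lemma residual_transport C C' p q m t : residual_defect C C' = 0 ->
  (at_pt p q C).[m] * (at_pt (p + t) (q + m * t) C').[m] =
  (at_pt p q C').[m] * ((at_pt (p + t) (q + m * t) C).[m]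
     - t * (at_pt (p + t) (q + m * t) C').[m]).
Proof.
move=> E0; pose f := along p q 1 m m C; pose g := along p q 1 m m C'.
have fg : f^`() * g - f * g^`() = g * g.
  apply: (poly_ext char0) => s; rewrite !(hornerD, hornerM, hornerN) !along_deriv !along_horner mul1r.
  have := congr1 (fun D => (at_pt (p + s) (q + m * s) D).[m]) E0.
  rewrite /residual_defect /at_pt !rmorphB !rmorphM /= rmorphB rmorph0 /=.
  rewrite !(hornerD, hornerM, hornerN) horner0 => e.
  by apply/eqP; rewrite -subr_eq0 -e; apply/eqP; ring.
have W : (f - 'X * g)^`() * g = (f - 'X * g) * g^`().
  rewrite derivB derivM derivX.
  transitivity ((f^`() * g - f * g^`()) - g * g + (f - 'X * g) * g^`()); first by ring.
  by rewrite fg subrr add0r.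
have /(congr1 (fun P => P.[t])) := wronskian_proportional char0 W.
rewrite !(hornerZ, hornerD, hornerN, hornerM, hornerX) !along_horner.
by rewrite !mulr0 !addr0 mul1r mul0r subr0.
Qed.

End Residual.

(** * Limits at a point of the configuration *)

Section BinaryForms.
Variable A : comNzRingType.
Implicit Types (c : {poly A}) (X Y m d : A).

Lemma hform_mulX n c a X Y :
  hform n.+1 (c * 'X + a%:P) X Y = Y * hform n c X Y + a * X ^+ n.+1.
Proof.
rewrite /hform big_ord_recl /= coefD coefMX coefC /= add0r subn0 mulr1 addrC.
congr (_ + _); rewrite mulr_sumr; apply: eq_bigr => i _.
rewrite coefD coefMX coefC /= addr0 /bump /= add1n subSS [Y ^+ _.+1]exprS.
by rewrite [RHS]mulrCA [Y * (_ * _)]mulrCA.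
Qed.

Lemma hformZ n a c X Y : hform n (a *: c) X Y = a * hform n c X Y.
Proof. by rewrite mulr_sumr; apply: eq_bigr => i _; rewrite coefZ mulrA. Qed.

Lemma hformD n c c' X Y : hform n (c + c') X Y = hform n c X Y + hform n c' X Y.
Proof. by rewrite -big_split; apply: eq_bigr => i _; rewrite coefD mulrDl. Qed.

(** First order expansion of [X ^ n * c (m + d / X)]; the factor [X] on the left clears the
    denominator of the linear term. *)
Lemma hform_taylor n c X m d : (size c <= n.+1)%N -> exists R,
  X * hform n c X (X * m + d) = X ^+ n.+1 * c.[m] + X ^+ n * d * c^`().[m] + d ^+ 2 * R.
Proof.
elim: n c => [|n IH] c sc.
  exists 0; rewrite (size1_polyC sc) derivC /hform big_ord1 !hornerC coefC /= ?subnn ?expr0; ring.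
have e : c = drop_poly 1 c * 'X + (c`_0)%:P.
  apply/polyP => -[|i]; rewrite coefD coefMX coefC /= ?add0r //.
  by rewrite coef_drop_poly addn1 addr0.
have sd : (size (drop_poly 1 c) <= n.+1)%N by rewrite size_drop_poly leq_subLR.
move: (drop_poly 1 c) (c`_0) e sd => c1 a -> /IH[R hR].
exists (X ^+ n * c1^`().[m] + (X * m + d) * R).
rewrite hform_mulX mulrDr mulrCA hR derivD derivM derivX derivC.
rewrite !(hornerD, hornerM, hornerX, hornerC) !exprS; ring.
Qed.

End BinaryForms.

Section LocalLimit.
Variables (K : fieldType) (char0 : [pchar K] =i pred0).
Local Notation A2 := {poly {poly K}}.
Implicit Types (S : seq (K * K)) (z a b : K * K) (c : {poly K}) (C : {poly A2}).
Local Notation at0 := (map_poly (horner_eval 0)).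

Lemma restrict_dx p q u v z : restrict p q u v (dx z) = (z.1 - p)%:P - u *: 'X.
Proof. by rewrite /dx restrictC comp_polyB comp_polyC comp_polyX rmorphB /=; ring. Qed.

Lemma restrict_dy p q u v z : restrict p q u v (dy z) = (z.2 - q)%:P - v *: 'X.
Proof. by rewrite /dy restrict_zmod_morphism restrictC comp_polyC restrictX rmorphB /=; ring. Qed.

Lemma restrict_hform n p q u v (D : {poly A2}) X Y :
  restrict p q u v (hform n D X Y) = hform n (map_poly (restrict p q u v) D) (restrict p q u v X) (restrict p q u v Y).
Proof. exact: map_hform (restrict_zmod_morphism p q u v) (restrict_monoid_morphism p q u v). Qed.

Lemma horner_at0 (D : {poly {poly K}}) m : (at0 D).[m] = (D.[m%:P]).[0].
Proof. by rewrite -[m in LHS](hornerC m 0) -[m%:P.[0]]/(horner_eval 0 m%:P) horner_map. Qed.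

Lemma diag_horner (D : {poly {poly K}}) m : D.['X].[m] = D.[m%:P].[m].
Proof.
elim/poly_ind: D => [|D c IH]; first by rewrite !horner0.
by rewrite !hornerMXaddC !(hornerD, hornerM, hornerX, hornerC) IH.
Qed.

Lemma uniq_fst_inj S a b : uniq [seq z.1 | z <- S] -> a \in S -> b \in S -> a.1 = b.1 -> a = b.
Proof.
elim: S => //= d S IH /andP[dS uS]; rewrite !inE => /predU1P[->|aS] /predU1P[->|bS] // e.
- by case/negP: dS; rewrite e map_f.
- by case/negP: dS; rewrite -e map_f.
- exact: IH.
Qed.

Lemma hform_at0 n (D : {poly {poly K}}) X Y :
  (hform n D X Y).[0] = hform n (at0 D) X.[0] Y.[0].
Proof.
by rewrite -[LHS]/(horner_eval 0 _) map_hform //; [exact: rmorphB | split; [exact: rmorph1 | exact: rmorphM]].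
Qed.

(** The direction is the one from [z] to a generic point at which [C] or [C'] does not vanish; the
    restriction to the line through both points is then nonzero. The affine forms in the proof are
    the equations of the lines from [z] to the points of [S]. *)
Lemma generic_base_direction k S C C' z : curve_family k S C C' -> exists m,
  [/\ (map_poly (restrict z.1 z.2 1 m) C != 0) || (map_poly (restrict z.1 z.2 1 m) C' != 0) &
      forall a, a \in S -> m != slope z a].
Proof.
move=> [nz _ _ _].
have [p [q [pq0 [p0 hq]]]] : exists p q, (at_pt p q C != 0 \/ at_pt p q C' != 0) /\
   z.1 - p != 0 /\ forall a, a \in S -> - slope z a * p + 1 * q + (slope z a * z.1 - z.2) != 0.
  have g0 : generic (fun p q => at_pt p q C != 0 \/ at_pt p q C' != 0).
    have nz_at (D : {poly A2}) : D != 0 -> generic (fun p q => at_pt p q D != 0).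
      rewrite -lead_coef_eq0 => /generic_neq0; apply: generic_mono => p q.
      by apply: contraNneq => /polyP/(_ (size D).-1); rewrite coef_map coef0 => e; apply/eqP.
    by case/orP: nz => /nz_at; apply: generic_mono => p q; [left|right].
  have g2 : generic (fun p q => forall a, a \in S -> - slope z a * p + 1 * q + (slope z a * z.1 - z.2) != 0).
    by apply: generic_all => a _; apply: generic_affine; rewrite oner_eq0 orbT.
  have [p [q [[h1 h2] h3]]] := generic_ex char0 (generic_and (generic_and g0 (generic_x z)) g2).
  by exists p, q.
have p0' : p - z.1 != 0 by rewrite -opprB oppr_eq0.
exists ((q - z.2) / (p - z.1)); split; last first.
  move=> a /hq; apply: contraNneq => <-; apply/eqP; field.
  by rewrite p0'.
have keep (D : {poly A2}) : at_pt p q D != 0 ->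
    map_poly (restrict z.1 z.2 1 ((q - z.2) / (p - z.1))) D != 0.
  apply: contraNneq => /polyP e; apply/eqP/polyP => i.
  have := congr1 (fun f : {poly K} => f.[p - z.1]) (e i).
  rewrite coef_map_id0 ?rmorph0 // coef0 horner0 restrict_ev mul1r mulfVK //.
  by rewrite [z.1 + _]addrC subrK [z.2 + _]addrC subrK /at_pt coef_map coef0.
by case: pq0 => /keep ->; rewrite ?orbT.
Qed.

Definition doubled_slopes S z (ms : seq K) := forall m, m \in ms -> exists a b,
  [/\ a \in S, b \in S, a != z, b != z & [/\ a != b, slope z a = m & slope z b = m]].

(** The last hypothesis means that the line from the multiple point to [z] is not always a component
    of the curve: if [c'] vanishes at the slope of [z], then so does [c]. *)
Lemma local_limit k S C C' z : (k < 4)%N -> uniq [seq z.1 | z <- S] -> (k + 6 <= size S)%N ->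
    curve_family k S C C' -> z \in S ->
    (exists s m, s != 0 /\ (at_pt (z.1 + s) (z.2 + m * s) C').[m] != 0) ->
  exists N : {poly K}, [/\ N != 0, (size N <= k.+2)%N,
    forall a, a \in S -> a != z -> N.[slope z a] = 0 &
    (0 < k)%N -> forall ms, uniq ms -> size ms = k.+1 -> ~ doubled_slopes S z ms].
Proof.
move=> k4 uS sS fC zS [s [m0 [s0 nz0]]].
have E0 := residual_constant char0 k4 uS sS fC.
have [ms [nz hms]] := generic_base_direction z fC.
have [_ sC sC' fam] := fC.
have [r [B [B' [eB eB' nzB]]]] := eps_primitive nz.
have Xr : 'X^r != 0 :> {poly K} by rewrite -size_poly_gt0 size_polyXn.
(* The residual point of a line through [z], seen from any other position on it, is [z].
   Transporting this from distance [s] back to the moving point and setting the parameter to 0 kills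
   the limit of [c]: the limit curve is a cone with vertex [z]. *)
have B0 : at0 B = 0.
  (* In [h] the variable is both the slope and, times [s], the vertical displacement; [h] is a
     nonzero polynomial, so the slopes to be avoided are finite in number. *)
  pose h := (map_poly (restrict (z.1 + s) z.2 0 s) C').['X].
  have hE m : h.[m] = (at_pt (z.1 + s) (z.2 + m * s) C').[m].
    rewrite /h diag_horner -/(along (z.1 + s) z.2 0 s m C') along_horner.
    by rewrite mul0r addr0 [s * m]mulrC.
  apply: (@poly_cofinite0 _ char0 _ h); first by apply: contraNneq nz0 => h0; rewrite -hE h0 horner0.
  move=> m; rewrite hE => nzm.
  have tr : along z.1 z.2 1 ms m C * along (z.1 + s) (z.2 + m * s) 1 ms m C' =
     along z.1 z.2 1 ms m C' * (along (z.1 + s) (z.2 + m * s) 1 ms m C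
                  - s *: along (z.1 + s) (z.2 + m * s) 1 ms m C').
    apply: (poly_ext char0) => t; rewrite !(hornerM, hornerD, hornerN, hornerZ) !along_horner.
    have := residual_transport char0 (z.1 + 1 * t) (z.2 + ms * t) m s E0.
    by rewrite ![_ + _ * t + _]addrAC.
  have : along (z.1 + s) (z.2 + m * s) 1 ms m C' * B.[m%:P] =
     B'.[m%:P] * (along (z.1 + s) (z.2 + m * s) 1 ms m C
                  - s *: along (z.1 + s) (z.2 + m * s) 1 ms m C').
    have aC : along z.1 z.2 1 ms m C = 'X^r * B.[m%:P] by rewrite /along eB hornerZ.
    have aC' : along z.1 z.2 1 ms m C' = 'X^r * B'.[m%:P] by rewrite /along eB' hornerZ.
    by apply: (mulfI Xr); rewrite mulrCA -aC mulrC tr aC' mulrA.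
  move/(congr1 (fun f : {poly K} => f.[0])).
  rewrite !(hornerM, hornerD, hornerN, hornerZ) !along_horner !mulr0 !addr0.
  have -> : (at_pt (z.1 + s) (z.2 + m * s) C).[m] - s * (at_pt (z.1 + s) (z.2 + m * s) C').[m] = 0.
    have x0 : z.1 - (z.1 + s) != 0 by rewrite opprD addrA subrr add0r oppr_eq0.
    have := curve_family_point (z.2 + m * s) fC zS x0.
    have -> : slope (z.1 + s, z.2 + m * s) z = m by rewrite /slope /=; field; rewrite /= in x0.
    by move=> e; rewrite -[RHS]e; ring.
  by rewrite mulr0 => /eqP; rewrite mulf_eq0 (negPf nzm) => /eqP; rewrite horner_at0.
(* [N] is the limit of the curves along the line of slope [ms] through [z]. *)
pose N := at0 B'; have N0 : N != 0 by move: nzB; rewrite B0 eqxx.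
have sB (D D' : {poly {poly K}}) n : (size D <= n)%N -> D = 'X^r *: D' -> (size D' <= n)%N.
  by move=> sD eD; rewrite -(size_scale D' Xr) -eD.
have sCe n (D : {poly A2}) : (size D <= n)%N -> (size (map_poly (restrict z.1 z.2 1 ms) D) <= n)%N.
  exact: leq_trans (size_poly _ _).
have sBk := sB _ _ _ (sCe _ _ sC) eB; have sBk' := sB _ _ _ (sCe _ _ sC') eB'.
have sN : (size N <= k.+2)%N by apply: leq_trans (size_poly _ _) _.
pose X a : {poly K} := (a.1 - z.1)%:P - 1 *: 'X; pose Y a : {poly K} := (a.2 - z.2)%:P - ms *: 'X.
have G a : a \in S -> hform k B (X a) (Y a) + hform k.+1 B' (X a) (Y a) = 0.
  move=> aS; have /(congr1 (restrict z.1 z.2 1 ms)) := fam _ aS.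
  rewrite (rmorphD (restrict z.1 z.2 1 ms)) /=.
  rewrite !restrict_hform.
  rewrite restrict_dx restrict_dy eB eB' !hformZ -mulrDr [RHS](rmorph0 (restrict z.1 z.2 1 ms)) => /eqP.
  by rewrite mulf_eq0 (negPf Xr) => /eqP.
have dx0 a : a \in S -> a != z -> a.1 - z.1 != 0.
  move=> aS az; rewrite subr_eq0; apply: contraNneq az => e; apply/eqP.
  exact: (uniq_fst_inj uS).
have rootN a : a \in S -> a != z -> N.[slope z a] = 0.
  move=> aS az; have := congr1 (fun f : {poly K} => f.[0]) (G a aS).
  rewrite hornerD !hform_at0 B0 horner0.
  have -> : hform k 0 (X a).[0] (Y a).[0] = 0.
    by rewrite /hform big1 // => i _; rewrite coef0 mul0r.
  have -> : (X a).[0] = a.1 - z.1 by rewrite !hornerE /= subr0.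
  have -> : (Y a).[0] = a.2 - z.2 by rewrite !hornerE /= subr0.
  rewrite add0r hform_horner ?dx0 // => /eqP.
  by rewrite mulf_eq0 expf_eq0 (negPf (dx0 a aS az)) andbF => /eqP.
exists N; split => // k0 l ul sl_l dl.
have [B2 eB2 _] := at0_eq0 B0.
have [|B3 eB3 _] := @at0_eq0 K (B' - map_poly polyC N).
  rewrite rmorphB /= -/N -map_poly_comp; apply/polyP => i.
  by rewrite coefB coef_map_id0 /= ?horner_evalE ?hornerC // subrr coef0.
have {}eB3 : B' = map_poly polyC N + 'X *: B3 by rewrite -eB3 addrC subrK.
pose c1 := at0 B2; pose c3 := at0 B3.
have nX : 'X != 0 :> {poly K} by rewrite polyX_eq0.
(* On the base line itself [z] lies at distance [- t] from the moving point, hence [c = t * c'] at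
   the slope [ms]. *)
have c1ms : c1.[ms] = N.[ms].
  have e : along z.1 z.2 1 ms ms C = 'X * along z.1 z.2 1 ms ms C'.
    apply/eqP; rewrite -subr_eq0; apply/eqP; apply: (@poly_cofinite0 _ char0 _ 'X) => // t.
    rewrite hornerX => t0; rewrite !(hornerD, hornerN, hornerM, hornerX) !along_horner mul1r.
    have x0 : z.1 - (z.1 + t) != 0 by rewrite opprD addrA subrr add0r oppr_eq0.
    have := curve_family_point (z.2 + ms * t) fC zS x0.
    have -> : slope (z.1 + t, z.2 + ms * t) z = ms by rewrite /slope /=; field; rewrite /= in x0.
    by move=> h; rewrite -[RHS]h; ring.
  have : B2.[ms%:P] = B'.[ms%:P].
    apply: (mulfI Xr); apply: (mulfI nX); rewrite mulrCA -hornerZ -eB2.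
    by move: e; rewrite /along eB eB' !hornerZ.
  by rewrite !horner_at0 => ->.
(* This is the first order coefficient, in the parameter [e], of the incidence with [a]: the slope
   from the moving point to [a] is [m + (m - ms) e / (a.1 - z.1)] up to higher order. *)
have key a : a \in S -> a != z ->
    c1.[slope z a] + (a.1 - z.1) * c3.[slope z a] = (ms - slope z a) * N^`().[slope z a].
  move=> aS az; set m := slope z a; have x0 := dx0 a aS az.
  have hm : a.2 - z.2 = (a.1 - z.1) * m by rewrite /m /slope mulrC divfK.
  have eY : Y a = X a * m%:P + (m - ms)%:P * 'X.
    rewrite /Y /X hm polyCM [(m - ms)%:P]polyCB -!mul_polyC polyC1.
    by move: ((a.1 - z.1)%:P) (m%:P) (ms%:P) => u v w; ring.
  have sNc : (size (map_poly polyC N) <= k.+2)%N by apply: leq_trans (size_poly _ _) _.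
  have [R hR] := hform_taylor (X a) m%:P ((m - ms)%:P * 'X) sNc.
  have := congr1 (fun f => X a * f) (G a aS).
  rewrite eB2 eB3 hformD !hformZ eY mulr0 !mulrDr hR.
  rewrite horner_map /= rootN // deriv_map horner_map /= mulr0 add0r.
  set h1 := hform k B2 _ _; set h3 := hform k.+1 B3 _ _ => e.
  have {}e : X a * h1 + X a ^+ k.+1 * (m - ms)%:P * (N^`().[m])%:P
      + (m - ms)%:P ^+ 2 * 'X * R + X a * h3 = 0.
    apply: (mulfI nX); rewrite mulr0 -[RHS]e.
    by move: (X a ^+ _) => u; ring.
  have := congr1 (fun f : {poly K} => f.[0]) e.
  have X0 : (X a).[0] = a.1 - z.1 by rewrite !hornerE /= subr0.
  have Y0 : (Y a).[0] = a.2 - z.2 by rewrite !hornerE /= subr0.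
  rewrite !(hornerD, hornerN, hornerZ, hornerM, horner_exp, hornerC, hornerX).
  rewrite !(mulr0, mul0r, addr0, oppr0) /h1 /h3 -eY !hform_at0 X0 Y0 !hform_horner // ?(leq_trans (size_poly _ _)) //.
  - rewrite -/(slope z a) -/m -/c1 -/c3 => e0; apply/eqP; rewrite -subr_eq0; apply/eqP.
    apply: (mulfI (expf_neq0 k.+1 x0)); rewrite mulr0 -[RHS]e0 !exprS.
    by move: (_ ^+ k) => u; ring.
  - rewrite -(size_scale B3 nX); have -> : 'X *: B3 = B' - map_poly polyC N.
      by rewrite {1}eB3 addrC addKr.
    by rewrite (leq_trans (size_polyD _ _)) // size_polyN geq_max sBk'.
  - by rewrite -(size_scale B2 nX) -eB2.
(* Two points of slope [m] with different first coordinates give two equations [key] with the same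
   right-hand side, so [c3] vanishes at [m]. *)
have c3l m : m \in l -> c1.[m] = (ms - m) * N^`().[m].
  case/dl => a [b [aS bS az bz [ab ea eb]]]; have := key a aS az; have := key b bS bz.
  rewrite ea eb => kb ka; have ab0 : a.1 - b.1 != 0.
    by rewrite subr_eq0; apply: contraNneq ab => e; apply/eqP/(uniq_fst_inj uS).
  have c30 : c3.[m] = 0.
    apply: (mulfI ab0); rewrite mulr0 -(subrr ((ms - m) * N^`().[m])) -{1}ka -kb; ring.
  by move: ka; rewrite c30 mulr0 addr0.
(* [c1] and [N] determine the first order term of the family; if the slopes in [l] are
   doubled, then [T] vanishes there, so [T = 0] and [k * N.[ms] = 0]. *)
pose T := c1 - (ms%:P - 'X) * N^`() - (k.+1)%:R *: N.
have T0 : T = 0.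
  apply: (poly_roots0 ul); last first.
    (* The multiple [k.+1] of [N] is the one for which the coefficients of degree [k.+1] cancel
       against ['X] times the derivative of [N]. Hence [T] has degree at most [k], and the [k.+1]
       slopes in [l] suffice. *)
    rewrite sl_l; apply/leq_sizeP => i ki.
    have c1i : c1`_i = 0.
      apply: nth_default; apply: leq_trans ki; apply: leq_trans (size_poly _ _) _.
      by rewrite -(size_scale B2 nX) -eB2.
    have Ni : N`_i.+1 = 0 by apply: nth_default; apply: leq_trans sN _; rewrite ltnS.
    rewrite /T !coefB coefZ mulrBl coefB coefCM coefXM !coef_deriv c1i Ni mul0rn mulr0.
    case: i ki {c1i} Ni => // i; rewrite leq_eqVlt => /orP[/eqP[->]|ki] _.
      by rewrite mulr_natl !sub0r opprK subrr.
    by rewrite [N`_i.+1]nth_default ?(leq_trans sN) // mul0rn mulr0 !subrr.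
  apply/allP => m ml; apply/rootP; rewrite /T !hornerE c3l //.
  have -> : N.[m] = 0 by have [a [_ [aS _ az _ [_ <- _]]]] := dl m ml; apply: rootN.
  by rewrite mulr0 subr0 subrr.
have Nms : N.[ms] = 0.
  have := congr1 (fun f : {poly K} => f.[ms]) T0; rewrite /T !hornerE c1ms.
  rewrite subrr mul0r subr0 -[X in X - _]mul1r -mulrBl -natr1 opprD addrCA subrr addr0.
  by move=> /eqP; rewrite mulf_eq0 oppr_eq0 (pcharf0P _).1 // (negPf (lt0n_neq0 k0)) => /eqP.
(* The direction [ms] was chosen outside the slopes of [S], so with [l] it gives [k.+2] roots, one
   too many for [N]. *)
case/eqP: N0; apply: (@poly_roots0 _ _ (ms :: l)); last by rewrite /= sl_l.
  rewrite /= ul andbT; apply/negP => /dl[a [_ [aS _ _ _ [_ e _]]]].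
  by have := hms a aS; rewrite e eqxx.
rewrite /= /root Nms eqxx; apply/allP => m ml.
by have [a [_ [aS _ az _ [_ <- _]]]] := dl m ml; rewrite /root rootN.
Qed.

End LocalLimit.

(** * Quartics in an affine chart *)

Lemma size_le_classes (T U : eqType) (f : T -> U) (b : nat) (s : seq T) (l : seq U) :
  (forall x, x \in s -> f x \in l) -> (forall y, y \in l -> (count (fun x => f x == y) s <= b)%N) ->
  (size s <= size l * b)%N.
Proof.
elim: l s => [|y l IH] s fl cb.
  by case: s fl {cb} => // x s /(_ x (mem_head _ _)).
rewrite -(count_predC (fun x => f x == y)) mulSn leq_add ?cb ?mem_head //.
rewrite -size_filter; apply: IH => [x|u ul].
  by rewrite mem_filter /= => /andP[/negPf fy /fl]; rewrite inE fy.
apply: leq_trans (cb u _); last by rewrite inE ul orbT.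
by rewrite count_filter; apply: sub_count => x /andP[].
Qed.

Section QuarticLines.
Variables (K : fieldType) (char0 : [pchar K] =i pred0).
Local Notation A2 := {poly {poly K}}.
Implicit Types (S : seq (K * K)) (z a b : K * K) (c : {poly K}) (C : {poly A2}) (l : K * K).

(** Vertical lines are left out: with distinct first coordinates such a line carries at most one
    point. *)
Definition on l a := a.2 == l.1 * a.1 + l.2.

Definition nofive S := forall l, (count (on l) S <= 4)%N.

Lemma at_pt_neq0 C : C != 0 -> generic (fun p q => at_pt p q C != 0).
Proof.
rewrite -lead_coef_eq0 => /generic_neq0; apply: generic_mono => p q.
by apply: contraNneq => /polyP/(_ (size C).-1); rewrite coef_map coef0 => e; apply/eqP.
Qed.

(** Here the line from the multiple point to [z] is always a component. Dividing [c] and [c'] by the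
    linear factor of its slope lowers degree and multiplicity by one, and the other points stay on
    the curve because generically their slopes differ. *)
Lemma generic_curve_remove k S C C' z : uniq [seq z.1 | z <- S] ->
    curve_family k S C C' -> z \in S ->
    (forall s m, s != 0 -> (at_pt (z.1 + s) (z.2 + m * s) C').[m] = 0) ->
  generic_curve k (rem z S).
Proof.
move=> uS fC zS red; have uS' := map_uniq uS.
have g0 : generic (fun p q => at_pt p q C != 0 \/ at_pt p q C' != 0).
  by have [/orP[] nz _ _ _] := fC; apply: generic_mono (at_pt_neq0 nz) => p q; [left|right].
have g1 : generic (fun p q => forall a, a \in rem z S -> slope (p, q) a != slope (p, q) z).
  apply: generic_all => a; rewrite mem_rem_uniq // inE => /andP[/= az aS].
  apply: generic_slope_neq; apply: contraNneq az => e.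
  by apply/eqP/(uniq_fst_inj uS).
apply: generic_mono (generic_and g0 (generic_and g1 (generic_xs S))) => p q [nz [hs hx]].
set m := slope (p, q) z in hs; have x0 := hx z zS; rewrite /= in x0.
have c'm : (at_pt p q C').[m] = 0.
  have s0 : p - z.1 != 0 by rewrite -opprB oppr_eq0.
  rewrite -(red (p - z.1) m s0); congr (at_pt _ _ _).[m]; first by rewrite addrC subrK.
  by rewrite /m /slope /=; field; rewrite x0.
have cm : (at_pt p q C).[m] = 0.
  by have := curve_family_point q fC zS x0; rewrite -/m c'm mulr0 addr0.
have [_ sC sC' _] := fC.
have /factor_theorem[d hd] : root (at_pt p q C) m by apply/rootP.
have /factor_theorem[d' hd'] : root (at_pt p q C') m by apply/rootP.
have sd (f g : {poly K}) n : f = g * ('X - m%:P) -> (size f <= n.+1)%N -> (size g <= n)%N.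
  move=> ->; have [->|g0'] := eqVneq g 0; first by rewrite size_poly0.
  by rewrite size_Mmonic ?monicXsubC // size_XsubC addn2.
exists d, d'; split.
- case: nz => nz; apply/orP; [left|right]; apply: contraNneq nz => d0.
    by rewrite hd d0 mul0r.
  by rewrite hd' d0 mul0r.
- exact: sd hd (size_at_pt _ _ sC).
- exact: sd hd' (size_at_pt _ _ sC').
move=> a aS'; have aS := mem_rem aS'; have x1 := hx a aS; rewrite /= in x1.
have := curve_family_point q fC aS x1; rewrite hd hd' !hornerM !hornerXsubC.
rewrite mulrA -mulrDl => /eqP; rewrite mulf_eq0 subr_eq0 (negPf (hs a aS')) orbF.
by move/eqP.
Qed.

Definition slopes_at S z (ms : seq K) :=
  forall m, m \in ms -> exists a, [/\ a \in S, a != z & slope z a = m].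

Lemma generic_curve_local k S z : (k < 4)%N -> uniq [seq z.1 | z <- S] -> (k + 6 <= size S)%N ->
    generic_curve k.+1 S -> z \in S ->
  generic_curve k (rem z S) \/
  (forall ms, uniq ms -> slopes_at S z ms -> (size ms <= k.+1)%N) /\
  ((0 < k)%N -> forall ms, uniq ms -> size ms = k.+1 -> ~ doubled_slopes S z ms).
Proof.
move=> k4 uS sS /(generic_curve_family char0)[C [C' fC]] zS.
have [red|nred] := pselect (forall s m, s != 0 -> (at_pt (z.1 + s) (z.2 + m * s) C').[m] = 0).
  by left; apply: generic_curve_remove fC zS red.
right; have [|N [N0 sN Nr dbl]] := local_limit char0 k4 uS sS fC zS.
  apply: contrapT => h; apply: nred => s m s0; apply/eqP; apply: contrapT => /negP nz.
  by apply: h; exists s, m.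
split => // ms ums hms; rewrite leqNgt; apply/negP => lt.
case/eqP: N0; apply: (poly_roots0 ums); last exact: leq_trans sN lt.
by apply/allP => m /hms[a [aS az <-]]; apply/rootP/Nr.
Qed.

(** A curve of degree [k] that meets [l] in more than [k] points contains [l]. As [P] is off [l],
    the rest has degree [k - 1] and still multiplicity [k - 1] at [P], so it consists of [k - 1]
    lines through [P], and these carry at most one point of [S] each. *)
Lemma line_component k S l : uniq [seq z.1 | z <- S] -> generic_curve k S ->
  (k < count (on l) S)%N -> (count (predC (on l)) S < k)%N.
Proof.
move=> uS gS; set T := filter (on l) S; set U := filter (predC (on l)) S.
have g1 : generic (fun p q => l.1 * p + (-1) * q + l.2 != 0).
  by apply: generic_affine; rewrite oppr_eq0 oner_eq0 orbT.
have [p [q [[[c [c' [nz sc sc' hc]]] [hx hu]] k0]]] := generic_ex char0 (generic_and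
  (generic_and gS (generic_and (generic_xs S) (generic_slopes_uniq uS))) g1).
rewrite -!size_filter -/T -/U => sT; rewrite ltnNge; apply/negP => sU.
set r := l.1 * p + (-1) * q + l.2 in k0.
have usub P : uniq [seq slope (p, q) z | z <- filter P S].
  exact: subseq_uniq (map_subseq _ (filter_subseq _ _)) hu.
have lineE a : a \in S -> c.[slope (p, q) a] * (slope (p, q) a - l.1) + r * c'.[slope (p, q) a]
    = c'.[slope (p, q) a] * (l.1 * a.1 + l.2 - a.2).
  move=> aS; have x0 := hx a aS; have := hc a aS; set m := slope (p, q) a.
  have hm : a.2 - q = (a.1 - p) * m by rewrite /m /slope /= mulrC divfK.
  move=> /eqP; rewrite addr_eq0 => /eqP ->; rewrite /r.
  have -> : a.2 = q + (a.1 - p) * m by rewrite -hm addrC subrK.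
  by ring.
(* The line of slope [m] through [(p, q)] meets [l] at position [r / (m - l.1)], so this polynomial
   of degree at most [k] vanishes at the slopes of the points on [l]. *)
have P0 : c * ('X - (l.1)%:P) + r *: c' = 0.
  apply: (poly_roots0 (usub (on l))).
    rewrite all_map; apply/allP => a; rewrite mem_filter => /andP[/eqP al aS] /=.
    by rewrite /root !hornerE lineE // al subrr mulr0.
  rewrite size_map (leq_trans _ sT) // (leq_trans (size_polyD _ _)) // geq_max.
  rewrite (leq_trans (size_scale_leq _ _)) // andbT.
  have [->|c0] := eqVneq c 0; first by rewrite mul0r size_poly0.
  by rewrite size_Mmonic ?monicXsubC // size_XsubC addn2.
have c0 : c = 0.
  apply: (poly_roots0 (usub (predC (on l)))); last by rewrite size_map (leq_trans sc).
  rewrite all_map; apply/allP => a; rewrite mem_filter => /andP[/= al aS]; rewrite /root.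
  have al' : l.1 * a.1 + l.2 - a.2 != 0 by rewrite subr_eq0 eq_sym.
  have := lineE a aS; have := congr1 (fun f => f.[slope (p, q) a]) P0.
  rewrite !hornerE => -> /esym/eqP; rewrite mulf_eq0 (negPf al') orbF => /eqP c'0.
  by have := hc a aS; rewrite c'0 mulr0 addr0 => ->.
case/orP: nz; rewrite ?c0 ?eqxx //; move: P0; rewrite c0 mul0r add0r => /eqP.
by rewrite scaler_eq0 (negPf k0) => /= ->.
Qed.

Lemma on_slope a b l : a.1 != b.1 -> on l a -> on l b = (slope a b == l.1).
Proof.
move=> ab /eqP al; have ba : b.1 - a.1 != 0 by rewrite subr_eq0 eq_sym.
rewrite /on /slope -[RHS](inj_eq (mulIf ba)) divfK // al.
by rewrite -subr_eq0 -[RHS]subr_eq0; congr (_ == 0); ring.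
Qed.

Lemma nofive_slopes S z m (b : nat) : uniq [seq z.1 | z <- S] -> z \in S ->
  (forall l, (count (on l) S <= b.+1)%N) -> (count (fun a => slope z a == m) (rem z S) <= b)%N.
Proof.
move=> uS zS hb; have uS' := map_uniq uS.
have := hb (m, z.2 - m * z.1); rewrite (permP (perm_to_rem zS)) /= /on /= addrC subrK eqxx add1n ltnS.
apply: leq_trans; apply: eq_leq; apply: eq_in_count => a.
rewrite mem_rem_uniq // inE => /andP[/= az aS].
have az1 : z.1 != a.1 by apply: contraNneq az => e; apply/eqP/(uniq_fst_inj uS).
by rewrite -/(on (m, z.2 - m * z.1) a) (on_slope az1) // /on /= addrC subrK.
Qed.

Lemma nofive_rem S z : nofive S -> nofive (rem z S).
Proof.
move=> h l; apply: leq_trans (h l).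
have [zS|zS] := boolP (z \in S); last by rewrite rem_id.
by rewrite (permP (perm_to_rem zS)) /= leq_addl.
Qed.

Lemma slopes_at_undup S z : uniq S -> slopes_at S z (undup [seq slope z a | a <- rem z S]).
Proof.
move=> uS m; rewrite mem_undup => /mapP[a]; rewrite mem_rem_uniq // inE => /andP[/= az aS] ->.
by exists a.
Qed.

(** Applied with [k = 3] to the residual cubic through at least eight points, this excludes that a
    line splits off a quartic. In the induction either one more line splits off, or each point lies
    on at most as many lines as the degree, with too few points on each. *)
Lemma no_small_curve k S : (k <= 3)%N -> uniq [seq z.1 | z <- S] -> (k + 5 <= size S)%N ->
  nofive S -> ~ generic_curve k S.
Proof.
elim: k S => [|k IH] S k3 uS sS n5 gS.
  case: S sS uS gS {n5} => // a S _ uS gS.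
  have := line_component (l := (0, a.2)) uS gS; rewrite ltn0 => h; suff : false by [].
  by apply: h; rewrite /= /on mul0r add0r eqxx.
case: S sS uS n5 gS => // z S' sS uS n5 gS; set S := z :: S' in sS uS n5 gS.
have zS : z \in S := mem_head _ _; have uS' := map_uniq uS.
have sr : (size (rem z S)).+1 = size S by rewrite size_rem.
have sub : uniq [seq a.1 | a <- rem z S] by apply: subseq_uniq uS; apply/map_subseq/rem_subseq.
have sS6 : (k + 6 <= size S)%N by rewrite addnS -addSn.
have [gr|[sl_le _]] := generic_curve_local (leqW k3) uS sS6 gS zS.
  by apply: (IH (rem z S)) => //; [lia | rewrite -ltnS sr; lia | exact: nofive_rem].
have hb l : (count (on l) S <= k.+1)%N.
  rewrite leqNgt; apply/negP => lt; have := line_component uS gS lt.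
  have := count_predC (on l) S; have := n5 l; lia.
have := size_le_classes (f := slope z) (b := k) (s := rem z S)
  (l := undup [seq slope z a | a <- rem z S]).
have := sl_le _ (undup_uniq _) (slopes_at_undup uS').
set n := size _ => n_le /(_ _ _)/[dup] h.
have {h} : (size (rem z S) <= n * k)%N.
  apply: h => [a aS|m _]; first by rewrite mem_undup map_f.
  exact: nofive_slopes.
move=> le; have : (n * k <= k.+1 * k)%N by rewrite leq_mul2r n_le orbT.
(* Here [k <= 2]. The inequality fails for [k = 3], so for quartics counting lines through a point
   is not enough and the first order term is required. *)
have kk : (k.+1 * k < k + 5)%N by move: k3; case: (k) => [|[|[|]]].
by move=> le'; have := leq_trans le le'; rewrite -ltnS sr => /leq_trans/(_ kk); rewrite ltnNge -ltnS -addSn sS.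
Qed.

Theorem generic_quartic_local S z : uniq [seq z.1 | z <- S] -> (9 <= size S)%N ->
    nofive S -> generic_curve 4 S -> z \in S ->
  (forall ms, uniq ms -> slopes_at S z ms -> (size ms <= 4)%N) /\
  (forall ms, uniq ms -> size ms = 4 -> ~ doubled_slopes S z ms).
Proof.
move=> uS sS n5 gS zS; have [|gr|[]] := @generic_curve_local 3 S z _ uS sS gS zS => //.
- exfalso; apply: (@no_small_curve 3 (rem z S)) gr => //.
  + by apply: subseq_uniq uS; apply/map_subseq/rem_subseq.
  + by rewrite size_rem // -ltnS prednK // (leq_trans _ sS).
  + exact: nofive_rem.
by move=> h1 /(_ isT).
Qed.

End QuarticLines.

(** * Incidences forced by a generic quartic *)

Section Classification.
Variables (K : fieldType) (char0 : [pchar K] =i pred0).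
Implicit Types (S : seq (K * K)) (a b c d z : K * K).

Definition collinear a b c := (b.2 - a.2) * (c.1 - a.1) == (c.2 - a.2) * (b.1 - a.1).

Lemma colC a b c : collinear a b c = collinear b a c.
Proof. by rewrite /collinear -subr_eq0 -[RHS]subr_eq0 -[RHS]oppr_eq0; congr (_ == 0); ring. Qed.

Lemma colR a b c : collinear a b c = collinear a c b.
Proof. by rewrite /collinear eq_sym. Qed.

Lemma col_refl a b : collinear a a b.
Proof. by rewrite /collinear !subrr mul0r mulr0. Qed.

Lemma col_trans a b c d : a != b -> collinear a b c -> collinear a b d -> collinear a c d.
Proof.
move=> ab /eqP abc /eqP abd; rewrite /collinear -subr_eq0.
have [b1|b1] := eqVneq (b.1 - a.1) 0; last first.
  apply/eqP/(mulfI b1); rewrite mulr0 mulrBr.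
  transitivity ((c.2 - a.2) * (b.1 - a.1) * (d.1 - a.1) - (d.2 - a.2) * (b.1 - a.1) * (c.1 - a.1)); first by ring.
  by rewrite -abc -abd; ring.
have b2 : b.2 - a.2 != 0.
  apply: contraNneq ab => b2; apply/eqP; case: a b b1 b2 {abc abd} => a1 a2 [? ?] /= /eqP + /eqP.
  by rewrite !subr_eq0 => /eqP-> /eqP->.
apply/eqP/(mulfI b2); rewrite mulr0 mulrBr.
transitivity ((c.2 - a.2) * ((b.2 - a.2) * (d.1 - a.1)) - (d.2 - a.2) * ((b.2 - a.2) * (c.1 - a.1))); first by ring.
by rewrite abc abd; ring.
Qed.

Lemma col_slope a b c : b.1 != a.1 -> c.1 != a.1 -> collinear a b c = (slope a b == slope a c).
Proof. by move=> ba ca; rewrite /collinear /slope eqr_div // subr_eq0. Qed.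

Lemma col_on a b c : a.1 != b.1 -> collinear a b c = on (slope a b, a.2 - slope a b * a.1) c.
Proof.
move=> ab; have ba : b.1 - a.1 != 0 by rewrite subr_eq0 eq_sym.
rewrite /collinear /on /=; have {1}-> : b.2 - a.2 = slope a b * (b.1 - a.1) by rewrite /slope divfK.
rewrite mulrAC (inj_eq (mulIf ba)) eq_sym -subr_eq0 -[RHS]subr_eq0.
by congr (_ == 0); ring.
Qed.

Section Fixed.
Variable S : seq (K * K).
Hypothesis uS : uniq [seq z.1 | z <- S].
Hypothesis sS : (9 <= size S)%N.
Hypothesis n5 : nofive S.
Hypothesis gS : generic_curve 4 S.

Lemma neq_fst a b : a \in S -> b \in S -> a != b -> a.1 != b.1.
Proof. by move=> aS bS; apply: contraNneq => e; apply/eqP/(uniq_fst_inj uS). Qed.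

Lemma col_no5 a b : a \in S -> b \in S -> a != b -> (count (collinear a b) S <= 4)%N.
Proof.
move=> aS bS ab; apply: leq_trans (n5 (slope a b, a.2 - slope a b * a.1)); apply: eq_leq.
by apply: eq_count => c; rewrite col_on // neq_fst.
Qed.

Lemma col_lines4 z s : z \in S -> size s = 5 -> uniq s -> {subset s <= S} -> z \notin s ->
  exists a b, [/\ a \in s, b \in s, a != b & collinear z a b].
Proof.
move=> zS s5 us sub zs; have [le4 _] := generic_quartic_local char0 uS sS n5 gS zS.
apply: contrapT => h; have := le4 (map (slope z) s).
rewrite size_map s5 => /(_ _ _) h'; suff : (5 <= 4)%N by [].
have az a : a \in s -> a != z by move=> ha; apply: contraNneq zs => <-.
apply: h' => [|m /mapP[a ha ->]]; last by exists a; rewrite sub // az.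
rewrite map_inj_in_uniq // => a b ha hb e; apply/eqP/negP => /negP ab; apply: h.
exists a, b; split=> //.
rewrite col_slope; [exact/eqP | exact: (neq_fst (sub _ ha) zS (az _ ha)) | exact: (neq_fst (sub _ hb) zS (az _ hb))].
Qed.

(** The eight other points lie on at most four lines through [z]. If none of these carries three of
    them, then there are four lines with exactly two each, which is the case excluded by
    [doubled_slopes]. *)
Lemma col_fourline z : size S = 9 -> z \in S -> exists2 l, fourline collinear S l & z \in l.
Proof.
move=> s9 zS; have [le4 dbl] := generic_quartic_local char0 uS sS n5 gS zS.
have uS' := map_uniq uS.
pose O := rem z S; have sO : size O = 8 by rewrite size_rem // s9.
have OP a : a \in O -> a \in S /\ a != z by rewrite mem_rem_uniq // inE => /andP[/= -> ->].
pose ms := undup (map (slope z) O).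
have ums : uniq ms by apply: undup_uniq.
have sms : (size ms <= 4)%N by apply: le4 => //; apply: slopes_at_undup.
have inms a : a \in O -> slope z a \in ms by move=> aO; rewrite mem_undup map_f.
have two m (k : nat) : (k < count (fun a => slope z a == m) O)%N -> exists s,
    [/\ size s = k.+1, uniq s, {subset s <= O} & forall a, a \in s -> slope z a = m].
  move=> lt; exists (take k.+1 (filter (fun a => slope z a == m) O)); split.
  - by rewrite size_takel // size_filter.
  - by rewrite take_uniq // filter_uniq // rem_uniq.
  - by move=> a /mem_take; rewrite mem_filter => /andP[].
  - by move=> a /mem_take; rewrite mem_filter => /andP[/eqP].
have [[m [mms m3]]|no3] := pselect (exists m, m \in ms /\ (2 < count (fun a => slope z a == m) O)%N).
  have [s [ss us sub hs]] := two _ _ m3.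
  case: s ss us sub hs => [|a [|b [|c [|]]]] // _ us sub hs.
  have aO : a \in O by apply: sub; rewrite !inE eqxx.
  have bO : b \in O by apply: sub; rewrite !inE eqxx ?orbT.
  have cO : c \in O by apply: sub; rewrite !inE eqxx ?orbT.
  have [[[aS az] [bS bz]] [cS cz]] := (OP a aO, OP b bO, OP c cO).
  exists [:: z; a; b; c]; last by rewrite mem_head.
  apply: fourlineI.
  - exact: colC.
  - exact: colR.
  - exact: col_refl.
  - exact: col_trans.
  - by rewrite cons_uniq us andbT !inE !negb_or ![z == _]eq_sym az bz cz.
  - by move=> x; rewrite !inE => /or4P[]/eqP->.
  - by rewrite col_slope ?neq_fst // !hs // !inE eqxx ?orbT.
  - by rewrite col_slope ?neq_fst // !hs // !inE eqxx ?orbT.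
have le2 m : m \in ms -> (count (fun a => slope z a == m) O <= 2)%N.
  by move=> mms; rewrite leqNgt; apply/negP => lt; apply: no3; exists m.
have s4 : size ms = 4.
  apply/eqP; rewrite eqn_leq sms /=; have := size_le_classes inms le2.
  by rewrite sO (@leq_pmul2r 2 4).
case: (dbl ms ums s4) => m mms.
have lt1 : (1 < count (fun a => slope z a == m) O)%N.
  rewrite ltnNge; apply/negP => le1.
  have := @size_le_classes _ _ (slope z) 2 (filter (fun a => slope z a != m) O) (rem m ms) _ _.
  have -> : size (rem m ms) = 3 by rewrite size_rem // s4.
  have := count_predC (fun a => slope z a == m) O; rewrite sO -[count (predC _) _]size_filter => e.
  move=> /(_ _ _) h; suff : (size (filter (fun a => slope z a != m) O) <= 6)%N.
    by rewrite leqNgt => /negP; apply; rewrite -(ltn_add2l 1); apply: leq_trans (leq_add le1 (leqnn _)); rewrite e.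
  apply: h => [a|m'].
    rewrite mem_filter => /andP[am aO]; rewrite mem_rem_uniq // inE /= am; exact: inms.
  move=> /mem_rem m'ms; apply: leq_trans (le2 m' m'ms).
  by rewrite count_filter; apply: sub_count => a /andP[].
have [s [ss us sub hs]] := two _ _ lt1.
case: s ss us sub hs => [|a [|b [|]]] // _ us sub hs.
have aO : a \in O by apply: sub; rewrite !inE eqxx.
have bO : b \in O by apply: sub; rewrite !inE eqxx ?orbT.
have [[aS az] [bS bz]] := (OP a aO, OP b bO).
exists a, b; split => //; split; last 2 first.
- by apply: hs; rewrite mem_head.
- by apply: hs; rewrite !inE eqxx orbT.
by move: us; rewrite /= inE andbT.
Qed.

Lemma col_no_doubled z (s : seq ((K * K) * (K * K))) : z \in S -> size s = 4 ->
    (forall p, p \in s -> [/\ p.1 \in S, p.2 \in S, p.1 != z, p.2 != z & p.1 != p.2 /\ collinear z p.1 p.2]) ->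
    pairwise (fun p q => ~~ collinear z p.1 q.1) s -> False.
Proof.
move=> zS s4 hs pw; have [_ dbl] := generic_quartic_local char0 uS sS n5 gS zS.
apply: (dbl [seq slope z p.1 | p <- s]); rewrite ?size_map //.
  rewrite uniq_pairwise pairwise_map; apply: (sub_in_pairwise (P := mem s)) pw; last by apply/allP.
  move=> p q /hs[p1 _ p1z _ _] /hs[q1 _ q1z _ _] /=; rewrite col_slope //; exact: neq_fst.
move=> m /mapP[p /hs[p1 p2 p1z p2z [p12 cp]] ->]; exists p.1, p.2; split => //; split => //.
by apply/esym/eqP; rewrite -col_slope //; apply: neq_fst.
Qed.

End Fixed.

Lemma generic_curve_sub k S S' : {subset S' <= S} -> generic_curve k S -> generic_curve k S'.
Proof.
move=> sub; apply: generic_mono => p q [c [c' [nz sc sc' h]]].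
by exists c, c'; split => // z /sub/h.
Qed.

Lemma fourline_sub S S' l : {subset S' <= S} -> fourline collinear S' l -> fourline collinear S l.
Proof. by move=> sub [szl ul lS hl]; split => // x /lS/sub. Qed.

(** Nine of the points form the configuration. For a tenth point [Q], the bound of four lines
    through [a1] puts [Q] on a line from [a1] to a point of the line of [a2], [a5], [a8], [a9]. For
    [a2] and [a5] this gives five collinear points; for [a8] and [a9] it gives four lines through
    that point with two further points each. *)
Theorem B3_of_quartic S : uniq [seq z.1 | z <- S] -> (9 <= size S)%N ->
    nofive S -> generic_curve 4 S ->
  exists2 s, B3_configuration collinear S s & perm_eq s S.
Proof.
move=> uS sS n5 gS; pose S' := take 9 S.
have sub : {subset S' <= S} by move=> x /mem_take.
have uS' : uniq [seq z.1 | z <- S'] by rewrite /S' map_take take_uniq.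
have sS' : size S' = 9 by rewrite size_takel.
have n5' : nofive S'.
  by move=> l; apply: leq_trans (n5 l); rewrite -[X in (_ <= count _ X)%N](cat_take_drop 9 S) count_cat leq_addr.
have gS' := generic_curve_sub sub gS.
have [|||||s [a1 [a2 [a3 [a4 [a5 [a6 [a7 [a8 [a9 [es L1 L2 L3 [c1 c2 c3 c4]]]]]]]]]]] ps] :=
  @B3_of_nine _ collinear S' colC colR col_refl col_trans.
- by apply: col_no5.
- exact: map_uniq uS'.
- by apply: col_lines4; rewrite ?sS'.
- exact: sS'.
- by move=> z; apply: col_fourline; rewrite ?sS'.
have {}L1 := fourline_sub sub L1; have {}L2 := fourline_sub sub L2; have {}L3 := fourline_sub sub L3.
have [S9|S9] := leqP (size S) 9.
  have eS : S' = S by apply: take_oversize.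
  by exists s; [exists a1, a2, a3, a4, a5, a6, a7, a8, a9 | rewrite -eS].
exfalso; pose Q := nth 0 S 9.
have QS : Q \in S by apply: mem_nth.
have QS' : Q \notin s.
  rewrite (perm_mem ps); have := map_uniq uS; rewrite -[X in uniq X](cat_take_drop 9 S) cat_uniq.
  case/and3P => _ /hasPn h _; apply: h; rewrite (drop_nth 0) //; exact: mem_head.
have U : uniq s by rewrite (perm_uniq ps); apply: map_uniq uS'.
have sS1 x : x \in s -> x \in S by rewrite (perm_mem ps) => /sub.
have out := fourline_out (col_no5 uS n5).
rewrite es in U QS' sS1; move: U QS'; rewrite /= !inE !negb_or !andbT => U QS'; split_andb.
have i1 : a1 \in S by apply: sS1; rewrite !inE eqxx ?orbT.
have i2 : a2 \in S by apply: sS1; rewrite !inE eqxx ?orbT.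
have i3 : a3 \in S by apply: sS1; rewrite !inE eqxx ?orbT.
have i4 : a4 \in S by apply: sS1; rewrite !inE eqxx ?orbT.
have i5 : a5 \in S by apply: sS1; rewrite !inE eqxx ?orbT.
have i6 : a6 \in S by apply: sS1; rewrite !inE eqxx ?orbT.
have i7 : a7 \in S by apply: sS1; rewrite !inE eqxx ?orbT.
have i8 : a8 \in S by apply: sS1; rewrite !inE eqxx ?orbT.
have i9 : a9 \in S by apply: sS1; rewrite !inE eqxx ?orbT.
have key w x y : w \in [:: a8; a9] -> x \in [:: a6; a7] -> y \in [:: a6; a7] ->
    collinear a3 x w -> collinear a4 y w -> collinear a1 w Q -> False.
  move=> hw hx hy c3x c4y c1Q.
  have wS : w \in S by move: hw; rewrite !inE => /orP[]/eqP->.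
  have wL3 : w \in [:: a2; a5; a8; a9] by move: hw; rewrite !inE => /orP[]/eqP->; rewrite eqxx ?orbT.
  have xS : x \in S by move: hx; rewrite !inE => /orP[]/eqP->.
  have yS : y \in S by move: hy; rewrite !inE => /orP[]/eqP->.
  have [w1 w2 w3 w4 [w5 wx wy wQ]] : [/\ a1 != w, a2 != w, a3 != w, a4 != w & [/\ a5 != w, x != w, y != w & Q != w]].
    move: hw hx hy; rewrite !inE => /orP[]/eqP-> /orP[]/eqP-> /orP[]/eqP->; split; try split; neq_from_context.
  have [x3 y4] : a3 != x /\ a4 != y.
    by move: hx hy; rewrite !inE => /orP[]/eqP-> /orP[]/eqP->; split; neq_from_context.
  have w1L : w \notin [:: a1; a2; a3; a4] by rewrite !inE !negb_or ![w == _]eq_sym w1 w2 w3 w4.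
  apply: (@col_no_doubled S uS sS n5 gS w [:: (a2, a5); (a3, x); (a4, y); (a1, Q)]) => //.
    move=> p; rewrite !inE => /or4P[]/eqP->; split => //; split => //=; try neq_from_context.
    - by case: L3 => _ _ _; apply; rewrite // !inE eqxx ?orbT.
    - by rewrite colC colR.
    - by rewrite colC colR.
    - by rewrite colC.
  rewrite /= !andbT; repeat (apply/andP; split).
  - by rewrite (out _ _ _ _ L3) // ?inE ?eqxx ?orbT //; neq_from_context.
  - by rewrite (out _ _ _ _ L3) // ?inE ?eqxx ?orbT //; neq_from_context.
  - by rewrite (out _ _ _ _ L3) // ?inE ?eqxx ?orbT //; neq_from_context.
  - by rewrite colC colR (out _ _ _ _ L1) // ?inE ?eqxx ?orbT //; neq_from_context.
  - by rewrite colC colR (out _ _ _ _ L1) // ?inE ?eqxx ?orbT //; neq_from_context.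
  - by rewrite colC colR (out _ _ _ _ L1) // ?inE ?eqxx ?orbT //; neq_from_context.
have step u : u \in [:: a2; a5; a8; a9] -> collinear a1 u Q -> False.
  rewrite !inE => /or4P[]/eqP-> c.
  - by move: c; rewrite (out _ _ _ _ L1) // ?inE ?eqxx ?orbT //; neq_from_context.
  - by move: c; rewrite (out _ _ _ _ L2) // ?inE ?eqxx ?orbT //; neq_from_context.
  - by apply: (key a8 a6 a7) => //; rewrite !inE eqxx ?orbT.
  - by apply: (key a9 a7 a6) => //; rewrite !inE eqxx ?orbT.
have a1L3 : a1 \notin [:: a2; a5; a8; a9] by neq_from_context.
have QL3 : Q \notin [:: a2; a5; a8; a9] by neq_from_context.
have [|||u [v [uin vin uv c]]] := @col_lines4 S uS sS n5 gS a1 (Q :: [:: a2; a5; a8; a9]) i1 erefl.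
- by case: L3 => _ u3 _ _; rewrite cons_uniq QL3.
- by move=> x; rewrite inE => /predU1P[->//|]; case: L3 => _ _ h _ /h.
- by rewrite inE negb_or a1L3 andbT; neq_from_context.
move: uin vin; rewrite ![_ \in Q :: _]inE => /predU1P[eu|uin] /predU1P[ev|vin].
- by rewrite eu ev eqxx in uv.
- by apply: (step v) => //; rewrite -eu colR.
- by apply: (step u) => //; rewrite -ev.
by move: c; rewrite colC colR (out _ _ _ _ L3 uin vin uv i1 a1L3).
Qed.

End Classification.

(** * Coordinates for the configuration *)

Section Frame.
Variables (K : fieldType).
Implicit Types (a b c : K * K).

Lemma row3_scale (t x y z : K) : t *: row3 x y z = row3 (t * x) (t * y) (t * z).
Proof. by apply/rowP => -[[|[|[|]]] //= ?]; rewrite !mxE. Qed.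

Lemma row3_add (x y z x' y' z' : K) :
  row3 x y z + row3 x' y' z' = row3 (x + x') (y + y') (z + z').
Proof. by apply/rowP => -[[|[|[|]]] //= ?]; rewrite !mxE. Qed.

Definition mx3 (f1 f2 f3 : 'rV[K]_3) : 'M[K]_3 :=
  \matrix_(i, j) [:: f1 0 j; f2 0 j; f3 0 j]`_i.

Lemma row3_mul x y z f1 f2 f3 : row3 x y z *m mx3 f1 f2 f3 = x *: f1 + y *: f2 + z *: f3.
Proof.
apply/rowP => j; rewrite !mxE !big_ord_recl big_ord0 !mxE /= addr0 addrA.
by [].
Qed.

Lemma row3E (v : 'rV[K]_3) : v = row3 (v 0 0) (v 0 1) (v 0 (inord 2)).
Proof.
apply/rowP => -[[|[|[|]]] //= h]; rewrite !mxE /=; congr (v 0 _); apply: val_inj => //=.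
by rewrite inordK.
Qed.

Definition hom a := row3 a.1 a.2 1.

(** The parameter is the division ratio: [c] is proportional to [a + p b] in homogeneous
    coordinates. *)
Lemma col_param a b c : a.1 != b.1 -> c.1 != a.1 -> c.1 != b.1 -> collinear a b c -> exists p,
  [/\ p != 0, 1 + p != 0 & c = ((a.1 + p * b.1) / (1 + p), (a.2 + p * b.2) / (1 + p))].
Proof.
move=> ab ca cb abc; have ab' : b.1 - a.1 != 0 by rewrite subr_eq0 eq_sym.
have cb' : b.1 - c.1 != 0 by rewrite subr_eq0 eq_sym.
have ca' : c.1 - a.1 != 0 by rewrite subr_eq0.
have p1 : 1 + (c.1 - a.1) / (b.1 - c.1) = (b.1 - a.1) / (b.1 - c.1) by field.
exists ((c.1 - a.1) / (b.1 - c.1)); rewrite p1; split.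
- by rewrite mulf_neq0 ?invr_eq0.
- by rewrite mulf_neq0 ?invr_eq0.
have c2 : c.2 = a.2 + (b.2 - a.2) * (c.1 - a.1) / (b.1 - a.1).
  by move/eqP: abc => ->; field.
case: c => x y /= in ca cb abc cb' ca' p1 c2 *; rewrite c2; congr (_, _); field; by rewrite ab' cb'.
Qed.

Definition area a b c := (b.2 - a.2) * (c.1 - a.1) - (c.2 - a.2) * (b.1 - a.1).

Lemma mx3_unit a b c (x y z : K) : ~~ collinear a b c -> x != 0 -> y != 0 -> z != 0 ->
  mx3 (x *: hom a) (y *: hom b) (z *: hom c) \in unitmx.
Proof.
move=> abc x0 y0 z0; have D0 : area a b c != 0 by rewrite subr_eq0.
rewrite -row_free_unit; apply: inj_row_free => v; rewrite (row3E v) row3_mul.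
move: (v 0 0) (v 0 1) (v 0 (inord 2)) => s t w; rewrite /hom !row3_scale !row3_add !mulr1 => /eqP.
rewrite row3_eq0 => /and3P[/eqP e1 /eqP e2 /eqP e3].
have w0 : w * z = 0.
  apply: (mulIf D0); rewrite mul0r /area.
  transitivity ((b.2 - a.2) * (s * (x * a.1) + t * (y * b.1) + w * (z * c.1))
     - (b.1 - a.1) * (s * (x * a.2) + t * (y * b.2) + w * (z * c.2))
     + (b.1 * a.2 - b.2 * a.1) * (s * x + t * y + w * z)); first by ring.
  by rewrite e1 e2 e3; ring.
have t0 : t * y = 0.
  apply: (mulIf D0); rewrite mul0r /area.
  transitivity ((c.1 - a.1) * (s * (x * a.2) + t * (y * b.2) + w * (z * c.2))
     - (c.2 - a.2) * (s * (x * a.1) + t * (y * b.1) + w * (z * c.1))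
     + (c.2 * a.1 - c.1 * a.2) * (s * x + t * y + w * z)); first by ring.
  by rewrite e1 e2 e3; ring.
have s0 : s * x = 0 by move: e3; rewrite w0 t0 !addr0.
move/eqP: w0; rewrite mulf_eq0 (negPf z0) orbF => /eqP ->.
move/eqP: t0; rewrite mulf_eq0 (negPf y0) orbF => /eqP ->.
move/eqP: s0; rewrite mulf_eq0 (negPf x0) orbF => /eqP ->.
by apply/eqP; rewrite row3_eq0 !eqxx.
Qed.

(** Listed in the order [a1], ..., [a9] of [B3_configuration], with the triangle at the coordinate
    points; up to sign these are the positive roots of type $B_3$. *)
Definition Z0_rows : seq 'rV[K]_3 :=
  [:: row3 1 0 0; row3 0 1 0; row3 1 1 0; row3 1 (-1) 0; row3 0 0 1;
      row3 1 0 1; row3 (-1) 0 1; row3 0 (-1) 1; row3 0 1 1].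

(** Menelaus' theorem: the difference [p b - r c] of the vectors [a + p b] and [a + r c] has to be a
    multiple of [b + u c]. *)
Lemma col_menelaus a b c (p r u : K) : ~~ collinear a b c -> 1 + p != 0 -> 1 + r != 0 -> 1 + u != 0 ->
  collinear ((a.1 + p * b.1) / (1 + p), (a.2 + p * b.2) / (1 + p))
      ((a.1 + r * c.1) / (1 + r), (a.2 + r * c.2) / (1 + r))
      ((b.1 + u * c.1) / (1 + u), (b.2 + u * c.2) / (1 + u)) -> r = - (p * u).
Proof.
move=> abc p1 r1 u1; rewrite /collinear /= -subr_eq0 => /eqP e.
have D0 : area a b c != 0 by rewrite subr_eq0.
apply/eqP; rewrite -subr_eq0 opprK; apply/eqP/(mulIf D0); rewrite mul0r.
have h : (1 + p) * (1 + r) * (1 + u) != 0 by rewrite !mulf_neq0.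
apply: (mulIf (invr_neq0 h)); rewrite mul0r -[RHS]oppr0 -e /area; field.
by rewrite p1 r1 u1.
Qed.

(** The four three-point lines give four Menelaus relations between the six division ratios. They
    imply [p ^ 2 = q ^ 2], hence [q = - p], and then leave only [p] and [r] free; these two are
    absorbed by scaling the vertices [a2] and [a5]. *)
Lemma B3_frame a1 a2 a3 a4 a5 a6 a7 a8 a9 :
    uniq [seq z.1 | z <- [:: a1; a2; a3; a4; a5; a6; a7; a8; a9]] ->
    ~~ collinear a1 a2 a5 ->
    [/\ collinear a1 a2 a3, collinear a1 a2 a4, collinear a1 a5 a6 & collinear a1 a5 a7] ->
    collinear a2 a5 a8 -> collinear a2 a5 a9 ->
    [/\ collinear a3 a6 a8, collinear a3 a7 a9, collinear a4 a6 a9 & collinear a4 a7 a8] ->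
  exists2 g : 'M[K]_3, g \in unitmx &
    forall i, (i < 9)%N -> exists2 t : K, t != 0 &
      hom [:: a1; a2; a3; a4; a5; a6; a7; a8; a9]`_i *m g = t *: Z0_rows`_i.
Proof.
move=> U nc [c3 c4 c6 c7] c8 c9 [t1 t2 t3 t4].
rewrite /= !inE !negb_or !andbT in U; split_andb.
have [|||p [p0 p1 e3]] := col_param _ _ _ c3; try by neq_from_context.
have [|||q [q0 q1 e4]] := col_param _ _ _ c4; try by neq_from_context.
have [|||r [r0 r1 e6]] := col_param _ _ _ c6; try by neq_from_context.
have [|||r' [r0' r1' e7]] := col_param _ _ _ c7; try by neq_from_context.
have [|||u [u0 u1 e8]] := col_param _ _ _ c8; try by neq_from_context.
have [|||u' [u0' u1' e9]] := col_param _ _ _ c9; try by neq_from_context.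
have pq : p != q.
  have : a3.1 != a4.1 by [].
  by apply: contraNneq => pq; rewrite e3 e4 pq.
move: t1 t2 t3 t4; rewrite e3 e4 e6 e7 e8 e9.
move=> /(col_menelaus nc p1 r1 u1) h1 /(col_menelaus nc p1 r1' u1') h2.
move=> /(col_menelaus nc q1 r1 u1') h3 /(col_menelaus nc q1 r1' u1) h4.
have qp : q = - p.
  have : (p - q) * (p + q) == 0.
    apply/eqP/(mulIf u0); rewrite mul0r.
    transitivity (- p * - (p * u) + q * - (q * u)); first by ring.
    rewrite -h1 -h4 h3 h2; ring.
  by rewrite mulf_eq0 subr_eq0 (negPf pq) /= addrC addr_eq0 => /eqP.
have ur : u = - r / p by rewrite h1; field.
have ur' : u' = r / p by rewrite h3 qp; field.
have r'r : r' = - r by rewrite h4 h1 qp; ring.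
pose B := mx3 (1 *: hom a1) (p *: hom a2) (r *: hom a5).
have uB : B \in unitmx by apply: mx3_unit; rewrite ?oner_eq0.
exists (invmx B); first by rewrite unitmx_inv.
have inv t x y z w : t != 0 -> hom w = t *: (x *: (1 *: hom a1) + y *: (p *: hom a2) + z *: (r *: hom a5)) ->
    exists2 t, t != 0 & hom w *m invmx B = t *: row3 x y z.
  by move=> t0 e; exists t => //; rewrite e -row3_mul scalemxAl mulmxK.
have homE x y : hom (x, y) = row3 x y 1 by [].
rewrite ur in u1 *; rewrite ur' in u1' *; rewrite r'r in r1' *; rewrite qp in q1 *.
have d8 : p - r != 0.
  apply: contraNneq u1 => e; have -> : 1 + - r / p = (p - r) / p by field.
  by rewrite e mul0r.
have d9 : p + r != 0.
  apply: contraNneq u1' => e; have -> : 1 + r / p = (p + r) / p by field.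
  by rewrite e mul0r.
case=> [|[|[|[|[|[|[|[|[|i]]]]]]]]] //= _.
- by apply: (inv 1); rewrite ?oner_eq0 // /hom !(row3_scale, row3_add); congr (row3 _ _ _); ring.
- by apply: (inv p^-1); rewrite ?invr_eq0 // /hom !(row3_scale, row3_add); congr (row3 _ _ _); field.
- by apply: (inv (1 + p)^-1); rewrite ?invr_eq0 // homE /hom !(row3_scale, row3_add); congr (row3 _ _ _); field.
- by apply: (inv (1 + - p)^-1); rewrite ?invr_eq0 // homE /hom !(row3_scale, row3_add); congr (row3 _ _ _); field.
- by apply: (inv r^-1); rewrite ?invr_eq0 // /hom !(row3_scale, row3_add); congr (row3 _ _ _); field.
- by apply: (inv (1 + r)^-1); rewrite ?invr_eq0 // homE /hom !(row3_scale, row3_add); congr (row3 _ _ _); field.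
- by apply: (inv (- (1 + - r)^-1)); rewrite ?oppr_eq0 ?invr_eq0 // homE /hom !(row3_scale, row3_add); congr (row3 _ _ _); field.
- apply: (inv (- (p - r)^-1)); rewrite ?oppr_eq0 ?invr_eq0 // homE /hom !(row3_scale, row3_add).
  by congr (row3 _ _ _); field; rewrite ?p0 ?d8 ?u1.
- apply: (inv (p + r)^-1); rewrite ?oppr_eq0 ?invr_eq0 // homE /hom !(row3_scale, row3_add).
  by congr (row3 _ _ _); field; rewrite ?p0 ?d9 ?u1'.
Qed.
End Frame.

(** * Fat point ideals and affine charts *)

Section Mpoly.
Variables (K : fieldType) (char0 : [pchar K] =i pred0).
Implicit Types (f : {mpoly K[3]}) (v w : 'I_3 -> K).

Lemma big_ord3 (T : Type) (idx : T) (op : Monoid.law idx) (F : 'I_3 -> T) :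
  \big[op/idx]_(i < 3) F i = op (F 0) (op (F 1) (F (inord 2))).
Proof.
rewrite !big_ord_recl big_ord0 Monoid.mulm1.
have -> : lift ord0 (ord0 : 'I_2) = 1 :> 'I_3 by apply: val_inj.
have -> // : lift ord0 (lift ord0 ord0) = inord 2 :> 'I_3.
by apply: val_inj; rewrite /= inordK.
Qed.

(* The substitution [x_i := t ^ B ^ i] separates the monomials with exponents less than [B]. *)
Lemma mpoly_nonroot f : f != 0 -> exists v, f.@[v] != 0.
Proof.
move=> f0; pose B := (msize f).+1.
pose e (m : 'X_{1..3}) := (m 0%R + B * (m 1%R + B * m (inord 2)))%N.
have e_inj m m' : m \in msupp f -> m' \in msupp f -> e m = e m' -> m = m'.
  have small (u : 'X_{1..3}) i : u \in msupp f -> (u i < B)%N.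
    move=> uf; apply: leq_trans (leqW (msize_mdeg_lt uf)); rewrite ltnS.
    by rewrite mdegE (bigD1 i) //= leq_addr.
  move=> mf m'f; rewrite /e => E.
  have modE (a b : nat) : (a < B)%N -> ((a + B * b) %% B = a)%N.
    by move=> aB; rewrite addnC mulnC modnMDl modn_small.
  have divE (a b : nat) : (a < B)%N -> ((a + B * b) %/ B = b)%N.
    by move=> aB; rewrite addnC mulnC divnMDl // divn_small // addn0.
  have E0 : m 0 = m' 0 by rewrite -(modE _ (m 1%R + B * m (inord 2))%N (small m 0 mf)) E modE // small.
  have E' : (m 1%R + B * m (inord 2) = m' 1%R + B * m' (inord 2))%N.
    by rewrite -(divE _ (m 1%R + B * m (inord 2))%N (small m 0 mf)) E divE // small.
  have E1 : m 1 = m' 1 by rewrite -(modE _ (m (inord 2)) (small m 1 mf)) E' modE // small.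
  have E2 : m (inord 2) = m' (inord 2) by rewrite -(divE _ (m (inord 2)) (small m 1 mf)) E' divE // small.
  apply/mnmP => i; case: i => [[|[|[|]]] //= h].
  - by rewrite (_ : Ordinal h = 0) //; apply: val_inj.
  - by rewrite (_ : Ordinal h = 1) //; apply: val_inj.
  - by rewrite (_ : Ordinal h = inord 2) //; apply: val_inj; rewrite /= inordK.
pose F := \sum_(m <- msupp f) f@_m *: 'X^(e m) : {poly K}.
have FE t : F.[t] = f.@[fun i => t ^+ (B ^ i)].
  rewrite mevalE horner_sum; apply: eq_bigr => m _; rewrite hornerZ hornerXn; congr (_ * _).
  rewrite big_ord3 /= -!exprM -!exprD /e; congr (_ ^+ _).
  by rewrite inordK // expn0 mul1n expn1 expnS expn1 mulnDr mulnA.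
have F0 : F != 0.
  have [m mf] : exists m, m \in msupp f.
    by move: f0; rewrite -msupp_eq0; case: (msupp f) => // m s _; exists m; apply: mem_head.
  apply/eqP => /polyP/(_ (e m)); rewrite coef0 coef_sum (bigD1_seq m) ?msupp_uniq //=.
  rewrite coefZ coefXn eqxx mulr1 big_seq_cond big1 ?addr0 => [/eqP|m' /andP[m'f mm']].
    by rewrite mcoeff_eq0 mf.
  rewrite coefZ coefXn; case: eqP => [E|_]; last by rewrite mulr0.
  by rewrite (e_inj _ _ mf m'f E) eqxx in mm'.
by have [t] := poly_nonroot char0 F0; rewrite FE; exists (fun i => t ^+ (B ^ i)).
Qed.

Lemma meval_scale d f t v : f \is d.-homog -> f.@[fun i => t * v i] = t ^+ d * f.@[v].
Proof.
move=> /dhomogP hf; rewrite !mevalE mulr_sumr [LHS]big_seq [RHS]big_seq.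
apply: eq_bigr => m mf; rewrite mulrCA; congr (_ * _).
rewrite -(hf m mf) /= mdegE expr_sum -big_split; apply: eq_bigr => i _.
by rewrite exprMn.
Qed.

Lemma rmorph_mmap (A B : comNzRingType) (g : {rmorphism A -> B}) (f : K -> A) h (p : {mpoly K[3]}) :
  g (mmap f h p) = mmap (g \o f) (g \o h) p.
Proof.
rewrite /mmap rmorph_sum; apply: eq_bigr => m _; rewrite rmorphM; congr (_ * _).
by rewrite /mmap1 rmorph_prod; apply: eq_bigr => i _; rewrite rmorphXn.
Qed.

End Mpoly.

Section Ideals.
Variables (K : fieldType).
Implicit Types (f g : {mpoly K[3]}) (P : P2 K).

Lemma point_ideal_dvd (B : comNzRingType) (Psi : {rmorphism {mpoly K[3]} -> B}) (x : B) P :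
    (forall f, homogeneous f -> vanishes_at f P -> exists y : B, Psi f = x * y) ->
  forall f, point_ideal P f -> exists y : B, Psi f = x * y.
Proof.
move=> hx f; elim=> {f} [f [hf vf]||f g _ [u hu] _ [v hv]|h f _ [u hu]].
- exact: hx.
- by exists 0; rewrite rmorph0 mulr0.
- by exists (u + v); rewrite rmorphD hu hv mulrDr.
- by exists (Psi h * u); rewrite rmorphM hu mulrCA.
Qed.

(** The device for reading off multiplicities: it is used with evaluation at a vector of [P] and
    [x = 0], and with the expansion along the lines through [P] and [x = 'X]. *)
Lemma ideal_exp_dvd (B : comNzRingType) (Psi : {rmorphism {mpoly K[3]} -> B}) (x : B) P m f :
    (forall f, homogeneous f -> vanishes_at f P -> exists y : B, Psi f = x * y) ->
  ideal_exp (point_ideal P) m f -> exists y : B, Psi f = x ^+ m * y.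
Proof.
move=> hx; elim: m f => [|m IH] f; first by exists (Psi f); rewrite expr0 mul1r.
rewrite /ideal_exp /=; elim=> {f} [f [u [v [hu hv ->]]]||f g _ [u hu] _ [v hv]|h f _ [u hu]].
- have [u' eu] := point_ideal_dvd hx hu; have [v' ev] := IH _ hv.
  by exists (u' * v'); rewrite rmorphM eu ev exprS; ring.
- by exists 0; rewrite rmorph0 mulr0.
- by exists (u + v); rewrite rmorphD hu hv mulrDr.
- by exists (Psi h * u); rewrite rmorphM hu mulrCA.
Qed.

Lemma ideal_exp_vanishes P m f : ideal_exp (point_ideal P) m.+1 f -> vanishes_at f P.
Proof.
move=> hf v vP; have [|y] := @ideal_exp_dvd _ (meval (v 0)) 0 P m.+1 f _ hf.
  by move=> g _ /(_ v vP) e; exists 0; rewrite mul0r.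
by rewrite expr0n mul0r.
Qed.

Lemma ideal_exp1 P f : homogeneous f -> vanishes_at f P -> ideal_exp (point_ideal P) 1 f.
Proof.
move=> hf vf; apply: ideal_gen_incl; exists f, 1; rewrite mulr1; split => //.
exact: ideal_gen_incl.
Qed.

Lemma ideal_expM P m f g : point_ideal P f -> ideal_exp (point_ideal P) m g ->
  ideal_exp (point_ideal P) m.+1 (f * g).
Proof. by move=> hf hg; apply: ideal_gen_incl; exists f, g. Qed.

Definition rep P : 'rV[K]_3 := vpick (line_of P).

Lemma rep_neq0 P : rep P != 0.
Proof. by rewrite vpick0 -dimv_eq0; case: P => U /= /eqP ->. Qed.

Lemma line_of_rep P : line_of P = <[rep P]>%VS.
Proof.
apply/eqP; rewrite eq_sym eqEdim dim_vline rep_neq0 -memvE memv_pick.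
by case: P => U /= /eqP ->.
Qed.

Lemma P2_inj P Q : line_of P = line_of Q -> P = Q.
Proof. by move=> e; apply: val_inj. Qed.

Lemma vanishes_at_line f P d v : f \is d.-homog -> line_of P = <[v]>%VS ->
  f.@[v 0] = 0 -> vanishes_at f P.
Proof.
move=> hf e fv w; rewrite e => /vlineP[t ->].
rewrite (@meval_eq _ _ _ (fun i => t * v 0 i)); last by move=> i; rewrite mxE.
by rewrite (meval_scale _ _ hf) fv mulr0.
Qed.

End Ideals.

Section Pencil.
Variables (K : fieldType) (char0 : [pchar K] =i pred0) (b1 b2 b3 : 'rV[K]_3).
Implicit Types (f : {mpoly K[3]}) (a : K * K).

Definition vec a : 'rV[K]_3 := a.1 *: b1 + a.2 *: b2 + b3.

(* The point at position ['X] on the line through [(p, q)] whose slope is the inner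
   variable. *)
Definition pencil p q (i : 'I_3) : {poly {poly K}} :=
  (vec (p, q) 0 i)%:P%:P + ((b1 0 i)%:P + (b2 0 i) *: 'X)%:P * 'X.

Definition expansion p q : {mpoly K[3]} -> {poly {poly K}} := mmap (polyC \o polyC) (pencil p q).
HB.instance Definition _ p q := GRing.RMorphism.copy (expansion p q)
  (mmap (polyC \o polyC) (pencil p q)).

Lemma mmap_ext (A : nzRingType) (g g' : K -> A) h h' (f : {mpoly K[3]}) :
  g =1 g' -> h =1 h' -> mmap g h f = mmap g' h' f.
Proof.
move=> gg hh; apply: eq_bigr => m _; rewrite gg; congr (_ * _).
exact: mmap1_eq.
Qed.

Lemma expansion_horner p q f (x m : K) : (expansion p q f).[x%:P].[m] =
  f.@[fun i => vec (p, q) 0 i + (b1 0 i + b2 0 i * m) * x].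
Proof.
rewrite -[LHS]/((horner_eval m \o horner_eval x%:P) (expansion p q f)).
rewrite /expansion rmorph_mmap; apply: mmap_ext => [c|i] /=.
  by rewrite /horner_eval !hornerC.
by rewrite /horner_eval !hornerE.
Qed.

Lemma expansion_vec p q f a : a.1 - p != 0 ->
  (expansion p q f).[(a.1 - p)%:P].[slope (p, q) a] = f.@[vec a 0].
Proof.
move=> x0; rewrite expansion_horner; apply: meval_eq => i; rewrite /vec !mxE /slope /=.
by field.
Qed.

(** The slope enters the pencil only through the product with the position, so its degree is bounded
    by the power of the position. This is the origin of the sizes 4 and 5 of [c] and [c']. *)
Definition graded d (phi : {poly {poly K}}) :=
  (size phi <= d.+1)%N /\ forall j, (size (phi`_j)%R <= j.+1)%N.

Lemma graded1 : graded 0 1.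
Proof.
by split=> [|j]; rewrite ?size_poly1 // coef1; case: j => [|j] /=; rewrite ?size_poly1 ?size_poly0.
Qed.

Lemma gradedM d e phi psi : graded d phi -> graded e psi -> graded (d + e) (phi * psi).
Proof.
move=> [s1 c1] [s2 c2]; split.
  apply: leq_trans (size_polyMleq _ _) _; rewrite -subn1 leq_subLR.
  by apply: leq_trans (leq_add s1 s2) _; rewrite addSn addnS add1n.
move=> j; rewrite coefM; apply: leq_trans (size_sum _ _ _) _.
apply/bigmax_leqP => i _; apply: leq_trans (size_polyMleq _ _) _; rewrite -subn1 leq_subLR.
apply: leq_trans (leq_add (c1 _) (c2 _)) _; have := ltn_ord i; lia.
Qed.

Lemma gradedX d k phi : graded d phi -> graded (d * k) (phi ^+ k).
Proof.
move=> h; elim: k => [|k IH]; first by rewrite muln0 expr0; apply: graded1.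
by rewrite mulnS exprS; apply: gradedM.
Qed.

Lemma graded_pencil p q i : graded 1 (pencil p q i).
Proof.
split.
  apply: leq_trans (size_polyD _ _) _; rewrite geq_max (leq_trans (size_polyC_leq1 _)) //=.
  by apply: leq_trans (size_polyMleq _ _) _; rewrite size_polyX addn2 /= ltnS size_polyC_leq1.
move=> j; rewrite coefD coefC coefCM coefX.
case: j => [|[|j]] /=; rewrite ?mulr0 ?mulr1 ?addr0 ?add0r ?size_poly0 ?size_polyC_leq1 //.
apply: leq_trans (size_polyD _ _) _; rewrite geq_max (leq_trans (size_polyC_leq1 _)) //=.
by apply: leq_trans (size_scale_leq _ _) _; rewrite size_polyX.
Qed.

Lemma graded_expansion p q f d : f \is d.-homog -> graded d (expansion p q f).
Proof.
move=> /dhomogP hf.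
have gm m : m \in msupp f -> graded d ((f@_m)%:P%:P * mmap1 (pencil p q) m).
  move=> mf; rewrite -[d]add0n; apply: gradedM.
    split; first exact: size_polyC_leq1.
    move=> j; rewrite coefC; case: j => [|j] /=; rewrite ?size_poly0 //.
    exact: size_polyC_leq1.
  rewrite -(hf m mf) /= mdegE /mmap1.
  apply: (big_ind2 (fun n phi => graded n phi)); first exact: graded1.
    by move=> ? ? ? ? ? ?; apply: gradedM.
  by move=> i _; rewrite -[X in graded X]mul1n; apply/gradedX/graded_pencil.
rewrite /expansion /mmap big_seq; apply: (big_ind (graded d)) => //.
  by split=> [|j]; rewrite ?coef0 size_poly0.
move=> phi psi [s1 c1] [s2 c2]; split.
  by apply: leq_trans (size_polyD _ _) _; rewrite geq_max s1.
by move=> j; rewrite coefD; apply: leq_trans (size_polyD _ _) _; rewrite geq_max c1 c2.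
Qed.

Lemma pencil_dvd p q P f : line_of P = <[vec (p, q)]>%VS -> homogeneous f -> vanishes_at f P ->
  exists g, expansion p q f = 'X * g.
Proof.
move=> eP _ fP; exists (drop_poly 1 (expansion p q f)).
have e0 : (expansion p q f).[0] = 0.
  rewrite -[LHS]/(horner_eval 0 (expansion p q f)) /expansion rmorph_mmap.
  rewrite (@mmap_ext _ _ (polyC \o idfun) _ (polyC \o (vec (p, q) 0))).
  - by rewrite -(rmorph_mmap (polyC) idfun) -/(meval _ _) fP ?polyC0 // eP memv_line.
  - by move=> c; rewrite /= /horner_eval hornerC.
  - by move=> i; rewrite /= /horner_eval /pencil !hornerE.
apply/polyP => -[|i]; first by rewrite coefXM -horner_coef0.
by rewrite coefXM /= coef_drop_poly addn1.
Qed.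

Definition affine_part f : {poly {poly K}} :=
  mmap (polyC \o polyC) (fun i => (b1 0 i *: 'X + (b3 0 i)%:P)%:P + (b2 0 i)%:P%:P * 'X) f.

Lemma ev_affine_part p q f : ev p q (affine_part f) = f.@[vec (p, q) 0].
Proof.
rewrite -[LHS]/((horner_eval p \o horner_eval q%:P) (affine_part f)).
rewrite /affine_part rmorph_mmap; apply: mmap_ext => [c|i] /=.
  by rewrite /horner_eval !hornerC.
by rewrite /horner_eval /vec !hornerE !mxE /=; ring.
Qed.

Hypothesis uB : mx3 b1 b2 b3 \in unitmx.

Lemma vec_neq0 a : vec a != 0.
Proof.
apply/negP => /eqP e; have : row3 a.1 a.2 1 *m mx3 b1 b2 b3 = 0.
  by rewrite row3_mul scale1r.
move=> /(congr1 (fun M => M *m invmx (mx3 b1 b2 b3))); rewrite mulmxK // mul0mx => /eqP.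
by rewrite row3_eq0 oner_eq0 !andbF.
Qed.

Lemma vec_coords (v : 'rV[K]_3) (w := v *m invmx (mx3 b1 b2 b3)) : w 0 (inord 2) != 0 ->
  v = w 0 (inord 2) *: vec (w 0 0 / w 0 (inord 2), w 0 1 / w 0 (inord 2)).
Proof.
move=> w0; rewrite -[v in LHS](mulmxKV uB) -/w {1}(row3E w) row3_mul /vec /=.
by rewrite !scalerDr !scalerA ![_ * (_ / _)]mulrC !divfK.
Qed.

(** The form [l] cuts out the line at infinity of the chart; a point where [f * l] does not vanish
    lies in the chart and off the curve. *)
Lemma affine_part_neq0 f d : f \is d.-homog -> f != 0 -> affine_part f != 0.
Proof.
move=> hf f0; apply/eqP => af0.
pose l : {mpoly K[3]} := \sum_i (invmx (mx3 b1 b2 b3)) i (inord 2) *: 'X_i.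
have lE (v : 'rV[K]_3) : l.@[v 0] = (v *m invmx (mx3 b1 b2 b3)) 0 (inord 2).
  rewrite mxE raddf_sum /=; apply: eq_bigr => i _.
  by rewrite mevalZ mevalXU mulrC.
have l0 : l != 0.
  apply/eqP => l0; have := lE b3; rewrite l0 meval0.
  have {1}-> : b3 = row3 0 0 1 *m mx3 b1 b2 b3 by rewrite row3_mul !scale0r scale1r !add0r.
  by rewrite mulmxK // mxE inordK //= => /esym/eqP; rewrite oner_eq0.
have [v] := mpoly_nonroot char0 (mulf_neq0 f0 l0).
pose w : 'rV[K]_3 := \row_i v i; have vw : v =1 w 0 by move=> i; rewrite mxE.
rewrite (meval_eq _ vw) mevalM mulf_eq0 negb_or lE => /andP[fw lw].
case/negP: fw; rewrite {1}(vec_coords lw).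
set t := (_ 0 (inord 2)); set a := (_, _).
rewrite (@meval_eq _ _ _ (fun i => t * vec a 0 i)); last by move=> i; rewrite mxE.
by rewrite (meval_scale _ _ hf) -ev_affine_part af0 rmorph0 mulr0.
Qed.

(** The pair consists of the coefficients of ['X ^ 3] and ['X ^ 4] in the expansion at [P]: the
    triple point removes the lower ones, the degree the higher ones. If both were zero, [f] would
    vanish on the chart off a vertical line. *)
Lemma quartic_generic_pair f P p q (S : seq (K * K)) : f \is 4.-homog -> f != 0 ->
    line_of P = <[vec (p, q)]>%VS -> ideal_exp (point_ideal P) 3 f ->
    (forall z, z \in S -> z.1 - p != 0) -> (forall z, z \in S -> f.@[vec z 0] = 0) ->
  exists c c' : {poly K}, [/\ (c != 0) || (c' != 0), (size c <= 4)%N, (size c' <= 5)%N &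
    forall z, z \in S -> c.[slope (p, q) z] + (z.1 - p) * c'.[slope (p, q) z] = 0].
Proof.
move=> hf f0 eP If hS fS; have [sF cF] := graded_expansion p q hf.
have [g eg] := ideal_exp_dvd (Psi := expansion p q) (x := 'X) (fun h => @pencil_dvd p q P h eP) If.
have eF : expansion p q f = 'X^3 * (((expansion p q f)`_3)%:P + ((expansion p q f)`_4)%:P * 'X).
  apply/polyP => j; rewrite coefXnM; case: ltnP => j3; first by rewrite eg coefXnM j3.
  rewrite coefD coefC coefCM coefX; case: j j3 => [|[|[|[|[|j]]]]] //= _.
  - by rewrite mulr0 addr0.
  - by rewrite mulr1 add0r.
  by rewrite mulr0 addr0 nth_default // (leq_trans sF).
move: eF (cF 3%N) (cF 4%N); move: (_`_3) (_`_4) => c c' eF sc sc'.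
exists c, c'; split => //; last first.
  move=> z zS; have x0 := hS z zS; have := expansion_vec q f x0.
  rewrite fS // eF !(hornerM, hornerD, hornerC, hornerXn, hornerX) ?horner_exp ?hornerC => /eqP.
  by rewrite !mulf_eq0 (negPf x0) /= mulrC => /eqP.
rewrite -negb_and; apply/negP => /andP[/eqP c0 /eqP c'0].
have F0 : expansion p q f = 0 by rewrite eF c0 c'0 !polyC0 mul0r addr0 mulr0.
case/eqP: (affine_part_neq0 hf f0); apply: generic_eq0 => //.
apply: generic_mono (generic_affine (a := 1) (b := 0) (- p) _) => [x y|]; last by rewrite oner_eq0.
rewrite mul1r mul0r addr0 => xp.
by rewrite ev_affine_part -(@expansion_vec p q f (x, y)) // F0 !horner0.
Qed.

End Pencil.

(** * Choice of the chart *)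

Section Coordinates.
Variables (K : fieldType) (char0 : [pchar K] =i pred0).

Lemma polys_avoid (ps : seq {poly K}) (s : seq K) : all (fun f => f != 0) ps ->
  exists t, (forall f, f \in ps -> f.[t] != 0) /\ t \notin s.
Proof.
move=> nz; have p0 : \prod_(f <- ps) f != 0 by rewrite prodf_seq_neq0; apply: sub_all nz => f ->.
have [t [pt ts]] := poly_avoid char0 s p0; exists t; split => // f fps.
move: pt; rewrite horner_prod prodf_seq_neq0 => /allP/(_ f fps).
by rewrite implyTb.
Qed.

Lemma mx3_rows (M : 'M[K]_3) : mx3 (row 0 M) (row 1 M) (row (inord 2) M) = M.
Proof.
apply/matrixP => i j; rewrite !mxE; case: i => [[|[|[|]]] //= h]; congr (M _ _); apply: val_inj => //=.
by rewrite inordK.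
Qed.

Lemma line_scale (t : K) (v : 'rV[K]_3) : t != 0 -> <[t *: v]>%VS = <[v]>%VS.
Proof.
move=> t0; apply/vspaceP => w; apply/vlineP/vlineP => -[s ->].
  by exists (s * t); rewrite scalerA.
by exists (s / t); rewrite scalerA divfK.
Qed.

(* The functionals [v |-> v 0 0 + v 0 1 * t + v 0 2 * t ^+ 2] do not vanish at a given
   vector for all but finitely many [t], and three of them are independent (Vandermonde). *)
Lemma affine_coordinates (Z : {fset P2 K}) : exists (b1 b2 b3 : 'rV[K]_3) (aff : P2 K -> K * K),
  [/\ mx3 b1 b2 b3 \in unitmx, forall P, P \in Z -> line_of P = <[vec b1 b2 b3 (aff P)]>%VS &
    uniq [seq (aff P).1 | P <- Z]].
Proof.
have [|t3 [ht3 _]] := @polys_avoid [seq rVpoly (rep P) | P <- Z] [::].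
  by rewrite all_map; apply/allP => P _ /=; rewrite rVpoly_eq0 rep_neq0.
pose la (v : 'rV[K]_3) := (rVpoly v).[t3].
(* A functional vanishes at [w P Q] exactly when its quotients by [la] agree at [P] and [Q].
   Avoiding these vectors with [t1] therefore separates the first coordinates. *)
pose w P Q := la (rep Q) *: rep P - la (rep P) *: rep Q.
have la0 P : P \in Z -> la (rep P) != 0.
  by move=> PZ; apply: ht3; apply: map_f.
have w0 P Q : P \in Z -> Q \in Z -> P != Q -> w P Q != 0.
  move=> PZ QZ; apply: contraNneq => /eqP; rewrite subr_eq0 => /eqP e; apply/eqP/P2_inj.
  rewrite line_of_rep line_of_rep -(line_scale _ (la0 Q QZ)) e line_scale //; exact: la0.
have [|t1 [ht1 t13]] := @polys_avoid [seq rVpoly (w x.1 x.2) |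
    x <- [seq (P, Q) | P <- Z, Q <- Z] & x.1 != x.2] [:: t3].
  rewrite all_map; apply/allP => -[P Q]; rewrite mem_filter => /andP[/= PQ].
  move=> /allpairsP[[P' Q'] /= [PZ QZ [eP eQ]]]; rewrite rVpoly_eq0.
  by rewrite eP eQ in PQ *; apply: w0.
have [|t2 [_ t2n]] := @polys_avoid [::] [:: t1; t3] => //.
pose tt (j : 'I_3) := [:: t1; t2; t3]`_j.
pose G : 'M[K]_3 := \matrix_(i, j) tt j ^+ i.
have GE v j : (v *m G) 0 j = (rVpoly v).[tt j].
  rewrite horner_poly mxE; apply: eq_bigr => i _; rewrite mxE; congr (_ * _).
  by rewrite insubT // => lti; congr (v 0 _); apply: val_inj.
have uG : G \in unitmx.
  rewrite -row_free_unit; apply: inj_row_free => v vG; apply/eqP; rewrite -rVpoly_eq0; apply/eqP.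
  apply: (@poly_roots0 _ _ [:: t1; t2; t3]); last exact: size_poly.
    move: t13 t2n; rewrite /= !inE !negb_or => t13 /andP[t21 t23].
    by rewrite eq_sym t21 t13 t23.
  have r j : root (rVpoly v) (tt j) by rewrite /root -GE vG mxE.
  by rewrite /= (r 0) (r 1) -[t3]/[:: t1; t2; t3]`_2 -{2}(@inordK 2 2) // (r (inord 2)).
exists (row 0 (invmx G)), (row 1 (invmx G)), (row (inord 2) (invmx G)).
pose aff P := ((rep P *m G) 0 0 / (rep P *m G) 0 (inord 2), (rep P *m G) 0 1 / (rep P *m G) 0 (inord 2)).
have laE v : (v *m G) 0 (inord 2) = la v by rewrite GE /tt inordK.
exists aff; split; first by rewrite mx3_rows unitmx_inv.
  move=> P PZ; have uB : mx3 (row 0 (invmx G)) (row 1 (invmx G)) (row (inord 2) (invmx G)) \in unitmx.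
    by rewrite mx3_rows unitmx_inv.
  have := @vec_coords K _ _ _ uB (rep P); cbv zeta; rewrite mx3_rows invmxK laE => /(_ (la0 P PZ)) e.
  by rewrite line_of_rep {1}e line_scale ?la0 // -laE.
rewrite map_inj_in_uniq ?fset_uniq // => P Q PZ QZ /eqP; rewrite /aff /= !laE !GE eqr_div ?la0 //.
rewrite /tt /= => e; apply/eqP/negP => /negP PQ.
have /ht1 : rVpoly (w P Q) \in [seq rVpoly (w x.1 x.2) |
    x <- [seq (P, Q) | P <- Z, Q <- Z] & x.1 != x.2].
  apply/mapP; exists (P, Q) => //; rewrite mem_filter /= PQ; apply/allpairsP.
  by exists (P, Q).
rewrite /w linearB !linearZ /= hornerD !hornerZ hornerN mulrN subr_eq0 => /negP; apply.
by rewrite mulrC (eqP e) mulrC.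
Qed.

End Coordinates.

(** * Dimension counts for quartics *)

Section Dimension.
Variable (K : fieldType).
Local Notation V := (dhomog 3 K 4).

Definition evals (ws : seq 'rV[K]_3) (F : V) : 'rV[K]_(size ws) :=
  \row_i (mpoly_of_dhomog F).@[ws`_i 0].

Fact evals_linear ws : linear (evals ws).
Proof.
move=> a F G; apply/rowP => i; rewrite !mxE.
by rewrite -[mpoly_of_dhomog (_ + _)]/(a *: mpoly_of_dhomog F + mpoly_of_dhomog G) mevalD mevalZ.
Qed.
HB.instance Definition _ ws := GRing.isLinear.Build K V 'rV[K]_(size ws) _ (evals ws) (evals_linear ws).

Lemma dim_quartics : \dim {:V} = 15%N.
Proof. by rewrite dimvf. Qed.

Lemma dim_evals_ker (U : {vspace V}) ws :
  (\dim U <= \dim (U :&: lker (linfun (evals ws))) + size ws)%N.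
Proof.
rewrite -(limg_ker_dim (linfun (evals ws)) U) leq_add2l.
by apply: leq_trans (dimvS (subvf _)) _; rewrite dimvf /dim /= mul1n.
Qed.

Lemma evals_kerP (ws : seq 'rV[K]_3) (F : V) : reflect (forall w, w \in ws -> (mpoly_of_dhomog F).@[w 0] = 0)
  (F \in lker (linfun (evals ws))).
Proof.
rewrite memv_ker lfunE; apply: (iffP eqP) => /= [e w /(nthP 0)[i iw <-]|h].
  by have := congr1 (fun r : 'rV_ _ => r 0 (Ordinal iw)) e; rewrite !mxE.
by apply/rowP => i; rewrite !mxE h // mem_nth.
Qed.

(** If [ws] imposes all the conditions of [Z], the quartics through [Z] have dimension at least
    [15 - size ws]. Unexpectedness then makes the dimension with the triple point larger than
    [9 - size ws], so [ad] can be imposed in addition. *)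
Lemma unexpected_extension (Z : {fset P2 K}) (ws ad : seq 'rV[K]_3) P :
    (forall F : V, (forall w, w \in ws -> (mpoly_of_dhomog F).@[w 0] = 0) ->
       F \in fat_ideal_deg (seq_mset Z) 4) ->
    (size ad <= 9 - size ws)%N ->
    Num.max ((\dim (fat_ideal_deg (seq_mset Z) 4))%:Z - 'C(4, 2)%:Z) 0
      < (\dim (fat_ideal_deg (seq_mset Z `+` msetn 3 P)%mset 4))%:Z ->
  exists F : V, [/\ F != 0, F \in fat_ideal_deg (seq_mset Z `+` msetn 3 P)%mset 4 &
    forall w, w \in ad -> (mpoly_of_dhomog F).@[w 0] = 0].
Proof.
move=> hws sad; rewrite Order.TotalTheory.gt_max => /andP[lt1 lt2].
set U := fat_ideal_deg (_ `+` _)%mset 4 in lt1 lt2 *; set W := fat_ideal_deg _ 4 in lt1.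
have dW : (15 <= \dim W + size ws)%N.
  rewrite -dim_quartics; apply: leq_trans (dim_evals_ker fullv ws) _; rewrite leq_add2r.
  by apply/dimvS/subvP => F; rewrite capfv => /evals_kerP/hws.
have dU : (size ad < \dim U)%N by move: lt1 lt2; rewrite (_ : 'C(4, 2) = 6) //; lia.
have dk := dim_evals_ker U ad.
have k0 : (U :&: lker (linfun (evals ad)))%VS != 0%VS by rewrite -dimv_eq0; lia.
exists (vpick (U :&: lker (linfun (evals ad)))); have := memv_pick (U :&: lker (linfun (evals ad)))%VS.
rewrite memv_cap => /andP[FU /evals_kerP Fad]; split => //.
by rewrite vpick0.
Qed.

End Dimension.

Section Fset9.
Local Open Scope fset_scope.

Lemma fset9P (T : choiceType) (a1 a2 a3 a4 a5 a6 a7 a8 a9 x : T) :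
  reflect (exists2 i, (i < 9)%N & x = nth a1 [:: a1; a2; a3; a4; a5; a6; a7; a8; a9] i)
    (x \in [fset a1; a2; a3; a4; a5; a6; a7; a8; a9]).
Proof.
have -> : (x \in [fset a1; a2; a3; a4; a5; a6; a7; a8; a9])
    = (x \in [:: a1; a2; a3; a4; a5; a6; a7; a8; a9]) by rewrite !inE -!orbA.
by apply: (iffP (nthP a1)) => -[i i9 e]; exists i.
Qed.

End Fset9.

Section Weaken.
Variables (K : fieldType).
Implicit Types (P : P2 K) (f g h : {mpoly K[3]}).

Lemma ideal_expDM P m f g h : ideal_exp (point_ideal P) m f ->
  ideal_exp (point_ideal P) m g -> ideal_exp (point_ideal P) m (h * f + g).
Proof. by case: m => [//|m] If Ig; apply: ideal_genD => //; apply: ideal_genM. Qed.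

Lemma ideal_exp0 P m : ideal_exp (point_ideal P) m 0.
Proof. by case: m => [//|m]; apply: ideal_gen0. Qed.

(** At [P] the scheme has multiplicity 3 plus that of [P] in [Z]; this inclusion of powers makes it
    irrelevant whether [P] belongs to [Z]. *)
Lemma ideal_exp_weaken P m n f :
  ideal_exp (point_ideal P) (n + m) f -> ideal_exp (point_ideal P) m f.
Proof.
elim: n f => // n IH f hf; apply: IH; move: hf; rewrite addSn.
elim=> {f} [f [u [v [_ hv ->]]]||f g _ hf _ hg|h f _ hf].
- by rewrite -[u * v]addr0; apply: ideal_expDM => //; apply: ideal_exp0.
- exact: ideal_exp0.
- by rewrite -[f]mul1r; apply: ideal_expDM.
- by rewrite -[h * f]addr0; apply: ideal_expDM => //; apply: ideal_exp0.
Qed.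

Lemma P2_of_vector (v : 'rV[K]_3) : v != 0 -> exists P : P2 K, line_of P = <[v]>%VS.
Proof.
by move=> v0; have d : \dim <[v]> == 1%N by [rewrite dim_vline v0]; exists (Point2 d).
Qed.

Lemma nonempty_open_neq0 (A : P2 K -> Prop) : zariski_open A -> (exists P, A P) ->
  exists f, [/\ f != 0, homogeneous f & forall P, ~ vanishes_at f P -> A P].
Proof.
move=> [T Thom hT] [P AP].
have [f [Tf nf]] : exists f, T f /\ ~ vanishes_at f P.
  apply: contrapT => h; have := (hT P).2; apply => // f Tf.
  by apply: contrapT => nf; apply: h; exists f.
exists f; split; [|exact: Thom|].
  by apply: contra_notN nf => /eqP-> v _; rewrite meval0.
by move=> Q nQ; apply: contrapT => /(hT Q).1 /(_ f Tf).
Qed.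

Lemma dhomog_vanishes_fat_ideal (Z : {fset P2 K}) d (F : dhomog 3 K d) :
  (forall P, P \in Z -> (mpoly_of_dhomog F).@[rep P 0] = 0) ->
  F \in fat_ideal_deg (seq_mset Z) d.
Proof.
move=> h; apply/fat_ideal_degP => P; rewrite mset_seqE count_uniq_mem ?fset_uniq //.
have [PZ|//] := boolP (P \in enum_fset Z).
apply: ideal_exp1; first by exists d; exact: dhomog_is_dhomog.
exact: vanishes_at_line (dhomog_is_dhomog F) (line_of_rep P) (h P PZ).
Qed.

End Weaken.

(** * From an unexpected quartic to the configuration *)

Section Forward.
Variables (K : fieldType) (char0 : [pchar K] =i pred0).
Local Notation V := (dhomog 3 K 4).

Section Chart.
Variables (Z : {fset P2 K}) (b1 b2 b3 : 'rV[K]_3) (aff : P2 K -> K * K).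
Hypothesis uB : mx3 b1 b2 b3 \in unitmx.
Hypothesis affZ : forall P, P \in Z -> line_of P = <[vec b1 b2 b3 (aff P)]>%VS.
Let S0 := [seq aff P | P <- Z].
Local Notation vec := (vec b1 b2 b3).

Lemma eval_rep_vec d (F : dhomog 3 K d) P : P \in Z ->
  (mpoly_of_dhomog F).@[vec (aff P) 0] = 0 -> (mpoly_of_dhomog F).@[rep P 0] = 0.
Proof.
move=> PZ e; apply: (vanishes_at_line (dhomog_is_dhomog F) (affZ PZ) e).
by rewrite line_of_rep memv_line.
Qed.

(** The points [Ad] are fixed before the triple point varies, so they may be treated like points of
    the configuration. Allowing [ws] to be smaller than [Z] matters when five points are
    collinear. *)
Lemma unexpected_generic_curve (ws Ad : seq (K * K)) :
    (forall F : V, (forall a, a \in ws -> (mpoly_of_dhomog F).@[vec a 0] = 0) ->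
       forall a, a \in S0 -> (mpoly_of_dhomog F).@[vec a 0] = 0) ->
    (size Ad <= 9 - size ws)%N ->
  admits_unexpected_curve Z 4 -> generic_curve 4 (Ad ++ S0).
Proof.
move=> hws sAd [A [oA exA hA]].
have [f [f0 [d fd] fA]] := nonempty_open_neq0 oA exA.
have g1 := generic_neq0 (affine_part_neq0 char0 uB fd f0).
apply: generic_mono (generic_and g1 (generic_xs (Ad ++ S0))) => p q [nz hx].
have [P eP] := P2_of_vector (vec_neq0 uB (p, q)).
have AP : A P.
  by apply: fA => /(_ (vec (p, q))); rewrite eP memv_line -ev_affine_part => /(_ isT) e; rewrite e eqxx in nz.
have [||F [F0 /fat_ideal_degP FI Fad]] := @unexpected_extension K Z (map vec ws) (map vec Ad) P _ _ (hA P AP).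
- move=> F hF; apply: dhomog_vanishes_fat_ideal => Q QZ; apply: eval_rep_vec => //.
  by apply: hws => [a aws|]; [apply/hF/map_f | apply: map_f].
- by rewrite !size_map.
apply: (quartic_generic_pair char0 uB (dhomog_is_dhomog F) _ eP) => //.
- have := FI P; rewrite msetE2 msetnxx; exact: ideal_exp_weaken.
move=> z; rewrite mem_cat => /orP[zA|/mapP[Q QZ ->]]; first by apply/Fad/map_f.
have := FI Q; rewrite msetE2 mset_seqE count_uniq_mem ?fset_uniq // [Q \in _]QZ add1n.
move/ideal_exp_vanishes; apply; rewrite affZ //; exact: memv_line.
Qed.

Lemma quartic_vanishes_on_line (F : V) l (T : seq (K * K)) : uniq [seq z.1 | z <- T] ->
    size T = 5 -> (forall a, a \in T -> on l a /\ (mpoly_of_dhomog F).@[vec a 0] = 0) ->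
  forall a, on l a -> (mpoly_of_dhomog F).@[vec a 0] = 0.
Proof.
move=> uT sT hT; pose g := map_poly (horner_eval l.1) (expansion b1 b2 b3 0 l.2 (mpoly_of_dhomog F)).
have gE a : on l a -> (mpoly_of_dhomog F).@[vec a 0] = g.[a.1].
  move=> /eqP al; rewrite /g -[X in _ = _.[X]](hornerC a.1 l.1) -[_.[l.1]]/(horner_eval l.1 _) horner_map /= /horner_eval.
  rewrite expansion_horner; apply: meval_eq => i; rewrite /vec /= al !mxE; ring.
suff g0 : g = 0 by move=> a al; rewrite gE // g0 horner0.
apply: (poly_roots0 uT).
  by rewrite all_map; apply/allP => a /hT[al Fa]; rewrite /= /root -gE // Fa.
rewrite size_map sT; apply: leq_trans (size_poly _ _) _.
by have [] := graded_expansion b1 b2 b3 0 l.2 (dhomog_is_dhomog F).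
Qed.

End Chart.

Definition free (S : seq (K * K)) (a : K * K) := forall b c, b \in S -> c \in S -> b != c -> ~~ collinear b c a.

Lemma free_point (S : seq (K * K)) l : uniq [seq z.1 | z <- S] -> exists a : K * K,
  [/\ uniq [seq z.1 | z <- a :: S], ~~ on l a & free S a].
Proof.
move=> uS.
have g1 : generic (fun p q => forall b, b \in S -> b.1 - p != 0) := generic_xs S.
have g2 : generic (fun p q => l.1 * p + (-1) * q + l.2 != 0).
  by apply: generic_affine; rewrite oppr_eq0 oner_eq0 orbT.
have g3 : generic (fun p q => forall bc, bc \in [seq (b, c) | b <- S, c <- S] ->
    bc.1 != bc.2 -> (bc.2.2 - bc.1.2) * p + (bc.1.1 - bc.2.1) * q
       + (bc.1.2 * (bc.2.1 - bc.1.1) - (bc.2.2 - bc.1.2) * bc.1.1) != 0).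
  apply: generic_all => -[b c] /allpairsP[[b' c'] /= [bS cS [-> ->]]].
  have [->|bc] := eqVneq b' c'; first exact: generic_true.
  apply: generic_mono (generic_affine (a := c'.2 - b'.2) (b := b'.1 - c'.1) _ _) => [p q h _|]; first exact: h.
  apply/orP; right; rewrite subr_eq0; apply: contraNneq bc => e.
  by apply/eqP/(uniq_fst_inj uS).
have [p [q [h1 [h2 h3]]]] := generic_ex char0 (generic_and g1 (generic_and g2 g3)).
exists (p, q); split.
- rewrite /= uS andbT; apply/mapP => -[b bS /= e].
  by have := h1 b bS; rewrite e subrr eqxx.
- by apply: contraNN h2 => /eqP /= ->; apply/eqP; ring.
move=> b c bS cS bc; have := h3 (b, c) _ bc; rewrite allpairs_f // => /(_ isT) /=.
apply: contraNN; rewrite /collinear /= -subr_eq0 => /eqP e; apply/eqP.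
by rewrite -[RHS]e; ring.
Qed.

Lemma on_col (l a b c : K * K) : on l a -> on l b -> on l c -> collinear a b c.
Proof. by move=> /eqP al /eqP bl /eqP cl; rewrite /collinear al bl cl; apply/eqP; ring. Qed.

Lemma free_nofive (S : seq (K * K)) a : uniq S -> nofive S -> free S a -> nofive (a :: S).
Proof.
move=> uS n5 fa l; rewrite /=; have [al|_] := boolP (on l a); last by rewrite add0n.
rewrite add1n ltnS leqNgt; apply/negP => lt.
have uF : uniq (filter (on l) S) by apply: filter_uniq.
have mF x : x \in filter (on l) S -> on l x /\ x \in S by rewrite mem_filter => /andP[].
move: lt; rewrite -size_filter; case: (filter _ _) uF mF => [|b [|c T]] //= /andP[bc _] mF _.
have [bl bS] := mF b (mem_head _ _).
have [cl cS] : on l c /\ c \in S by apply: mF; rewrite !inE eqxx orbT.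
have := fa b c bS cS; rewrite (on_col bl cl al) => h; suff : b != c by move=> /h.
by move: bc; rewrite inE negb_or => /andP[].
Qed.

(** Points are added one at a time, off all lines joining earlier ones. The last clause singles out
    the last one, which later contradicts that every point of the configuration lies on a four-point
    line. *)
Lemma free_points (S : seq (K * K)) l n : uniq [seq z.1 | z <- S] -> exists Ad : seq (K * K),
  [/\ size Ad = n, uniq [seq z.1 | z <- Ad ++ S], all (fun a => ~~ on l a) Ad,
      nofive S -> nofive (Ad ++ S) &
      (0 < n)%N -> exists a T, [/\ perm_eq (Ad ++ S) (a :: T), uniq (a :: T) & free T a]].
Proof.
move=> uS; elim: n => [|n [Ad [sAd uAd oAd nAd _]]]; first by exists [::].
have [a [ua al fa]] := free_point l uAd; exists (a :: Ad); split.
- by rewrite /= sAd.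
- exact: ua.
- by rewrite /= al.
- by move=> /nAd n5; apply: free_nofive => //; apply: map_uniq uAd.
by move=> _; exists a, (Ad ++ S); split => //; apply: map_uniq ua.
Qed.

Lemma free_not_fourline (S : seq (K * K)) a l : uniq S -> a \in S ->
  free (rem a S) a -> fourline (@collinear K) S l -> a \notin l.
Proof.
move=> uS aS fa [szl ul lS hl]; apply/negP => al.
have pl := perm_to_rem al; have sr : size (rem a l) = 3 by have := perm_size pl; rewrite szl => -[].
have ur : uniq (rem a l) by apply: rem_uniq.
have mr x : x \in rem a l -> x \in l /\ x \in rem a S.
  by rewrite mem_rem_uniq // mem_rem_uniq // !inE => /andP[-> xl]; rewrite xl lS.
case: (rem a l) sr ur mr => [|b [|c [|d []]]] //= _ /andP[bcd _] mr.
have [bl bS] := mr b (mem_head _ _).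
have [cl cS] : c \in l /\ c \in rem a S by apply: mr; rewrite !inE eqxx orbT.
have bc : b != c by move: bcd; rewrite inE negb_or => /andP[].
by have := fa b c bS cS bc; rewrite hl.
Qed.

Lemma limg_mulmxr (g : 'M[K]_3) (v : 'rV[K]_3) :
  (linfun (mulmxr g) @: <[v]>)%VS = <[v *m g]>%VS.
Proof. by rewrite limg_line lfunE. Qed.

Lemma Z0_lineP (U : {vspace 'rV[K]_3}) :
  (exists2 P, P \in Z0 K & U = line_of P) <-> exists2 i, (i < 9)%N & U = <[(Z0_rows K)`_i]>%VS.
Proof.
pose p i : P2 K := nth (pt (-1) 0 1) [:: pt (-1) 0 1; pt 0 (-1) 1; pt 1 0 1; pt 0 1 1; pt 0 0 1;
  pt 1 (-1) 0; pt 1 1 0; pt 0 1 0; pt 1 0 0] i.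
pose r i := nth (row3 (-1) 0 1) [:: row3 (-1) 0 1; row3 0 (-1) 1; row3 1 0 1; row3 0 1 1; row3 0 0 1;
  row3 1 (-1) 0; row3 1 1 0; row3 0 1 0; row3 1 0 0 : 'rV[K]_3] i.
have pr i : (i < 9)%N -> line_of (p i) = <[r i]>%VS.
  by case: i => [|[|[|[|[|[|[|[|[|i]]]]]]]]] //= _; apply: line_of_pt;
    rewrite ?oppr_eq0 oner_eq0 ?andbF.
(* The permutation from the order of [Z0_rows] to the order in which [Z0] lists its points. *)
pose s := [:: 8; 7; 6; 5; 4; 2; 0; 1; 3]%N.
have rs i : (i < 9)%N -> (Z0_rows K)`_i = r (nth 0%N s i).
  by case: i => [|[|[|[|[|[|[|[|[|i]]]]]]]]].
split=> [[P /fset9P[i i9 ->] ->]|[i i9 ->]].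
  rewrite -[nth _ _ i]/(p i) (pr i i9).
  exists (index i s); first by case: i i9 => [|[|[|[|[|[|[|[|[|i]]]]]]]]].
  by rewrite rs; case: i i9 => [|[|[|[|[|[|[|[|[|i]]]]]]]]].
have si : (nth 0%N s i < 9)%N by case: i i9 => [|[|[|[|[|[|[|[|[|i]]]]]]]]].
rewrite rs // -pr //; exists (p (nth 0%N s i)) => //.
by apply/fset9P; exists (nth 0%N s i).
Qed.

Theorem unexpected_quartic_classification (Z : {fset P2 K}) :
  admits_unexpected_curve Z 4 -> projectively_equivalent Z (Z0 K).
Proof.
move=> unexp; have [b1 [b2 [b3 [aff [uB affZ uS]]]]] := affine_coordinates char0 Z.
set S0 := [seq aff P | P <- Z]; have {}uS : uniq [seq z.1 | z <- S0] by rewrite -map_comp.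
have uS' := map_uniq uS.
have n5 : nofive S0.
  apply: contrapT => /existsNP[l /negP]; rewrite -ltnNge => lt.
  set Ls := filter (on l) S0; set Os := filter (predC (on l)) S0.
  (* A quartic through five points of [l] contains [l], so five of them suffice. The spare
     conditions allow [4 - size Os] points off [l], which makes at least four points off [l] on the
     curve, against [line_component]. *)
  pose ws := take 5 Ls ++ Os; have s5 : size (take 5 Ls) = 5 by rewrite size_takel // size_filter.
  have [Ad [sAd uAd oAd _ _]] := free_points l (4 - size Os) uS.
  have gc : generic_curve 4 (Ad ++ S0).
    apply: (@unexpected_generic_curve Z b1 b2 b3 aff uB affZ ws) => //; last first.
      by rewrite size_cat s5 sAd; lia.
    move=> F hF a aS; have [al|al] := boolP (on l a).
      apply: (@quartic_vanishes_on_line b1 b2 b3 F l (take 5 Ls)) al => //.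
        by rewrite map_take take_uniq //; apply: subseq_uniq uS; apply/map_subseq/filter_subseq.
      move=> x xl; split; last by apply: hF; rewrite mem_cat xl.
      by move/mem_take: xl; rewrite mem_filter => /andP[].
    by apply: hF; rewrite mem_cat mem_filter /= al aS orbT.
  have := line_component char0 uAd gc (l := l); rewrite !count_cat => /(_ (leq_trans lt (leq_addl _ _))).
  have -> : count (predC (on l)) Ad = size Ad by apply/eqP; rewrite -all_count.
  by rewrite sAd -size_filter -/Os; lia.
have [n8|n9] := leqP (size S0) 8.
  exfalso; have [Ad [sAd uAd _ nAd fAd]] := free_points (0, 0) (9 - size S0) uS.
  have gc : generic_curve 4 (Ad ++ S0).
    by apply: (@unexpected_generic_curve Z b1 b2 b3 aff uB affZ S0) => //; rewrite sAd.
  have [|a [T [pT uT fT]]] := fAd; first by rewrite subn_gt0.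
  have sS : size (Ad ++ S0) = 9 by rewrite size_cat sAd subnK // leqW.
  have [|s [a1 [a2 [a3 [a4 [a5 [a6 [a7 [a8 [a9 [es L1 L2 L3 _]]]]]]]]]] ps] := B3_of_quartic char0 uAd _ (nAd n5) gc.
    by rewrite sS.
  have uA := map_uniq uAd; have aS : a \in Ad ++ S0 by rewrite (perm_mem pT) mem_head.
  have fa : free (rem a (Ad ++ S0)) a.
    move=> b c; rewrite !mem_rem_uniq // !inE !(perm_mem pT) !inE.
    by move=> /andP[/= /negPf-> bT] /andP[/negPf-> cT]; apply: fT.
  have n1 := free_not_fourline uA aS fa L1; have n2 := free_not_fourline uA aS fa L2.
  have n3 := free_not_fourline uA aS fa L3.
  move: aS n1 n2 n3; rewrite -(perm_mem ps) es !inE !negb_or.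
  by do ?case/orP; move=> /eqP->; rewrite eqxx ?andbF.
have gc : generic_curve 4 S0.
  by apply: (@unexpected_generic_curve Z b1 b2 b3 aff uB affZ S0 [::]).
have [s [a1 [a2 [a3 [a4 [a5 [a6 [a7 [a8 [a9 [es L1 L2 L3 c]]]]]]]]]] ps] := B3_of_quartic char0 uS n9 n5 gc.
have us : uniq [seq z.1 | z <- s] by rewrite (perm_uniq (perm_map _ ps)).
have u0 := map_uniq us; rewrite es /= !inE !negb_or !andbT in u0; split_andb.
have [|||||g ug hg] := @B3_frame K a1 a2 a3 a4 a5 a6 a7 a8 a9 _ _ _ _ _ c.
- by rewrite -es.
- have inS x : x \in s -> x \in S0 by rewrite (perm_mem ps).
  rewrite (fourline_out (col_no5 uS n5) L1) // ?inE ?eqxx ?orbT //.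
    by apply: inS; rewrite es !inE eqxx ?orbT.
  by neq_from_context.
- have [_ _ _ h1] := L1; have [_ _ _ h2] := L2.
  by split; [apply: h1|apply: h1|apply: h2|apply: h2]; rewrite !inE eqxx ?orbT.
- by have [_ _ _ h3] := L3; apply: h3; rewrite !inE eqxx ?orbT.
- by have [_ _ _ h3] := L3; apply: h3; rewrite !inE eqxx ?orbT.
rewrite -es in hg; have ss : size s = 9 by rewrite es.
pose M := invmx (mx3 b1 b2 b3) *m g.
have img P i : P \in Z -> (i < 9)%N -> aff P = s`_i ->
    (linfun (mulmxr M) @: line_of P)%VS = <[(Z0_rows K)`_i]>%VS.
  move=> PZ i9 e; rewrite affZ // limg_mulmxr.
  have [t t0 ht] := hg i i9; rewrite -[RHS](line_scale _ t0) -ht -e /M mulmxA.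
  have -> : vec b1 b2 b3 (aff P) = hom (aff P) *m mx3 b1 b2 b3 by rewrite row3_mul scale1r.
  by rewrite mulmxK.
exists M; first by rewrite unitmx_mul unitmx_inv uB.
apply/fsetP => U; apply/imfsetP/imfsetP => -[P /= PZ ->].
  have /(nthP 0)[i i9 e] : aff P \in s by rewrite (perm_mem ps) map_f.
  rewrite ss in i9; rewrite (img P i PZ i9 (esym e)).
  by have /Z0_lineP[Q QZ eQ] : exists2 j, (j < 9)%N & <[(Z0_rows K)`_i]>%VS = <[(Z0_rows K)`_j]>%VS; [exists i | exists Q].
have /Z0_lineP[i i9 e] : exists2 Q, Q \in Z0 K & line_of P = line_of Q by exists P.
have /mapP[Q QZ eQ] : s`_i \in S0 by rewrite -(perm_mem ps) mem_nth ?ss.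
by exists Q => //; rewrite (img Q i QZ i9 (esym eQ)).
Qed.

End Forward.

(** * The quartics of the nine points *)

Section Converse.
Variables (K : fieldType) (char0 : [pchar K] =i pred0).
Local Notation V := (dhomog 3 K 4).

(* [\sum_i v_i * (u x v)_i ^+ 3] with [u = (a, b, c)] and [v = (x, y, z)]. *)
Definition triple_quartic (A : comNzRingType) (a b c x y z : A) :=
  x * (b * z - c * y) ^+ 3 + y * (c * x - a * z) ^+ 3 + z * (a * y - b * x) ^+ 3.

(** A family dual to the nine points: the [i]-th quartic vanishes at all rows of [Z0_rows] except
    the [i]-th, where its value is 1 or 2 up to sign. *)
Definition separating_quartic (A : comNzRingType) (x y z : A) i :=
  [:: (y * y + z * z - x * x) * (x * x); (x * x + z * z - y * y) * (y * y);
      (x * x) * (y * (x + y)); (x * x) * (y * (x - y)); (x * x + y * y - z * z) * (z * z);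
      (x * x) * (z * (x + z)); (x * x) * (z * (x - z)); (y * y) * (z * (y - z));
      (y * y) * (z * (y + z))]`_i.

Lemma rmorph_triple_quartic (A B : comNzRingType) (phi : {rmorphism A -> B}) a b c x y z :
  phi (triple_quartic a b c x y z) =
  triple_quartic (phi a) (phi b) (phi c) (phi x) (phi y) (phi z).
Proof.
have h u v w r s : phi (u * (v * w - r * s) ^+ 3) = phi u * (phi v * phi w - phi r * phi s) ^+ 3.
  by rewrite rmorphM rmorphXn rmorphB !rmorphM.
by rewrite /triple_quartic 2!rmorphD !h.
Qed.

Lemma rmorph_separating_quartic (A B : comNzRingType) (phi : {rmorphism A -> B}) x y z i :
  (i < 9)%N -> phi (separating_quartic x y z i) = separating_quartic (phi x) (phi y) (phi z) i.
Proof.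
rewrite /separating_quartic; case: i => [|[|[|[|[|[|[|[|[|i]]]]]]]]] //= _;
  by rewrite !(rmorphD, rmorphM, rmorphN).
Qed.

Lemma two_neq0 : 2 != 0 :> K. Proof. by rewrite (pcharf0P _).1. Qed.

Lemma six_neq0 : 6 != 0 :> K. Proof. by rewrite (pcharf0P _).1. Qed.

Definition entry (v : 'rV[K]_3) (i : nat) : K := v 0 (inord i).

Lemma entry_row3 x y z : [/\ entry (row3 x y z) 0 = x, entry (row3 x y z) 1 = y & entry (row3 x y z) 2 = z].
Proof. by rewrite /entry !mxE !inordK. Qed.

(** On the line [z = 0] the quartic restricts to [c ^ 3 * x * y * (x ^ 2 - y ^ 2)], and similarly on
    the other two coordinate lines; the zeros of these products are the nine points. *)
Lemma triple_quartic_Z0 (a b c t : K) i : (i < 9)%N ->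
  triple_quartic a b c (t * entry (Z0_rows K)`_i 0) (t * entry (Z0_rows K)`_i 1)
    (t * entry (Z0_rows K)`_i 2) = 0.
Proof.
rewrite /triple_quartic.
case: i => [|[|[|[|[|[|[|[|[|i]]]]]]]]] //= _;
  match goal with |- context [row3 ?x ?y ?z] => have [-> -> ->] := entry_row3 x y z end; ring.
Qed.

Lemma separating_quartic_Z0 (t : K) i j : t != 0 -> (i < 9)%N -> (j < 9)%N ->
  (separating_quartic (t * entry (Z0_rows K)`_j 0) (t * entry (Z0_rows K)`_j 1)
    (t * entry (Z0_rows K)`_j 2) i == 0) = (i != j).
Proof.
move=> t0; have t4 : t ^+ 4 != 0 by rewrite expf_neq0.
have t42 : t ^+ 4 * 2 != 0 by rewrite mulf_neq0 ?two_neq0.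
case: j => [|[|[|[|[|[|[|[|[|j]]]]]]]]] //=;
  match goal with |- context [row3 ?x ?y ?z] => have [-> -> ->] := entry_row3 x y z end;
  case: i => [|[|[|[|[|[|[|[|[|i]]]]]]]]] //= _ _; rewrite /separating_quartic /=;
  first [ by apply/eqP; ring
        | apply/negbTE/negP => /eqP e; case/eqP: t4; rewrite -[RHS]e; ring
        | apply/negbTE/negP => /eqP e; case/eqP: t4; rewrite -[RHS]oppr0 -e; ring
        | apply/negbTE/negP => /eqP e; case/eqP: t42; rewrite -[RHS]e; ring
        | apply/negbTE/negP => /eqP e; case/eqP: t42; rewrite -[RHS]oppr0 -e; ring ].
Qed.

Variable g : 'M[K]_3.
Hypothesis ug : g \in unitmx.

Definition linear_form (i : nat) : {mpoly K[3]} := \sum_(j < 3) g j (inord i) *: 'X_j.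
Local Notation L := linear_form.

Lemma linear_form_meval i (v : 'rV[K]_3) : (L i).@[v 0] = entry (v *m g) i.
Proof.
rewrite /L /entry mxE raddf_sum /=; apply: eq_bigr => j _.
by rewrite mevalZ mevalXU mulrC.
Qed.

Lemma linear_form_homog i : L i \is 1.-homog.
Proof. by apply: rpred_sum => j _; apply: dhomogZ; rewrite dhomogX /= mdeg1. Qed.

Lemma triple_quartic_meval a b c (v : 'rV[K]_3) :
  (triple_quartic a%:MP b%:MP c%:MP (L 0) (L 1) (L 2)).@[v 0] =
  triple_quartic a b c (entry (v *m g) 0) (entry (v *m g) 1) (entry (v *m g) 2).
Proof.
by rewrite (rmorph_triple_quartic (meval (v 0))) /= !mevalC !linear_form_meval.
Qed.

Lemma separating_quartic_meval i (v : 'rV[K]_3) : (i < 9)%N ->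
  (separating_quartic (L 0) (L 1) (L 2) i).@[v 0] =
  separating_quartic (entry (v *m g) 0) (entry (v *m g) 1) (entry (v *m g) 2) i.
Proof.
by move=> i9; rewrite (rmorph_separating_quartic (meval (v 0))) //= !linear_form_meval.
Qed.

Lemma linear_form_comb a b i j : a%:MP * L i - b%:MP * L j \is 1.-homog.
Proof. by rewrite !mul_mpolyC rpredB // dhomogZ // linear_form_homog. Qed.

Lemma triple_quartic_homog a b c :
  triple_quartic a%:MP b%:MP c%:MP (L 0) (L 1) (L 2) \is 4.-homog.
Proof.
have h i p : p \is 1.-homog -> L i * p ^+ 3 \is 4.-homog.
  move=> hp; apply: (@dhomogM _ _ _ 1 _ 3); first exact: linear_form_homog.
  exact: (@dhomogMn _ _ _ 1 _ 3).
by rewrite /triple_quartic !rpredD // h // linear_form_comb.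
Qed.

Lemma separating_quartic_homog i : (i < 9)%N ->
  separating_quartic (L 0) (L 1) (L 2) i \is 4.-homog.
Proof.
have h p q : p \is 2.-homog -> q \is 2.-homog -> p * q \is 4.-homog by apply: (@dhomogM _ _ _ 2 _ 2).
have h' p q : p \is 1.-homog -> q \is 1.-homog -> p * q \is 2.-homog by apply: (@dhomogM _ _ _ 1 _ 1).
have l := linear_form_homog.
rewrite /separating_quartic; case: i => [|[|[|[|[|[|[|[|[|i]]]]]]]]] //= _; apply: h;
  repeat first [exact: l | apply: h' | apply: rpredB | apply: rpredD].
Qed.

Lemma triple_quartic_ideal P : ideal_exp (point_ideal P) 3
  (triple_quartic (entry (rep P *m g) 0)%:MP (entry (rep P *m g) 1)%:MP (entry (rep P *m g) 2)%:MP
     (L 0) (L 1) (L 2)).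
Proof.
have cube l i j : ideal_exp (point_ideal P) 3
    (L l * ((entry (rep P *m g) i)%:MP * L j - (entry (rep P *m g) j)%:MP * L i) ^+ 3).
  apply: ideal_genM; rewrite 2!exprS expr1.
  have hD : point_ideal P ((entry (rep P *m g) i)%:MP * L j - (entry (rep P *m g) j)%:MP * L i).
    apply: ideal_gen_incl; split; first by exists 1%N; apply: linear_form_comb.
    apply: (vanishes_at_line (linear_form_comb _ _ _ _) (line_of_rep P)).
    by rewrite mevalB !mevalM !mevalC !linear_form_meval mulrC subrr.
  move: hD; set D := _ - _ => hD; rewrite -[X in _ * (_ * X)]mulr1.
  exact: (ideal_expM (m := 2) hD (ideal_expM (m := 1) hD (ideal_expM (m := 0) hD I))).
rewrite /triple_quartic; apply: ideal_genD; first apply: ideal_genD; exact: cube.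
Qed.

Lemma line_eq_scale (v w : 'rV[K]_3) : v != 0 -> <[v]>%VS = <[w]>%VS -> exists2 t, t != 0 & v = t *: w.
Proof.
move=> v0 e; have /vlineP[t ht] : v \in <[w]>%VS by rewrite -e memv_line.
by exists t => //; apply: contraNneq v0 => t0; rewrite ht t0 scale0r.
Qed.

Lemma entryZ t v i : entry (t *: v) i = t * entry v i.
Proof. by rewrite /entry mxE. Qed.

Variable Z : {fset P2 K}.
Hypothesis hZ : [fset (linfun (mulmxr g) @: line_of P)%VS | P in Z]%fset
  = [fset line_of P | P in Z0 K]%fset.

Lemma rep_to_Z0 P : P \in Z -> exists i t, [/\ (i < 9)%N, t != 0 & rep P *m g = t *: (Z0_rows K)`_i].
Proof.
move=> PZ; have : (linfun (mulmxr g) @: line_of P)%VS \in [fset line_of P | P in Z0 K]%fset.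
  by rewrite -hZ; apply/imfsetP; exists P.
case/imfsetP => Q /= QZ; rewrite line_of_rep limg_mulmxr => e.
have [i i9 ei] : exists2 i, (i < 9)%N & <[rep P *m g]>%VS = <[(Z0_rows K)`_i]>%VS.
  by apply/Z0_lineP; exists Q.
have Pg : rep P *m g != 0.
  by apply: contraNneq (rep_neq0 P) => e0; rewrite -[rep P](mulmxK ug) e0 mul0mx.
by have [t t0 et] := line_eq_scale Pg ei; exists i, t.
Qed.

Lemma Z0_to_rep i : (i < 9)%N -> exists P, P \in Z /\ exists2 t, t != 0 & rep P *m g = t *: (Z0_rows K)`_i.
Proof.
move=> i9; have /Z0_lineP[Q QZ eQ] : exists2 j, (j < 9)%N & <[(Z0_rows K)`_i]>%VS = <[(Z0_rows K)`_j]>%VS.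
  by exists i.
have : line_of Q \in [fset line_of P | P in Z0 K]%fset by apply/imfsetP; exists Q.
rewrite -hZ => /imfsetP[P /= PZ]; rewrite (line_of_rep P) limg_mulmxr -eQ => e.
have Pg : rep P *m g != 0.
  by apply: contraNneq (rep_neq0 P) => e0; rewrite -[rep P](mulmxK ug) e0 mul0mx.
by exists P; split => //; apply: line_eq_scale.
Qed.

Lemma dim_quartics_through_Z0 : (\dim (fat_ideal_deg (seq_mset Z) 4) <= 6)%N.
Proof.
have ex i : exists P, (i < 9)%N -> P \in Z /\ exists2 t, t != 0 & rep P *m g = t *: (Z0_rows K)`_i.
  by have [/Z0_to_rep[P hP]|_] := ltnP i 9; [exists P | have [P _] := Z0_to_rep (isT : (0 < 9)%N); exists P].
pose Q i := projT1 (cid (ex i)); pose hQ i := projT2 (cid (ex i)).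
pose ws := [seq rep (Q i) | i <- iota 0 9].
have wsE i : (i < 9)%N -> ws`_i = rep (Q i) by move=> i9; rewrite (nth_map 0%N) ?size_iota // nth_iota.
pose G i : V := insubd (0 : V) (separating_quartic (L 0) (L 1) (L 2) i).
have GE i : (i < 9)%N -> mpoly_of_dhomog (G i) = separating_quartic (L 0) (L 1) (L 2) i.
  by move=> i9; apply: insubdK; apply: separating_quartic_homog.
have Gw i j : (i < 9)%N -> (j < 9)%N -> ((mpoly_of_dhomog (G i)).@[ws`_j 0] == 0) = (i != j).
  move=> i9 j9; rewrite GE // wsE // separating_quartic_meval //.
  by have [_ [t t0 ->]] := hQ j j9; rewrite !entryZ separating_quartic_Z0.
(* The dual quartics make evaluation at the nine points surjective, so its kernel has dimension
   [15 - 9 = 6]. *)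
have full : limg (linfun (evals ws)) = fullv.
  apply/eqP; rewrite eqEsubv subvf; apply/subvP => r _; apply/memv_imgP.
  exists (\sum_(i < size ws) (r 0 i / (mpoly_of_dhomog (G i)).@[ws`_i 0]) *: G i); first exact: memvf.
  rewrite lfunE /= linear_sum; apply/rowP => j; rewrite summxE (bigD1 j) //= big1 ?addr0 => [|i ij].
    by rewrite linearZ /= !mxE divfK // Gw ?eqxx //; exact: ltn_ord.
  have i9 : (i < 9)%N by exact: ltn_ord.
  have j9 : (j < 9)%N by exact: ltn_ord.
  by rewrite linearZ /= !mxE; have := Gw i j i9 j9; rewrite val_eqE ij => /eqP ->; rewrite mulr0.
have sub : (fat_ideal_deg (seq_mset Z) 4 <= lker (linfun (evals ws)))%VS.
  apply/subvP => F /fat_ideal_degP FI; apply/evals_kerP => w /(nthP 0)[i i9 <-]; rewrite wsE //.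
  have [QZ _] := hQ i i9; have := FI (Q i); rewrite mset_seqE count_uniq_mem ?fset_uniq // [_ \in _]QZ.
  by move/ideal_exp_vanishes; apply; rewrite line_of_rep memv_line.
apply: leq_trans (dimvS sub) _.
have := limg_ker_dim (linfun (evals ws)) fullv.
rewrite capfv full dim_quartics dimvf /dim /=.
by move=> e; rewrite -(leq_add2r 9) e.
Qed.

Theorem Z0_admits_unexpected_quartic : admits_unexpected_curve Z 4.
Proof.
(* All nine points lie on the three coordinate lines of the frame, so a [P] off these lines is not
   in [Z]. The expected dimension is 0, and one nonzero quartic is enough. *)
pose f := L 0 * (L 1 * L 2).
have fh : f \is 3.-homog.
  by apply: (@dhomogM _ _ _ 1 _ 2); [|apply: (@dhomogM _ _ _ 1 _ 1)]; apply: linear_form_homog.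
pose A P := f.@[rep P 0] != 0.
have AE P : A P <-> ~ vanishes_at f P.
  split=> [/eqP fP vP|nv]; first by apply/fP/vP; rewrite line_of_rep memv_line.
  by apply/eqP => e; apply/nv/(vanishes_at_line fh (line_of_rep P) e).
exists A; split.
- exists (fun h => h = f) => [h ->|P]; first by exists 3%N.
  by rewrite AE; split=> [nn h ->|h]; [apply: contrapT | move=> /(_ (h f erefl))].
- have v0 : row3 1 1 1 *m invmx g != 0 :> 'rV[K]_3.
    apply/eqP => /(congr1 (fun v => v *m g)); rewrite mulmxKV // mul0mx => /eqP.
    by rewrite row3_eq0 oner_eq0.
  have [P eP] := P2_of_vector v0; exists P; apply/AE => /(_ (row3 1 1 1 *m invmx g)).
  rewrite eP memv_line /f !mevalM !linear_form_meval mulmxKV // => /(_ isT)/eqP.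
  by have [-> -> ->] := entry_row3 1 1 1; rewrite !mul1r oner_eq0.
move=> P; rewrite /A /f !mevalM !linear_form_meval !mulf_eq0 !negb_or => /and3P[a0 b0 c0].
set a := entry _ 0 in a0 *; set b := entry _ 1 in b0 *; set c := entry _ 2 in c0 *.
have Fh := triple_quartic_homog a b c.
set F := triple_quartic _ _ _ _ _ _ in Fh.
pose F' : V := DHomog Fh.
have PZ : P \notin Z.
  apply/negP => /rep_to_Z0[i [t [i9 t0 e]]]; move: a0 b0 c0.
  rewrite /a /b /c e !entryZ !mulf_eq0 !negb_or !t0 /=.
  by case: i i9 {e} => [|[|[|[|[|[|[|[|[|i]]]]]]]]] //= _;
    match goal with |- context [row3 ?x ?y ?z] => have [-> -> ->] := entry_row3 x y z end;
    rewrite ?eqxx.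
(* At [(1, 2, 0)] the restriction to [z = 0] takes the value [- 6 * c ^ 3], nonzero because [P] is
   off that line. *)
have F'0 : F' != 0.
  apply/eqP => /(congr1 (fun H => (mpoly_of_dhomog H).@[(row3 1 2 0 *m invmx g) 0])) /=.
  rewrite meval0 /F triple_quartic_meval mulmxKV //.
  have [-> -> ->] := entry_row3 1 2 0; rewrite /triple_quartic => e.
  have : - 6 * c ^+ 3 = 0 by rewrite -[RHS]e; ring.
  by apply/eqP; rewrite mulf_neq0 ?oppr_eq0 ?six_neq0 ?expf_neq0.
have F'I : F' \in fat_ideal_deg (seq_mset Z `+` msetn 3 P)%mset 4.
  apply/fat_ideal_degP => Q; rewrite msetE2 mset_seqE count_uniq_mem ?fset_uniq // msetnE.
  have [->|QP] := eqVneq Q P.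
    by rewrite [P \in _](negPf PZ); apply: triple_quartic_ideal.
  have [QZ|QZ] := boolP (Q \in enum_fset Z); last by [].
  apply: ideal_exp1; first by exists 4%N.
  apply: (vanishes_at_line Fh (line_of_rep Q)); rewrite /F triple_quartic_meval.
  by have [i [t [i9 t0 ->]]] := rep_to_Z0 QZ; rewrite !entryZ triple_quartic_Z0.
have d1 : (0 < \dim (fat_ideal_deg (seq_mset Z `+` msetn 3 P)%mset 4))%N.
  rewrite lt0n dimv_eq0; apply: contraNneq F'0 => e; move: F'I; rewrite e memv0.
  by [].
have d2 := dim_quartics_through_Z0.
have key (m n : nat) : (0 < m)%N -> (n <= 6)%N -> Num.max (n%:Z - 'C(4, 2)%:Z) 0 < m%:Z.
  by move=> m0 n6; rewrite (_ : 'C(4, 2) = 6%N) // Order.TotalTheory.gt_max; apply/andP; split; lia.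
exact: key d1 d2.
Qed.

End Converse.

Local Open Scope fset_scope.

Theorem theorem1p6 (R : realType) (Z : {fset P2 R[i]}) :
  admits_unexpected_curve Z 4 <-> projectively_equivalent Z (Z0 R[i]).
Proof.
have char0 := pchar_num R[i].
split=> [|[g ug hZ]]; first exact: unexpected_quartic_classification.
by apply: (Z0_admits_unexpected_quartic char0 ug).
Qed.
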